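(* Let $n>2$ and let $\Lambda$ be an $n$-vector field on a smooth manifold $M$. Then $\Lambda$ is a Nambu-Poisson tensor (of order $n$) if and only if for every $f\in C^\infty(M)$ the contraction $\Lambda_f=i_{df}\Lambda$ is a Nambu-Poisson tensor (of order $n-1$). In this case, around each regular point of $\Lambda$ there are local coordinates $(x_1,\dots,x_m)$ on $M$, $m=\dim M$, in which $\Lambda=\partial_1\wedge\dots\wedge\partial_n$, where $\partial_i=\partial/\partial x_i$.
   Context: $M$ is a smooth (finite-dimensional, real) manifold, and all functions, vector fields and multivector fields are smooth. For a $k$-vector field $\Lambda$ and functions $f_1,\dots,f_j\in C^\infty(M)$, $j\le k$, write $\Lambda_{f_1,\dots,f_j}=i_{df_j}\cdots i_{df_1}\Lambda$ for the iterated contraction, a $(k-j)$-vector field. A $k$-vector field $\Lambda$ ($k\ge 2$) is called a Nambu-Poisson tensor (of order $k$) if the $k$-linear skew-symmetric bracket $\{f_1,\dots,f_k\}=\Lambda_{f_1,\dots,f_k}$ on $C^\infty(M)$ satisfies the generalized Jacobi identity $$\{f_1,\dots,f_{k-1},\{g_1,\dots,g_k\}\}=\sum_{i=1}^k\{g_1,\dots,g_{i-1},\{f_1,\dots,f_{k-1},g_i\},g_{i+1},\dots,g_k\}$$ for all $f_1,\dots,f_{k-1},g_1,\dots,g_k\in C^\infty(M)$. For $k=2$ these are the ordinary Poisson tensors. A regular point of $\Lambda$ is a point at which $\Lambda$ does not vanish. *)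

(* Defs.v *)
From mathcomp Require Import all_boot all_order all_algebra.
From mathcomp Require Import all_classical all_reals all_analysis.

Set Implicit Arguments.
Unset Strict Implicit.
Unset Printing Implicit Defensive.

Import Order.TTheory GRing.Theory Num.Theory.
Import numFieldNormedType.Exports.

Local Open Scope classical_set_scope.
Local Open Scope ring_scope.

(* The model space R^m is 'rV[R]_m; its dual is 'cV[R]_m, the pairing of v and
   w being the entry of v *m w. *)

Definition partial (R : realType) (m : nat) (i : 'I_m)
    (f : 'rV[R]_m -> R) : 'rV[R]_m -> R :=
  'D_(delta_mx 0 i) f.

(* C^k on U.  Meant for U open: every condition only involves the germs of f
   at points of U, so the values of f outside U are irrelevant. *)
Fixpoint Ck_on (R : realType) (m k : nat) (U : set 'rV[R]_m)
    (f : 'rV[R]_m -> R) : Prop :=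
  (forall x, U x -> {for x, continuous f}) /\
  if k is k'.+1 then
    forall i : 'I_m, (forall x, U x -> derivable f x (delta_mx 0 i)) /\
                     Ck_on k' U (partial i f)
  else True.

Definition smooth_on (R : realType) (m : nat) (U : set 'rV[R]_m)
    (f : 'rV[R]_m -> R) : Prop :=
  forall k, Ck_on k U f.

(* A homeomorphism [cmap] from the open set [cdom] of M onto the open set [cod]
   of R^m, with inverse [cinv]; both maps are total functions whose values
   outside [cdom], resp. [cod], are junk. *)
Record chart (R : realType) (m : nat) (M : topologicalType) := Chart {
  cdom : set M;
  cod : set 'rV[R]_m;
  cmap : M -> 'rV[R]_m;
  cinv : 'rV[R]_m -> M;
  cdom_open : open cdom;
  cod_open : open cod;
  cmap_cod : forall p, cdom p -> cod (cmap p);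
  cinv_dom : forall x, cod x -> cdom (cinv x);
  cmapK : forall p, cdom p -> cinv (cmap p) = p;
  cinvK : forall x, cod x -> cmap (cinv x) = x;
  cmap_continuous : forall p, cdom p -> {for p, continuous cmap};
  cinv_continuous : forall x, cod x -> {for x, continuous cinv} }.

Definition smooth_transition (R : realType) (m : nat) (M : topologicalType)
    (c c' : chart R m M) : Prop :=
  forall j : 'I_m,
    smooth_on (cod c `&` cinv c @^-1` cdom c')
              (fun x => cmap c' (cinv c x) 0 j).

(* The atlas need not be maximal.
   [chart_at] only serves to represent tangent spaces: it selects one atlas
   chart around each point, with no continuity in the point. *)
Record manifold (R : realType) (m : nat) := Manifold {
  carrier :> topologicalType;
  carrier_hausdorff : hausdorff_space carrier;
  carrier_second_countable : @second_countable carrier;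
  atlas : set (chart R m carrier);
  atlas_compatible :
    forall c c', atlas c -> atlas c' -> smooth_transition c c';
  chart_at : carrier -> chart R m carrier;
  chart_at_atlas : forall p, atlas (chart_at p);
  chart_at_dom : forall p, cdom (chart_at p) p }.

(* Local coordinates on M: charts of the maximal atlas. *)
Definition local_coordinates (R : realType) (m : nat) (M : manifold R m)
    (c : chart R m M) : Prop :=
  forall c', atlas c' -> smooth_transition c c' /\ smooth_transition c' c.

Definition smooth (R : realType) (m : nat) (M : manifold R m)
    (f : M -> R) : Prop :=
  forall c, atlas c -> smooth_on (cod c) (f \o cinv c).

(* T_pM and its dual: classes of (chart, vector) pairs at p modulo the
   Jacobians of the transition maps, each represented by its component in the
   chart [chart_at p]. *)
Definition tangent (R : realType) (m : nat) (M : manifold R m) (p : M) :=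
  'rV[R]_m.
Definition cotangent (R : realType) (m : nat) (M : manifold R m) (p : M) :=
  'cV[R]_m.

Definition pairing (R : realType) (m : nat) (M : manifold R m) (p : M)
    (w : cotangent p) (v : tangent p) : R :=
  ((v : 'rV[R]_m) *m (w : 'cV[R]_m)) 0 0.

(* df at p; f need only be defined (and differentiable) near p. *)
Definition differential (R : realType) (m : nat) (M : manifold R m)
    (f : M -> R) (p : M) : cotangent p :=
  \col_(i < m) partial i (f \o cinv (chart_at p)) (cmap (chart_at p) p).

(* Meaningful on [cdom c] only. *)
Definition coord (R : realType) (m : nat) (M : manifold R m)
    (c : chart R m M) (i : 'I_m) : M -> R :=
  fun p => cmap c p 0 i.

(* The coordinate vector d/dx_i of the chart c at p, for p in [cdom c]. *)
Definition coord_vector (R : realType) (m : nat) (M : manifold R m)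
    (c : chart R m M) (i : 'I_m) (p : M) : tangent p :=
  \row_(j < m) partial i (coord (chart_at p) j \o cinv c) (cmap c p).

(* Elements of the k-th exterior power of T_pM are identified with the
   alternating k-linear forms on the cotangent space (see [alternating]). *)
Definition multivector (R : realType) (m : nat) (M : manifold R m)
    (k : nat) (p : M) :=
  ('I_k -> cotangent p) -> R.

Definition alternating (R : realType) (V : lmodType R) (k : nat)
    (A : ('I_k -> V) -> R) : Prop :=
  (forall (w : 'I_k -> V) (i : 'I_k) (a : R) (x y : V),
     A (dfwith w i (a *: x + y)) =
     a * A (dfwith w i x) + A (dfwith w i y)) /\
  (forall (w : 'I_k -> V) (i j : 'I_k), i != j -> w i = w j -> A w = 0).

(* Smoothness: the components L(dx_{I 0}, ..., dx_{I (k-1)}) in every atlas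
   chart are smooth functions of the coordinates. *)
Definition multivector_field (R : realType) (m : nat) (M : manifold R m)
    (k : nat) (L : forall p : M, multivector k p) : Prop :=
  (forall p, @alternating R 'cV[R]_m k (L p)) /\
  (forall c, atlas c -> forall I : 'I_k -> 'I_m,
     smooth_on (cod c)
       (fun x => L (cinv c x)
                   (fun a => differential (coord c (I a)) (cinv c x)))).

(* (x, w_0, ..., w_{k-2}); since i < k the default value x of the second
   branch is never used. *)
Definition fcons (T : Type) (k : nat) (x : T) (w : 'I_k.-1 -> T) : 'I_k -> T :=
  fun i => if (i : nat) is j.+1 then oapp w x (insub j) else x.

(* (w_0, ..., w_{k-2}, x) *)
Definition frcons (T : Type) (k : nat) (w : 'I_k.-1 -> T) (x : T) : 'I_k -> T :=
  fun i => oapp w x (insub (i : nat)).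

(* i_{df} L = L(df, ...) *)
Definition interior_product (R : realType) (m : nat) (M : manifold R m) (k : nat)
    (L : forall p : M, multivector k p) (f : M -> R)
    : forall p : M, multivector k.-1 p :=
  fun p w => L p (fcons (differential f p) w).

(* {f_0, ..., f_{k-1}}.  As i_{df} fills the first remaining slot, the iterated
   contraction i_{df_{k-1}} ... i_{df_0} L is L(df_0, ..., df_{k-1}). *)
Definition bracket (R : realType) (m : nat) (M : manifold R m) (k : nat)
    (L : forall p : M, multivector k p) (f : 'I_k -> M -> R) : M -> R :=
  fun p => L p (fun i => differential (f i) p).

Definition nambu_poisson (R : realType) (m : nat) (M : manifold R m) (k : nat)
    (L : forall p : M, multivector k p) : Prop :=
  [/\ (2 <= k)%N,
      multivector_field L &
      forall (f : 'I_k.-1 -> M -> R) (g : 'I_k -> M -> R),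
        (forall i, smooth (f i)) -> (forall i, smooth (g i)) ->
        forall p : M,
          bracket L (frcons f (bracket L g)) p =
          \sum_(i < k)
            bracket L (dfwith g i (bracket L (frcons f (g i)))) p].

Definition regular_point (R : realType) (m : nat) (M : manifold R m) (k : nat)
    (L : forall p : M, multivector k p) (p : M) : Prop :=
  L p <> (fun=> 0).

(* v_0 /\ ... /\ v_{k-1}, normalised by
   (v_0 /\ ... /\ v_{k-1})(w_0, ..., w_{k-1}) = det (w_a (v_b)). *)
Definition wedge (R : realType) (m : nat) (M : manifold R m) (k : nat) (p : M)
    (v : 'I_k -> tangent p) : multivector k p :=
  fun w => \det (\matrix_(a < k, b < k) pairing (w a) (v b)).

(* Main.v *)
(** The generalized Jacobi identity of L_f is that of L with f among both the
    f_i and the g_i.  If it holds for all f, the Jacobiator of L is therefore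
    totally alternating in its 2n - 1 arguments.  Testing it on squares of
    functions vanishing at p gives quadratic relations on L_p, which for n > 2
    make L_p decomposable.  Hence it suffices to take as arguments n functions
    with nonzero bracket and functions whose differentials are annihilated by
    L_p.  Among 2n - 1 > n of these, either two coincide, and alternation applies,
    or at least two are annihilated; alternation moves those among the g_i, where
    decomposability makes each term of the identity vanish.

    Local form: choose y_i with {y_1, ..., y_n} <> 0 at p and rectify the field
    {., y_2, ..., y_n}; this gives y_1 with {y_1, ..., y_n} = 1.  The generalized
    Jacobi identity makes the n fields {y_1, ..., ., ..., y_n} commute, and a
    simultaneous rectification of them, together with decomposability, is the
    required chart.

    Flows are obtained without integrating differential equations, as limits of
    the Euler iterates (id + X/N)^N: the derivative of an Euler iterate is an
    Euler iterate of the tangent field, so convergence holds in C^k for all k,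
    and discrete Gronwall estimates compare derivatives in the parameters with the
    field itself. *)

From mathcomp Require Import all_boot all_order all_algebra all_fingroup.
From mathcomp Require Import all_classical all_reals all_analysis.
From mathcomp Require Import ring lra.
From HB Require Import structures.
Require Import Defs.

Set Implicit Arguments.
Unset Strict Implicit.
Unset Printing Implicit Defensive.

Import Order.TTheory GRing.Theory Num.Theory.
Import numFieldNormedType.Exports.

Local Open Scope classical_set_scope.
Local Open Scope ring_scope.

(** * Calculus in R^m *)

Section MeanValue.
Variable R : realType.

(** The Jacobiator is not tensorial. If [x] vanishes at [p], then [x^2] has zero differential at
    [p], but [{.., x^2, ..} = 2x{.., x, ..}] has the differential [2{.., x, ..}dx]. A square among
    the [g_i] contributes two such terms, which cancel identically; a square among the [f_i] leaves
    a genuine quadratic expression. Exchanging the two places by alternation shows that this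
    expression is zero. For the same reason arguments are decomposed with constant coefficients, and
    annihilation holds at the single point [p]: the determinant formula, valid near [p], then has
    two rows vanishing at [p], so that its differential vanishes there.

    The rectifying map is not a composition of flows but the time-one map of [sum s_i X_i], the
    [s_i] being carried as constant components of the state: smoothness in the parameters becomes
    smoothness in the initial point. A cutoff makes the fields bounded on the whole space, which
    confines the Euler iterates. Since the identity concerns global functions, coordinates are
    extended from charts by bump functions. *)

Lemma coord_le_norm (m : nat) (x : 'rV[R]_m) j : `|x 0 j| <= `|x|.
Proof.
rewrite [leRHS]/Num.Def.normr/= mx_normrE.
exact: (le_bigmax _ (fun ij : 'I_1 * 'I_m => `|x ij.1 ij.2|) (0, j)).
Qed.

Lemma norm_le_coord (m : nat) (x : 'rV[R]_m) (r : R) :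
  0 <= r -> (forall j, `|x 0 j| <= r) -> `|x| <= r.
Proof.
move=> r0 xr; rewrite [leLHS]/Num.Def.normr/= mx_normrE.
by rewrite bigmax_le// => -[i j] _; rewrite (ord1 i) /=.
Qed.

(** The one-variable mean value theorem on the coordinate line through [x]. Both signs of [h] are
    covered, hence the disjunction on the range of [t]. *)
Lemma mean_value_coord (m : nat) (f : 'rV[R]_m -> R) (x : 'rV[R]_m) (i : 'I_m)
    (h c e : R) :
  (forall t, (0 <= t <= h) || (h <= t <= 0) ->
     derivable f (x + t *: delta_mx 0 i) (delta_mx 0 i) /\
     `|partial i f (x + t *: delta_mx 0 i) - c| <= e) ->
  `|f (x + h *: delta_mx 0 i) - f x - h * c| <= e * `|h|.
Proof.
set v := delta_mx 0 i => H.
pose g t := f (x + t *: v).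
have drv t : (0 <= t <= h) || (h <= t <= 0) -> is_derive t 1 g (partial i f (x + t *: v)).
  move=> /H [df _].
  have E : (fun s : R => g (s *: (1 : R) + t)) = (fun s => f (s *: v + (x + t *: v))).
    apply/funext => s; rewrite /g.
    by rewrite [s%:A]mulr1 scalerDl addrCA.
  have dg : derivable g t 1.
    by apply: (derivable1P _ _ _).2; rewrite E; apply: (derivable1P _ _ _).1.
  apply: DeriveDef => //; rewrite /partial /derive.
  have -> // : (fun h : R => h^-1 *: ((g \o shift t) (h *: (1 : R)) - g t)) =
    (fun h => h^-1 *: ((f \o shift (x + t *: v)) (h *: v) - f (x + t *: v))).
  by apply/funext => s /=; rewrite (congr1 (fun F => F s) E).
have cg t : (0 <= t <= h) || (h <= t <= 0) -> {for t, continuous g}.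
  by move=> /drv dt; apply/differentiable_continuous/derivable1_diffP; case: dt.
have [h0|h0|->] := ltgtP h 0; last first.
- by rewrite scale0r addr0 subrr mul0r subr0 normr0 mulr0.
- have [||t] := @MVT R g (fun t => partial i f (x + t *: v)) 0 h h0.
  + by move=> t; rewrite in_itv/= => /andP[t0 th]; apply: drv; rewrite (ltW t0) (ltW th).
  + apply: continuous_in_subspaceT => t; rewrite inE/= in_itv/= => th.
    by apply: cg; rewrite th.
  rewrite in_itv/= => /andP[t0 th].
  rewrite /g subr0 scale0r addr0 => ->; rewrite mulrC -mulrBr normrM mulrC.
  by apply: ler_wpM2r => //; apply: (H t _).2; rewrite (ltW t0) (ltW th).
- have [||t] := @MVT R g (fun t => partial i f (x + t *: v)) h 0 h0.
  + by move=> t; rewrite in_itv/= => /andP[t0 th]; apply: drv; rewrite (ltW t0) (ltW th) orbT.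
  + apply: continuous_in_subspaceT => t; rewrite inE/= in_itv/= => th.
    by apply: cg; rewrite th orbT.
  rewrite in_itv/= => /andP[t0 th].
  rewrite /g sub0r scale0r addr0 => E.
  rewrite -(opprB (f x)) E mulrN opprK mulrC -mulrBr normrM mulrC.
  by apply: ler_wpM2r => //; apply: (H t _).2; rewrite (ltW t0) (ltW th) orbT.
Qed.

(** From [x] to [y] one coordinate is changed at a time. The norm being the sup norm, this path
    stays in the ball, so that bounds on the partial derivatives are enough and no total
    differential enters. *)
Lemma mean_value (m : nat) (f : 'rV[R]_m -> R) (x0 : 'rV[R]_m) (r e : R)
    (c : 'I_m -> R) :
  (forall z, `|z - x0| <= r -> forall i, derivable f z (delta_mx 0 i) /\
     `|partial i f z - c i| <= e) ->
  forall x y, `|x - x0| <= r -> `|y - x0| <= r ->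
  `|f y - f x - \sum_i (y - x) 0 i * c i| <= e * \sum_i `|(y - x) 0 i|.
Proof.
move=> H x y xr yr.
have r0 : 0 <= r by apply: le_trans xr.
pose z k : 'rV[R]_m := \row_i (if (i < k)%N then y 0 i else x 0 i).
have zr k : `|z k - x0| <= r.
  apply: norm_le_coord => // j; rewrite !mxE.
  by case: ifP => _; [move: yr|move: xr]; apply: le_trans;
    rewrite (le_trans _ (coord_le_norm _ j))// !mxE.
have zS (i : 'I_m) : z i.+1 = z i + (y - x) 0 i *: delta_mx 0 i.
  apply/rowP => j; rewrite !mxE eqxx /= ltnS -val_eqE /=.
  case: (ltngtP (val j) (val i)) => [ji|ji|/val_inj ->].
  - by rewrite mulr0 addr0.
  - by rewrite mulr0 addr0.
  - by rewrite mulr1 addrC subrK.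
have step (i : 'I_m) : `|f (z i.+1) - f (z i) - (y - x) 0 i * c i| <= e * `|(y - x) 0 i|.
  rewrite zS; apply: mean_value_coord => t th; apply: H.
  apply: norm_le_coord => // j; rewrite !mxE eqxx/= -val_eqE /=.
  have [/val_inj ->|ji] := eqVneq (val j) (val i); last first.
    rewrite mulr0 addr0; move: (zr i) => /(le_trans (coord_le_norm _ j)).
    by rewrite !mxE.
  rewrite ltnn mulr1.
  move: (le_trans (coord_le_norm _ i) xr) (le_trans (coord_le_norm _ i) yr).
  move: th; rewrite !mxE !ler_norml => /orP[] /andP[h1 h2] /andP[h3 h4] /andP[h5 h6].
    by apply/andP; split; lra.
  by apply/andP; split; lra.
have zm : z m = y by apply/rowP => j; rewrite mxE ltn_ord.
have z0 : z 0%N = x by apply/rowP => j; rewrite mxE.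
have -> : f y - f x = \sum_(i < m) (f (z i.+1) - f (z i)).
  rewrite -{1}zm -{1}z0 -(telescope_sumr (f \o z))//.
  by rewrite big_mkord.
rewrite -sumrB mulr_sumr; apply: le_trans (ler_norm_sum _ _ _) _.
by apply: ler_sum => i _; exact: step.
Qed.

Lemma sum_norm_coord (m : nat) (x : 'rV[R]_m) : \sum_i `|x 0 i| <= m%:R * `|x|.
Proof.
apply: le_trans (_ : \sum_(i < m) `|x| <= _).
  by apply: ler_sum => i _; exact: coord_le_norm.
by rewrite sumr_const card_ord mulr_natl.
Qed.

End MeanValue.

Section LinearForm.
Variables (R : realType) (m : nat) (c : 'I_m -> R).

(** The candidate for the total differential, with [c] the partial derivatives; the linear structure
    declared below allows comparison with ['d f x]. *)
Definition lform (v : 'rV[R]_m) : R := \sum_i v 0 i * c i.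

Lemma lform_is_linear : linear lform.
Proof.
move=> a x y; rewrite /lform scaler_sumr -big_split/=; apply: eq_bigr => i _.
by rewrite !mxE mulrDl -mulrA.
Qed.

HB.instance Definition _ := GRing.isLinear.Build R 'rV[R]_m R *:%R lform lform_is_linear.

Lemma lform_bound v : `|lform v| <= (\sum_i `|c i|) * `|v|.
Proof.
apply: le_trans (ler_norm_sum _ _ _) _.
rewrite mulr_suml; apply: ler_sum => i _.
by rewrite normrM mulrC ler_wpM2l// coord_le_norm.
Qed.

Lemma lform_continuous : continuous lform.
Proof.
apply: (linear_bounded_continuous lform).1.
apply: (linear_boundedP lform).2; near=> M => x.
apply: le_trans (lform_bound x) _; apply: ler_wpM2r => //.
Unshelve. all: by end_near. Qed.

End LinearForm.

(** * Functions of class C^k and the chain rule *)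

Section Smooth.
Variable R : realType.

Lemma Ck_on_subset m k (U V : set 'rV[R]_m) f :
  V `<=` U -> Ck_on k U f -> Ck_on k V f.
Proof.
move=> VU; elim: k f => [|k IH] f [cf H].
  by split=> // x /VU /cf.
split=> [x /VU /cf//|i]; have [df pf] := H i.
by split=> [x /VU /df//|]; exact: IH.
Qed.

(** The set [V] need be neither open nor contained in [U]: [Ck_on] is a conjunction of conditions at
    single points, each on the germ of an iterated partial derivative. *)
Lemma Ck_on_local m k (U : set 'rV[R]_m) f :
  (forall x, U x -> exists V, V x /\ Ck_on k V f) -> Ck_on k U f.
Proof.
elim: k f => [|k IH] f H.
  by split=> // x /H [V [Vx [/(_ _ Vx)]]].
split=> [x /H [V [Vx [/(_ _ Vx)]]] //|i]; split=> [x /H [V [Vx [_ /(_ i)]]]|].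
  by case=> /(_ _ Vx).
apply: IH => x /H [V [Vx [_ /(_ i)]]] [_ HV].
by exists V.
Qed.

Lemma Ck_onW m k (U : set 'rV[R]_m) f : Ck_on k.+1 U f -> Ck_on k U f.
Proof.
elim: k f => [|k IH] f [cf H]; first by split.
split=> // i; have [df pf] := H i; split=> //; exact: IH.
Qed.

Lemma Ck_on_cont m k (U : set 'rV[R]_m) f x :
  Ck_on k U f -> U x -> {for x, continuous f}.
Proof. by case: k => [|k] [cf _]; exact: cf. Qed.

Lemma near_continuous_for (m : nat) (f g : 'rV[R]_m -> R) x :
  {near x, f =1 g} -> {for x, continuous f} -> {for x, continuous g}.
Proof.
move=> fg cf; rewrite /prop_for /continuous_at -(nbhs_singleton fg).
exact: cvg_trans (near_eq_cvg fg) cf.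
Qed.

Lemma open_near_eq (T : topologicalType) (S : Type) (U : set T) (f g : T -> S) x :
  open U -> (forall y, U y -> f y = g y) -> U x -> {near x, f =1 g}.
Proof.
move=> oU fg Ux; have : nbhs x U by exact: open_nbhs_nbhs.
by apply: filterS => y /fg.
Qed.

Lemma eq_partial m (U : set 'rV[R]_m) f g i x : open U ->
  (forall y, U y -> f y = g y) -> U x -> partial i f x = partial i g x.
Proof. by move=> oU fg Ux; apply: near_eq_derive; exact: open_near_eq fg Ux. Qed.

Lemma eq_Ck_on m k (U : set 'rV[R]_m) f g : open U ->
  (forall x, U x -> f x = g x) -> Ck_on k U f -> Ck_on k U g.
Proof.
move=> oU; elim: k f g => [|k IH] f g fg [cf H].
  by split=> // x Ux; apply: near_continuous_for (cf _ Ux); exact: open_near_eq fg Ux.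
split=> [x Ux|i].
  by apply: near_continuous_for (cf _ Ux); exact: open_near_eq fg Ux.
have [df pf] := H i; split=> [x Ux|].
  by apply: near_eq_derivable (df _ Ux); exact: open_near_eq fg Ux.
apply: IH pf => x Ux; exact: eq_partial fg Ux.
Qed.

Lemma eq_smooth_on m (U : set 'rV[R]_m) f g : open U ->
  (forall x, U x -> f x = g x) -> smooth_on U f -> smooth_on U g.
Proof. by move=> oU fg sf k; apply: eq_Ck_on (sf k). Qed.

Lemma smooth_on_subset m (U V : set 'rV[R]_m) f :
  V `<=` U -> smooth_on U f -> smooth_on V f.
Proof. by move=> VU sf k; apply: Ck_on_subset (sf k). Qed.

Lemma smooth_on_local m (U : set 'rV[R]_m) f :
  (forall x, U x -> exists V, V x /\ smooth_on V f) -> smooth_on U f.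
Proof.
by move=> H k; apply: Ck_on_local => x /H [V [Vx sV]]; exists V; split.
Qed.

Lemma smooth_on_partial m (U : set 'rV[R]_m) f i :
  smooth_on U f -> smooth_on U (partial i f).
Proof. by move=> sf k; have [_ /(_ i) []] := sf k.+1. Qed.

Lemma smooth_on_derivable m (U : set 'rV[R]_m) f i x :
  smooth_on U f -> U x -> derivable f x (delta_mx 0 i).
Proof. by move=> sf Ux; have [_ /(_ i) [/(_ _ Ux)]] := sf 1%N. Qed.

Lemma smooth_on_cont m (U : set 'rV[R]_m) f x :
  smooth_on U f -> U x -> {for x, continuous f}.
Proof. by move=> sf; exact: Ck_on_cont (sf 0%N). Qed.

Lemma Ck_on_cst m k (U : set 'rV[R]_m) (a : R) : Ck_on k U (fun=> a).
Proof.
elim: k a => [|k IH] a; first by split=> // x _; exact: cst_continuous.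
split=> [x _|i]; first exact: cst_continuous.
split=> [x _|]; first exact: derivable_cst.
rewrite (_ : partial i _ = fun=> 0)//; apply/funext => x.
by rewrite /partial derive_cst.
Qed.

Lemma Ck_on_add m k (U : set 'rV[R]_m) f g : open U ->
  Ck_on k U f -> Ck_on k U g -> Ck_on k U (fun x => f x + g x).
Proof.
move=> oU; elim: k f g => [|k IH] f g [cf Hf] [cg Hg].
  by split=> // x Ux; exact: (continuousD (cf _ Ux) (cg _ Ux)).
split=> [x Ux|i]; first by exact: (continuousD (cf _ Ux) (cg _ Ux)).
have [df pf] := Hf i; have [dg pg] := Hg i.
split=> [x Ux|]; first by apply: derivableD; [exact: df|exact: dg].
apply: (eq_Ck_on oU _ (IH _ _ pf pg)) => x Ux.
by rewrite /partial -deriveD//; [exact: df|exact: dg].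
Qed.

Lemma Ck_on_mul m k (U : set 'rV[R]_m) f g : open U ->
  Ck_on k U f -> Ck_on k U g -> Ck_on k U (fun x => f x * g x).
Proof.
move=> oU; elim: k f g => [|k IH] f g hf hg; have [cf Hf] := hf; have [cg Hg] := hg.
  by split=> // x Ux; exact: (continuousM (cf _ Ux) (cg _ Ux)).
split=> [x Ux|i]; first by exact: (continuousM (cf _ Ux) (cg _ Ux)).
have [df pf] := Hf i; have [dg pg] := Hg i.
split=> [x Ux|]; first by apply: derivableM; [exact: df|exact: dg].
have H := Ck_on_add oU (IH _ _ (Ck_onW hf) pg) (IH _ _ (Ck_onW hg) pf).
apply: (eq_Ck_on oU _ H) => x Ux.
by rewrite /partial deriveM//; [exact: df|exact: dg].
Qed.

Lemma Ck_on_sum m k (U : set 'rV[R]_m) (I : Type) (r : seq I) (P : pred I) F :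
  open U -> (forall i, P i -> Ck_on k U (F i)) ->
  Ck_on k U (fun x => \sum_(i <- r | P i) F i x).
Proof.
move=> oU H; elim: r => [|i r IH].
  by under eq_fun do rewrite big_nil; exact: Ck_on_cst.
under eq_fun do rewrite big_cons.
have [Pi|_] := boolP (P i); last exact: IH.
by apply: Ck_on_add => //; exact: H.
Qed.

Lemma Ck_on_prod m k (U : set 'rV[R]_m) (I : Type) (r : seq I) (P : pred I) F :
  open U -> (forall i, P i -> Ck_on k U (F i)) ->
  Ck_on k U (fun x => \prod_(i <- r | P i) F i x).
Proof.
move=> oU H; elim: r => [|i r IH].
  by under eq_fun do rewrite big_nil; exact: Ck_on_cst.
under eq_fun do rewrite big_cons.
have [Pi|_] := boolP (P i); last exact: IH.
by apply: Ck_on_mul => //; exact: H.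
Qed.

Lemma Ck_on_inv m k (U : set 'rV[R]_m) f : open U ->
  (forall x, U x -> f x != 0) -> Ck_on k U f -> Ck_on k U (fun x => (f x)^-1).
Proof.
move=> oU f0; elim: k => [|k IH] hf; have [cf Hf] := hf.
  by split=> // x Ux; exact: (continuousV (f0 _ Ux) (cf _ Ux)).
split=> [x Ux|i]; first by exact: (continuousV (f0 _ Ux) (cf _ Ux)).
have [df pf] := Hf i; have hg := IH (Ck_onW hf).
split=> [x Ux|]; first by apply: derivableV; [exact: f0|exact: df].
have H := Ck_on_mul oU (Ck_on_cst k U (-1)) (Ck_on_mul oU (Ck_on_mul oU hg hg) pf).
apply: (eq_Ck_on oU _ H) => x Ux.
rewrite /partial deriveV//; [|exact: f0|exact: df].
by rewrite expr2 invfM mulN1r scaleNr.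
Qed.

Lemma is_derive_coord m (x v : 'rV[R]_m) j :
  is_derive x v (fun x : 'rV[R]_m => x 0 j) (v 0 j).
Proof.
have E : v = \matrix_(i < 1, j < m) 'D_v (fun t : 'rV[R]_m => t i j) x.
  have := @derive_mx R 'rV[R]_m 1 m id x v (@derivable_id R 'rV[R]_m x v).
  by rewrite derive_id.
apply: DeriveDef; last by rewrite [in RHS]E mxE.
exact: (derivable_mxP id x v).1 (@derivable_id R 'rV[R]_m x v) 0 j.
Qed.

Lemma partial_coord m (x : 'rV[R]_m) i j :
  partial i (fun x => x 0 j) x = (j == i)%:R.
Proof.
by have [_] := is_derive_coord x (delta_mx 0 i) j; rewrite /partial => ->; rewrite mxE.
Qed.

Lemma Ck_on_coord m k (U : set 'rV[R]_m) j : Ck_on k U (fun x => x 0 j).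
Proof.
case: k => [|k]; first by split=> // x _; exact: coord_continuous.
split=> [x _|i]; first exact: coord_continuous.
split=> [x _|]; first by case: (is_derive_coord x (delta_mx 0 i) j).
rewrite (_ : partial i _ = fun=> (j == i)%:R); first exact: Ck_on_cst.
by apply/funext => x; rewrite partial_coord.
Qed.

(** [mean_value] with the slopes [partial i f x], on a ball where the partial derivatives vary by at
    most [e / (m + 1)]. Summation over the coordinates costs a factor [m]; the [+ 1] keeps the
    quotient meaningful for [m = 0]. *)
Lemma C1_estimate m (U : set 'rV[R]_m) f x e : open U -> U x -> Ck_on 1 U f ->
  0 < e -> \forall h \near (0 : 'rV[R]_m),
  `|f (h + x) - f x - lform (fun i => partial i f x) h| <= e * `|h|.
Proof.
move=> oU Ux [cf Hf] e0.
have m0 : 0 < (m%:R : R) + 1 by rewrite ltr_pwDr.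
have nU : nbhs x U by exact: open_nbhs_nbhs.
have : \forall z \near x, U z /\
    forall i, `|partial i f z - partial i f x| <= e / (m%:R + 1).
  near=> z; split; first by near: z.
  near: z; apply: filter_forall => i.
  have [_ [/(_ _ Ux) + _]] := Hf i.
  move=> /cvgr_dist_le/(_ (e / (m%:R + 1))) => H.
  apply: filterS (H _); first by move=> z; rewrite distrC.
  by rewrite divr_gt0.
move=> /nbhs_ballP[r /= r0 Hr].
have : \forall h \near (0 : 'rV[R]_m), `|h| < r by exact: nbhs0_lt.
apply: filterS => h hr.
have := @mean_value R m f x `|h| (e / (m%:R + 1)) (fun i => partial i f x) _ x (h + x).
rewrite subrr normr0 addrK => /(_ _ (normr_ge0 _) (lexx _)).
move=> /(_ _)/le_trans -> //.
- move=> z zh i.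
  have [|Uz /(_ i) Hi] := Hr z.
    by rewrite -ball_normE/= distrC (le_lt_trans zh).
  by split=> //; have [/(_ _ Uz)] := Hf i.
rewrite -mulrA ler_wpM2l ?(ltW e0)// mulrC ler_pdivrMr// mulrC.
apply: le_trans (sum_norm_coord _) _; apply: ler_wpM2r => //.
by rewrite lerDl.
Unshelve. all: by end_near. Qed.

Lemma C1_diff m (U : set 'rV[R]_m) f x : open U -> U x -> Ck_on 1 U f ->
  differentiable f x /\ 'd f x = lform (fun i => partial i f x) :> (_ -> _).
Proof.
move=> oU Ux hf.
have E : 'd f x = lform (fun i => partial i f x) :> (_ -> _).
  apply: diff_unique; first exact: lform_continuous.
  apply/eqaddoP => e e0; have := C1_estimate oU Ux hf e0.
  by apply: filterS => h; rewrite opprD addrA.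
split=> //; apply/diff_locallyP; rewrite E; split; first exact: lform_continuous.
apply/eqaddoP => e e0; have := C1_estimate oU Ux hf e0.
by apply: filterS => h; rewrite opprD addrA.
Qed.

Lemma derive_lform m (U : set 'rV[R]_m) f x v : open U -> U x -> Ck_on 1 U f ->
  'D_v f x = \sum_i v 0 i * partial i f x.
Proof.
by move=> oU Ux hf; have [df E] := C1_diff oU Ux hf; rewrite deriveE// E.
Qed.

(** Only the derivative of [phi] along [v] is assumed, so the chain rule is applied to the
    restriction of [phi] to the line [h *: v + x], where derivability and differentiability
    agree. *)
Lemma is_derive_comp m d (U : set 'rV[R]_d) (f : 'rV[R]_d -> R)
    (phi : 'rV[R]_m -> 'rV[R]_d) x v :
  open U -> U (phi x) -> Ck_on 1 U f -> derivable phi x v ->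
  is_derive x v (f \o phi) (\sum_j 'D_v (fun x => phi x 0 j) x * partial j f (phi x)).
Proof.
move=> oU Ux hf dphi.
have [df _] := C1_diff oU Ux hf.
pose g (h : R) := phi (h *: v + x).
have dg : differentiable g 0.
  by apply: (derivable1_diffP _ _).1; exact: (derivable1P _ _ _).1.
have g0 : g 0 = phi x by rewrite /g scale0r add0r.
have df0 : differentiable f (g 0) by rewrite g0.
have dfg : derivable (fun h : R => (f \o phi) (h *: v + x)) 0 1.
  by apply: (derivable1_diffP _ _).2; exact: differentiable_comp dg df0.
have dfphi : derivable (f \o phi) x v by exact: (derivable1P _ _ _).2.
have Dg : 'D_1 g 0 = 'D_v phi x.
  rewrite /derive; have -> // : (fun h : R => h^-1 *: ((g \o shift 0) (h *: (1 : R)) - g 0)) =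
     (fun h => h^-1 *: ((phi \o shift x) (h *: v) - phi x)).
  by apply/funext => h /=; rewrite g0 /g addr0 [h%:A]mulr1.
apply: DeriveDef => //.
have -> : 'D_v (f \o phi) x = 'D_1 (f \o g) 0.
  rewrite /derive; have -> // : (fun h : R => h^-1 *: (((f \o g) \o shift 0) (h *: (1 : R)) - (f \o g) 0)) =
     (fun h => h^-1 *: (((f \o phi) \o shift x) (h *: v) - (f \o phi) x)).
  by apply/funext => h /=; rewrite g0 /g addr0 [h%:A]mulr1.
rewrite deriveE; last exact: differentiable_comp dg df0.
rewrite diff_comp//= -(deriveE _ dg) Dg -(deriveE _ df0) g0.
rewrite (derive_lform _ oU Ux hf) (derive_mx dphi).
by apply: eq_bigr => i _; rewrite mxE.
Qed.

End Smooth.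

Section Composition.
Variable R : realType.

Lemma rV_continuous (T : topologicalType) (m : nat) (phi : T -> 'rV[R]_m) x :
  (forall j, {for x, continuous (fun x => phi x 0 j)}) -> {for x, continuous phi}.
Proof.
move=> H; apply/cvgrPdist_le => e e0.
have : \forall t \near x, forall j, `|phi x 0 j - phi t 0 j| <= e.
  by apply: filter_forall => j; have /cvgrPdist_le := H j; exact.
apply: filterS => t Ht; apply: norm_le_coord; first exact: ltW.
by move=> j; rewrite !mxE.
Qed.

Lemma continuous_estimate (T : topologicalType) (f : T -> R) x :
  (forall e, 0 < e -> \forall t \near x, `|f x - f t| <= e) ->
  {for x, continuous f}.
Proof. by move=> H; apply/cvgrPdist_le => e e0; exact: H. Qed.

Lemma partial_comp m d (U : set 'rV[R]_d) f (phi : 'rV[R]_m -> 'rV[R]_d) x i :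
  open U -> U (phi x) -> Ck_on 1 U f ->
  (forall j, derivable (fun x => phi x 0 j) x (delta_mx 0 i)) ->
  partial i (f \o phi) x =
    \sum_j partial j f (phi x) * partial i (fun x => phi x 0 j) x.
Proof.
move=> oU Ux hf dphi.
have D : derivable phi x (delta_mx 0 i).
  by apply: (derivable_mxP _ _ _).2 => k j; rewrite (ord1 k); exact: dphi.
have [_] := is_derive_comp oU Ux hf D; rewrite /partial => ->.
by apply: eq_bigr => j _; rewrite mulrC.
Qed.

Lemma partialD m (f g : 'rV[R]_m -> R) i x :
  derivable f x (delta_mx 0 i) -> derivable g x (delta_mx 0 i) ->
  partial i (fun x => f x + g x) x = partial i f x + partial i g x.
Proof. exact: deriveD. Qed.

Lemma partialM m (f g : 'rV[R]_m -> R) i x :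
  derivable f x (delta_mx 0 i) -> derivable g x (delta_mx 0 i) ->
  partial i (fun x => f x * g x) x = f x * partial i g x + g x * partial i f x.
Proof. exact: deriveM. Qed.

Lemma partialZ m a (f : 'rV[R]_m -> R) i x : derivable f x (delta_mx 0 i) ->
  partial i (fun x => a * f x) x = a * partial i f x.
Proof. by move=> df; exact: deriveZ. Qed.

(** Induction on [k] for all [f] at once: the partial derivatives of the composite are sums of
    products of the [partial j f \o phi], covered by the induction hypothesis, and of partial
    derivatives of [phi]. *)
Lemma Ck_on_comp m d k (U : set 'rV[R]_d) (V : set 'rV[R]_m) f
    (phi : 'rV[R]_m -> 'rV[R]_d) : open U -> open V ->
  (forall x, V x -> U (phi x)) ->
  (forall j, Ck_on k V (fun x => phi x 0 j)) ->
  Ck_on k U f -> Ck_on k V (f \o phi).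
Proof.
move=> oU oV VU; elim: k f => [|k IH] f hphi hf.
  have [cf _] := hf; split=> // x Vx.
  apply: continuous_comp; last exact: cf (VU _ Vx).
  by apply: rV_continuous => j; have [c _] := hphi j; exact: c.
have cphi x : V x -> {for x, continuous phi}.
  by move=> Vx; apply: rV_continuous => j; have [c _] := hphi j; exact: c.
have [cf Hf] := hf; split=> [x Vx|i].
  by apply: continuous_comp; [exact: cphi|exact: cf (VU _ Vx)].
have hf1 : Ck_on 1 U f.
  split=> // j; have [dj pj] := Hf j; split=> //.
  by split=> // x Ux; apply: Ck_on_cont pj Ux.
have dphi x j : V x -> derivable (fun x => phi x 0 j) x (delta_mx 0 i).
  by move=> Vx; have [_ /(_ i) [/(_ _ Vx)]] := hphi j.
split=> [x Vx|].
  have D : derivable phi x (delta_mx 0 i).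
    by apply: (derivable_mxP _ _ _).2 => l j; rewrite (ord1 l); exact: dphi.
  by have [] := is_derive_comp oU (VU _ Vx) hf1 D.
have H : Ck_on k V (fun x => \sum_j
    (partial j f \o phi) x * partial i (fun x => phi x 0 j) x).
  apply: Ck_on_sum => // j _; apply: Ck_on_mul => //.
    apply: IH; first by move=> l; apply: Ck_onW.
    by have [_ ] := Hf j.
  by have [_ /(_ i) []] := hphi j.
apply: (eq_Ck_on oV _ H) => x Vx.
by rewrite (partial_comp oU (VU _ Vx) hf1)// => j; exact: dphi.
Qed.

Definition smooth_map m d (U : set 'rV[R]_m) (phi : 'rV[R]_m -> 'rV[R]_d) :=
  forall j, smooth_on U (fun x => phi x 0 j).

Lemma smooth_map_cont m d (U : set 'rV[R]_m) (phi : 'rV[R]_m -> 'rV[R]_d) x :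
  smooth_map U phi -> U x -> {for x, continuous phi}.
Proof. by move=> sp Ux; apply: rV_continuous => j; exact: smooth_on_cont (sp j) Ux. Qed.

Lemma smooth_on_comp m d (U : set 'rV[R]_d) (V : set 'rV[R]_m) f
    (phi : 'rV[R]_m -> 'rV[R]_d) : open U -> open V ->
  (forall x, V x -> U (phi x)) -> smooth_map V phi ->
  smooth_on U f -> smooth_on V (f \o phi).
Proof. by move=> oU oV VU sphi sf k; apply: (Ck_on_comp oU oV VU) => // j; exact: sphi. Qed.

Lemma smooth_on_add m (U : set 'rV[R]_m) f g : open U ->
  smooth_on U f -> smooth_on U g -> smooth_on U (fun x => f x + g x).
Proof. by move=> oU sf sg k; exact: Ck_on_add. Qed.

Lemma smooth_on_mul m (U : set 'rV[R]_m) f g : open U ->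
  smooth_on U f -> smooth_on U g -> smooth_on U (fun x => f x * g x).
Proof. by move=> oU sf sg k; exact: Ck_on_mul. Qed.

Lemma smooth_on_cst m (U : set 'rV[R]_m) (a : R) : smooth_on U (fun=> a).
Proof. by move=> k; exact: Ck_on_cst. Qed.

Lemma smooth_on_coord m (U : set 'rV[R]_m) j : smooth_on U (fun x => x 0 j).
Proof. by move=> k; exact: Ck_on_coord. Qed.

Lemma smooth_on_sum m (U : set 'rV[R]_m) (I : Type) (r : seq I) (P : pred I) F :
  open U -> (forall i, P i -> smooth_on U (F i)) ->
  smooth_on U (fun x => \sum_(i <- r | P i) F i x).
Proof. by move=> oU H k; apply: Ck_on_sum => // i Pi; exact: H. Qed.

Lemma smooth_on_prod m (U : set 'rV[R]_m) (I : Type) (r : seq I) (P : pred I) F :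
  open U -> (forall i, P i -> smooth_on U (F i)) ->
  smooth_on U (fun x => \prod_(i <- r | P i) F i x).
Proof. by move=> oU H k; apply: Ck_on_prod => // i Pi; exact: H. Qed.

Lemma smooth_on_inv m (U : set 'rV[R]_m) f : open U ->
  (forall x, U x -> f x != 0) -> smooth_on U f -> smooth_on U (fun x => (f x)^-1).
Proof. by move=> oU f0 sf k; exact: Ck_on_inv. Qed.

Lemma smooth_on_det m d (U : set 'rV[R]_m) (A : 'rV[R]_m -> 'M[R]_d) : open U ->
  (forall i j, smooth_on U (fun x => A x i j)) -> smooth_on U (fun x => \det (A x)).
Proof.
move=> oU H; rewrite /determinant; apply: smooth_on_sum => // s _.
apply: smooth_on_mul => //; first exact: smooth_on_cst.
by apply: smooth_on_prod.
Qed.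

Lemma smooth_on_invmx m d (U : set 'rV[R]_m) (A : 'rV[R]_m -> 'M[R]_d) i j :
  open U -> (forall i j, smooth_on U (fun x => A x i j)) ->
  (forall x, U x -> A x \in unitmx) -> smooth_on U (fun x => invmx (A x) i j).
Proof.
move=> oU H uA.
have S : smooth_on U (fun x => (\det (A x))^-1 * cofactor (A x) j i).
  apply: smooth_on_mul => //.
    apply: smooth_on_inv => //; last exact: smooth_on_det.
    by move=> x /uA; rewrite unitmxE unitfE.
  rewrite /cofactor; apply: smooth_on_mul => //; first exact: smooth_on_cst.
  apply: smooth_on_det => // a b.
  by under eq_fun do rewrite !mxE; exact: H.
apply: (eq_smooth_on oU _ S) => x Ux.
by rewrite /invmx (uA _ Ux) !mxE.
Qed.

End Composition.

(** * Derivatives of limits *)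

Section Estimates.
Variable R : realType.

Lemma is_derive_estimate (V : normedModType R) (f : V -> R) x v d :
  (forall e, 0 < e -> \forall h \near (0 : R), `|f (x + h *: v) - f x - h * d| <= e * `|h|) ->
  is_derive x v f d.
Proof.
move=> H.
have C : (h^-1 *: ((f \o shift x) (h *: v) - f x)) @[h --> 0^'] --> d.
  apply/cvgrPdist_le => e e0; have := H _ e0.
  rewrite near_withinE; apply: filterS => h He h0 /=.
  rewrite -(ler_pM2l (_ : 0 < `|h|)) ?normr_gt0// -normrM mulrBr.
  rewrite /GRing.scale/= mulrA divff// mul1r distrC [leRHS]mulrC.
  by rewrite [h *: v + x]addrC.
by apply: DeriveDef; [exact: cvgP C|exact: cvg_lim C].
Qed.

(** The mean value bound with slope [h x0] holds for every [f k] with [k] large, with a constant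
    independent of [k], and passes to the pointwise limit; no integral is involved. Continuity of
    [h] at [x0] compares the slopes nearby with [h x0]. *)
Lemma is_derive_limit m (f : nat -> 'rV[R]_m -> R) (g h : 'rV[R]_m -> R) x0 r i :
  0 < r ->
  (forall k z, `|z - x0| <= r -> derivable (f k) z (delta_mx 0 i)) ->
  (forall z, `|z - x0| <= r -> f ^~ z @ \oo --> g z) ->
  (forall e, 0 < e -> exists K, forall k, (K <= k)%N -> forall z, `|z - x0| <= r ->
    `|partial i (f k) z - h z| <= e) ->
  {for x0, continuous h} -> is_derive x0 (delta_mx 0 i) g (h x0).
Proof.
move=> r0 df fg pfh ch; apply: is_derive_estimate => e e0.
have e20 : 0 < e / 2 by rewrite divr_gt0.
have [K HK] := pfh _ e20.
have : \forall z \near x0, `|h x0 - h z| <= e / 2 by have /cvgrPdist_le := ch; exact.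
move=> /nbhs_ballP[r' /= r'0 Hr'].
have : \forall t \near (0 : R), `|t| < Num.min r r'.
  by apply: nbhs0_lt; rewrite lt_min r0.
set v : 'rV[R]_m := delta_mx 0 i.
have v1 : `|v| <= 1.
  apply: norm_le_coord => // j; rewrite mxE eqxx /=.
  by case: (j == i); rewrite ?normr1 ?normr0.
apply: filterS => t; rewrite lt_min => /andP[tr tr'].
have zr s : `|s| <= `|t| -> `|x0 + s *: v - x0| <= `|t|.
  move=> st; rewrite addrC addKr normrZ.
  by rewrite -[leRHS]mulr1; apply: ler_pM.
have E k : (K <= k)%N -> `|f k (x0 + t *: v) - f k x0 - t * h x0| <= e * `|t|.
  move=> Kk; apply: mean_value_coord => s st.
  have st' : `|s| <= `|t|.
    by case/orP: st => /andP[s1 s2]; [rewrite !ger0_norm//|rewrite !ler0_norm ?lerN2//];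
      exact: le_trans s1 s2.
  have zr' := le_trans (zr _ st') (ltW tr).
  split; first exact: df.
  rewrite -(subrK (h (x0 + s *: v)) (partial _ _ _)) -addrA (splitr e).
  apply: le_trans (ler_normD _ _) _; apply: lerD; first exact: HK.
  rewrite distrC; apply: Hr'; rewrite -ball_normE /= distrC.
  by apply: le_lt_trans (zr _ st') _.
have L : (fun k => `|f k (x0 + t *: v) - f k x0 - t * h x0|) @ \oo -->
    `|g (x0 + t *: v) - g x0 - t * h x0|.
  apply: cvg_norm; apply: cvgB; last exact: cvg_cst.
  apply: cvgB; apply: fg; last by rewrite subrr normr0 ltW.
  exact: le_trans (zr _ (lexx _)) (ltW tr).
have <- := cvg_lim (@Rhausdorff R) L.
apply: limr_le; first exact: cvgP L.
by exists K => // k /= Kk; exact: E.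
Qed.

Lemma bounded_on_ball m (f : 'rV[R]_m -> R) (x0 : 'rV[R]_m) (r : R) :
  (forall x, `|x - x0| <= r -> {for x, continuous f}) ->
  exists C, 0 <= C /\ forall x, `|x - x0| <= r -> `|f x| <= C.
Proof.
move=> cf; have [r0|r0] := ltP r 0.
  exists 0; split=> // x xr; have := le_trans (normr_ge0 _) xr.
  by move=> /le_lt_trans /(_ r0); rewrite ltxx.
pose B : set 'rV[R]_m := [set x | `|x - x0| <= r].
have cB : compact B.
  apply: bounded_closed_compact.
    exists (`|x0| + r); split; first exact: num_real.
    move=> M HM x /= xB; rewrite -(subrK x0 x); apply: le_trans (ler_normD _ _) _.
    apply: le_trans (ltW HM); rewrite addrC; exact: lerD.
  have -> : B = (fun x : 'rV[R]_m => `|x - x0|) @^-1` [set t | t <= r] by [].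
  have cN : continuous (fun x : 'rV[R]_m => `|x - x0|).
    move=> x; apply: (@cvg_norm _ _ _ (nbhs x) _ (fun x => x - x0)).
    by apply: cvgB; [exact: cvg_id|exact: cvg_cst].
  exact: closed_comp (fun x _ => cN x) (@closed_le _ r).
have B0 : B !=set0 by exists x0; rewrite /B/= subrr normr0.
have [c _ Hc] : exists2 c, c \in B & forall t, t \in B -> `|f t| <= `|f c|.
  apply: EVT_max_rV => //; apply: continuous_in_subspaceT => x; rewrite inE => xB.
  exact: (continuous_comp (cf _ xB) (@norm_continuous _ _ _)).
by exists `|f c|; split=> // x xB; apply: Hc; rewrite inE.
Qed.

End Estimates.

(** * Flows as limits of Euler iterates *)

Section RowBlocks.
Variable R : realType.

Lemma norm_lsubmx_le n m (y : 'rV[R]_(n + m)) : `|lsubmx y| <= `|y|.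
Proof. by apply: norm_le_coord => // j; rewrite mxE coord_le_norm. Qed.

Lemma norm_rsubmx_le n m (y : 'rV[R]_(n + m)) : `|rsubmx y| <= `|y|.
Proof. by apply: norm_le_coord => // j; rewrite mxE coord_le_norm. Qed.

Lemma norm_row_mx_le n m (a : 'rV[R]_n) (b : 'rV[R]_m) r :
  `|a| <= r -> `|b| <= r -> `|row_mx a b| <= r.
Proof.
move=> ar br; apply: norm_le_coord; first exact: le_trans ar.
move=> j; rewrite mxE; case: (fintype.split j) => i.
  exact: le_trans (coord_le_norm _ _) ar.
exact: le_trans (coord_le_norm _ _) br.
Qed.

Lemma smooth_lsubmx n m (U : set 'rV[R]_(n + m)) : smooth_map U (@lsubmx R 1 n m).
Proof. by move=> j; under eq_fun do rewrite mxE; exact: smooth_on_coord. Qed.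

Lemma smooth_rsubmx n m (U : set 'rV[R]_(n + m)) : smooth_map U (@rsubmx R 1 n m).
Proof. by move=> j; under eq_fun do rewrite mxE; exact: smooth_on_coord. Qed.

Lemma smooth_row_mx d n m (U : set 'rV[R]_d) (f : 'rV[R]_d -> 'rV[R]_n)
    (g : 'rV[R]_d -> 'rV[R]_m) :
  smooth_map U f -> smooth_map U g -> smooth_map U (fun x => row_mx (f x) (g x)).
Proof.
move=> sf sg j; under eq_fun do rewrite mxE.
by case: (fintype.split j) => i; [exact: sf|exact: sg].
Qed.

Lemma smooth_map_id d (U : set 'rV[R]_d) : smooth_map U id.
Proof. by move=> j; exact: smooth_on_coord. Qed.

Lemma smooth_map_cst d n (U : set 'rV[R]_d) (a : 'rV[R]_n) : smooth_map U (fun=> a).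
Proof. by move=> j; exact: smooth_on_cst. Qed.

Lemma smooth_map_add d n (U : set 'rV[R]_d) (f g : 'rV[R]_d -> 'rV[R]_n) :
  open U -> smooth_map U f -> smooth_map U g -> smooth_map U (fun x => f x + g x).
Proof.
by move=> oU sf sg j; under eq_fun do rewrite mxE; apply: smooth_on_add.
Qed.

Lemma smooth_map_scale d n (U : set 'rV[R]_d) (c : 'rV[R]_d -> R)
    (f : 'rV[R]_d -> 'rV[R]_n) :
  open U -> smooth_on U c -> smooth_map U f -> smooth_map U (fun x => c x *: f x).
Proof.
by move=> oU sf sg j; under eq_fun do rewrite mxE; apply: smooth_on_mul.
Qed.

Lemma smooth_map_sum d n (U : set 'rV[R]_d) (I : Type) (r : seq I) (P : pred I)
    (f : I -> 'rV[R]_d -> 'rV[R]_n) :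
  open U -> (forall i, P i -> smooth_map U (f i)) ->
  smooth_map U (fun x => \sum_(i <- r | P i) f i x).
Proof.
move=> oU sf j; under eq_fun do rewrite summxE.
by apply: smooth_on_sum => // i Pi; exact: sf.
Qed.

Lemma smooth_map_comp d n m (U : set 'rV[R]_n) (V : set 'rV[R]_d)
    (f : 'rV[R]_n -> 'rV[R]_m) (g : 'rV[R]_d -> 'rV[R]_n) :
  open U -> open V -> (forall x, V x -> U (g x)) ->
  smooth_map V g -> smooth_map U f -> smooth_map V (f \o g).
Proof.
move=> oU oV VU sg sf j.
exact: (smooth_on_comp oU oV VU sg (sf j)).
Qed.

End RowBlocks.

(** * Bounds on balls, discrete Gronwall inequality, geometric convergence *)

Section Bounds.
Variable R : realType.

Lemma smooth_setT_bounded m (f : 'rV[R]_m -> R) r : smooth_on setT f ->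
  exists C, 0 <= C /\ forall x, `|x| <= r -> `|f x| <= C.
Proof.
move=> sf; have [x _|C [C0 HC]] := @bounded_on_ball R m f 0 r.
  exact: (@smooth_on_cont _ _ setT f x sf I).
by exists C; split=> // x xr; apply: HC; rewrite subr0.
Qed.

Lemma finite_bound (I : finType) (T : Type) (P : T -> Prop) (F : I -> T -> R) :
  (forall i, exists C, 0 <= C /\ forall x, P x -> F i x <= C) ->
  exists C, 0 <= C /\ forall i x, P x -> F i x <= C.
Proof.
move=> /choice[C HC]; exists (\sum_i C i); split.
  by apply: sumr_ge0 => i _; case: (HC i).
move=> i x Px; have [_ /(_ _ Px) Fi] := HC i; apply: le_trans Fi _.
by rewrite (bigD1 i)//= lerDl sumr_ge0// => j _; case: (HC j).
Qed.

Lemma smooth_map_bounded d m (X : 'rV[R]_d -> 'rV[R]_m) r : smooth_map setT X ->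
  exists C, 0 <= C /\ forall x, `|x| <= r -> `|X x| <= C.
Proof.
move=> sX.
have [C [C0 HC]] := @finite_bound 'I_m _ (fun x => `|x| <= r)
  (fun j x => `|X x 0 j|) (fun j => smooth_setT_bounded r (sX j)).
by exists C; split=> // x xr; apply: norm_le_coord => // j; exact: HC.
Qed.

Lemma smooth_setT_lipschitz m (f : 'rV[R]_m -> R) r : smooth_on setT f ->
  exists K, 0 <= K /\
  forall x y, `|x| <= r -> `|y| <= r -> `|f y - f x| <= K * `|y - x|.
Proof.
move=> sf.
have [C [C0 HC]] := @finite_bound 'I_m _ (fun x => `|x| <= r)
  (fun i x => `|partial i f x|)
  (fun i => smooth_setT_bounded r (smooth_on_partial i sf)).
exists (C * m%:R); split; first by rewrite mulr_ge0.
move=> x y xr yr.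
have := @mean_value R m f 0 r C (fun=> 0) _ x y.
rewrite !subr0 => /(_ _ xr yr).
rewrite big1 ?subr0 => [H|i _]; last by rewrite mulr0.
apply: le_trans (H _) _.
  move=> z; rewrite subr0 => zr i; split; first exact: (@smooth_on_derivable _ _ setT f i z sf I).
  by rewrite subr0; exact: HC.
by rewrite -mulrA ler_wpM2l// sum_norm_coord.
Qed.

Lemma smooth_map_lipschitz d m (X : 'rV[R]_d -> 'rV[R]_m) r : smooth_map setT X ->
  exists K, 0 <= K /\
  forall x y, `|x| <= r -> `|y| <= r -> `|X y - X x| <= K * `|y - x|.
Proof.
move=> sX.
have /choice[K HK] := fun j => smooth_setT_lipschitz r (sX j).
exists (\sum_j K j); split; first by apply: sumr_ge0 => i _; case: (HK i).
move=> x y xr yr; apply: norm_le_coord.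
  by rewrite mulr_ge0// sumr_ge0// => i _; case: (HK i).
move=> j; rewrite !mxE; have [_ /(_ _ _ xr yr) Kj] := HK j.
apply: le_trans Kj _; apply: ler_wpM2r => //.
by rewrite (bigD1 j)//= lerDl sumr_ge0// => i _; case: (HK i).
Qed.

Lemma smooth_setT_taylor m (f : 'rV[R]_m -> R) r : smooth_on setT f ->
  exists K, 0 <= K /\ forall x y, `|x| <= r -> `|y| <= r ->
  `|f y - f x - \sum_i (y - x) 0 i * partial i f x| <= K * `|y - x| ^+ 2.
Proof.
move=> sf.
(* A point at distance at most [|y - x| <= 2r] from [x] has norm at most [3r]. *)
have /choice[L HL] := fun i => smooth_setT_lipschitz (r + (r + r)) (smooth_on_partial i sf).
pose K := \sum_i L i.
have K0 : 0 <= K by apply: sumr_ge0 => i _; case: (HL i).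
exists (K * m%:R); split; first by rewrite mulr_ge0.
move=> x y xr yr.
have r0 : 0 <= r by exact: le_trans xr.
have := @mean_value R m f x `|y - x| (K * `|y - x|) (fun i => partial i f x) _ x y.
rewrite subrr normr0 => /(_ _ (normr_ge0 _) (lexx _)) H.
apply: le_trans (H _) _; last first.
  rewrite expr2 -!mulrA ler_wpM2l// mulrCA ler_wpM2l//; exact: sum_norm_coord.
move=> z zxy i; split; first exact: (@smooth_on_derivable _ _ setT f i z sf I).
have [Li0 /(_ x z) Hi] := HL i.
apply: le_trans (Hi _ _) _.
- by apply: le_trans xr _; rewrite lerDl addr_ge0.
- rewrite -(subrK x z) addrC; apply: le_trans (ler_normD _ _) _.
  apply: lerD => //; apply: le_trans zxy _; apply: le_trans (ler_normB _ _) _.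
  exact: lerD.
apply: ler_pM => //.
by rewrite /K (bigD1 i)//= lerDl sumr_ge0// => j _; case: (HL j).
Qed.

(** Induction gives the bound with [(1 + h * K) ^+ j], and then [1 + t <= expR t]. *)
Lemma gronwall (a : nat -> R) (h K b : R) N : 0 <= h -> 0 <= K -> 0 <= b ->
  0 <= a 0%N ->
  (forall j, (j < N)%N -> a j.+1 <= (1 + h * K) * a j + b) ->
  forall j, (j <= N)%N -> a j <= (a 0%N + j%:R * b) * expR (j%:R * h * K).
Proof.
move=> h0 K0 b0 a0 H.
have q1 : 1 <= 1 + h * K by rewrite lerDl mulr_ge0.
have q0 : 0 <= 1 + h * K by exact: le_trans q1.
have A j : (j <= N)%N -> a j <= (a 0%N + j%:R * b) * (1 + h * K) ^+ j.
  elim: j => [|j IH] jN; first by rewrite expr0 mul0r addr0 mulr1.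
  apply: le_trans (H _ jN) _.
  have := IH (ltnW jN) => IHj.
  apply: le_trans (_ : (1 + h * K) * ((a 0%N + j%:R * b) * (1 + h * K) ^+ j) + b * (1 + h * K) ^+ j.+1 <= _).
    by apply: lerD; [exact: ler_wpM2l|rewrite ler_peMr// exprn_ege1].
  by rewrite exprS -natr1 le_eqVlt; apply/orP; left; apply/eqP; ring.
move=> j jN; apply: le_trans (A _ jN) _; apply: ler_wpM2l.
  by rewrite addr_ge0// mulr_ge0.
have -> : j%:R * h * K = (h * K) * j%:R by ring.
rewrite expRM_natr; apply: lerXn2r => //.
  by rewrite nnegrE expR_ge0.
exact: expR_ge1Dx.
Qed.

(** Nested intervals: [u k - 2C/2^k] increases and [u k + 2C/2^k] decreases, and the supremum of the
    former lies between all of them. The explicit rate is what later makes convergence uniform on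
    balls. *)
Lemma geometric_limit (u : nat -> R) C : (forall k, `|u k.+1 - u k| <= C / 2 ^+ k) ->
  exists l, forall k, `|l - u k| <= 2 * C / 2 ^+ k.
Proof.
move=> H.
pose v k := u k - 2 * C / 2 ^+ k; pose w k := u k + 2 * C / 2 ^+ k.
have p2 k : (2 : R) ^+ k != 0 by rewrite expf_neq0.
have vS k : v k <= v k.+1.
  have := H k; rewrite /v ler_norml => /andP[h1 h2].
  have -> : 2 * C / 2 ^+ k.+1 = C / 2 ^+ k by rewrite exprS; field; rewrite p2.
  have E : 2 * C / 2 ^+ k = C / 2 ^+ k + C / 2 ^+ k by field; rewrite p2.
  rewrite E; lra.
have wS k : w k.+1 <= w k.
  have := H k; rewrite /w ler_norml => /andP[h1 h2].
  have -> : 2 * C / 2 ^+ k.+1 = C / 2 ^+ k by rewrite exprS; field; rewrite p2.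
  have E : 2 * C / 2 ^+ k = C / 2 ^+ k + C / 2 ^+ k by field; rewrite p2.
  rewrite E; lra.
have C0 : 0 <= C.
  by have := le_trans (normr_ge0 _) (H 0%N); rewrite expr0 divr1.
have vw k : v k <= w k.
  by rewrite /v /w lerD2l -subr_ge0 opprK addr_ge0// divr_ge0// ?mulr_ge0// exprn_ge0.
have vm : {homo v : i j / (i <= j)%N >-> i <= j} by apply: homo_leq => //; exact: le_trans.
have wm : {homo w : i j / (i <= j)%N >-> j <= i}.
  by apply: (@homo_leq _ _ (fun x y => y <= x)) => //; move=> y x z yx zy; exact: le_trans yx.
have vwjk j k : v j <= w k.
  apply: le_trans (vm _ _ (leq_maxl j k)) _; apply: le_trans (vw _) _.
  exact: wm (leq_maxr j k).
exists (sup (range v)) => k.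
have S1 : v k <= sup (range v).
  by apply: ub_le_sup; [exists (w 0%N) => _ [j _ <-]; exact: vwjk|exists k].
have S2 : sup (range v) <= w k.
  apply: ge_sup; first by exists (v 0%N), 0%N.
  by move=> _ [j _ <-]; exact: vwjk.
by rewrite ler_norml; move: S1 S2; rewrite /v /w => h1 h2; apply/andP; split; lra.
Qed.

Lemma small_pow2 (C e : R) : 0 < e -> exists K, forall k, (K <= k)%N -> C / 2 ^+ k <= e.
Proof.
move=> e0.
have : (fun k => C * (2^-1) ^+ k) @ \oo --> (0 : R).
  rewrite -[X in _ --> X](mulr0 C); apply: cvgMr.
  by apply: cvg_expr; rewrite ger0_norm ?invr_ge0// invf_lt1// ltr1n.
move=> /cvgrPdist_le/(_ _ e0)[K _ HK]; exists K => k /HK.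
by rewrite sub0r normrN exprVn; apply: le_trans; exact: ler_norm.
Qed.

End Bounds.

(** * Euler iterates and smoothness of their limit *)

Section EulerFlow.
Variable R : realType.

Definition euler_step d (X : 'rV[R]_d -> 'rV[R]_d) (h : R) (x : 'rV[R]_d) := x + h *: X x.

(** [j] steps of size [1/N], so that [j = N] corresponds to time one. *)
Definition euler d (X : 'rV[R]_d -> 'rV[R]_d) (N j : nat) (x : 'rV[R]_d) :=
  iter j (euler_step X N%:R^-1) x.

(** An a priori bound up to time one, uniform in the step size and on balls of initial points; it
    takes the place of completeness of the field. *)
Definition tame d (X : 'rV[R]_d -> 'rV[R]_d) :=
  forall r, exists r', forall N j x, (j <= N)%N -> `|x| <= r -> `|euler X N j x| <= r'.

Definition euler_pow2 d (X : 'rV[R]_d -> 'rV[R]_d) k := euler X (2 ^ k)%N (2 ^ k)%N.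

(** Two half steps and one full step differ by a term of order [h^2], and by Gronwall [N] such
    errors add up to order [1/N]. For [N = 2 ^ k] the resulting bound is geometric, which is why the
    limit is taken along powers of two. *)
Lemma euler_double d (X : 'rV[R]_d -> 'rV[R]_d) : smooth_map setT X -> tame X ->
  forall r, exists C, 0 <= C /\ forall N x, (0 < N)%N -> `|x| <= r ->
    `|euler X (2 * N) (2 * N) x - euler X N N x| <= C / N%:R.
Proof.
move=> sX tX r.
have [r' Hr'] := tX r.
have [K [K0 HK]] := smooth_map_lipschitz r' sX.
have [C [C0 HC]] := smooth_map_bounded r' sX.
exists (K * C * expR K); split; first by rewrite !mulr_ge0 ?expR_ge0.
move=> N x N0 xr.
have Np : (0 : R) < N%:R by rewrite ltr0n.
pose h : R := N%:R^-1.
have h0 : 0 <= h by rewrite invr_ge0 ltW.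
pose a j := `|euler X (2 * N) (2 * j) x - euler X N j x|.
have aS j : (j < N)%N -> a j.+1 <= (1 + h * K) * a j + h ^+ 2 * (K * C).
  move=> jN; rewrite /a.
  set u := euler X (2 * N) (2 * j) x; set v := euler X N j x.
  have -> : (2 * j.+1 = (2 * j).+2)%N by rewrite mulnS.
  have hE : (2 * N)%:R^-1 = h / 2 :> R by rewrite natrM invfM mulrC.
  pose w := u + (h / 2) *: X u.
  have wE : w = euler X (2 * N) (2 * j).+1 x by rewrite /w /u -hE.
  have -> : euler X (2 * N) (2 * j).+2 x = w + (h / 2) *: X w by rewrite wE -hE.
  have -> : euler X N j.+1 x = v + h *: X v by [].
  have ur : `|u| <= r' by apply: Hr' => //; rewrite leq_mul2l ltnW.
  have vr : `|v| <= r' by apply: Hr' => //; exact: ltnW.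
  have wr : `|w| <= r'.
    rewrite wE; apply: Hr' => //.
    by rewrite (leq_trans (_ : _ <= (2 * j).+2)%N)// -[(_.+2)%N]/(2 + 2 * j)%N -mulnS leq_mul2l jN.
  have E : w + (h / 2) *: X w - (v + h *: X v) =
     (u - v) + (h / 2) *: (X u - X v) + (h / 2) *: (X w - X v).
    have -> : h *: X v = (h / 2) *: X v + (h / 2) *: X v by rewrite -scalerDl -splitr.
    rewrite /w !scalerBr; apply/rowP => i; rewrite !mxE; ring.
  rewrite E.
  have wv : `|w - v| <= `|u - v| + h * C.
    rewrite /w addrAC; apply: le_trans (ler_normD _ _) _; apply: lerD => //.
    rewrite normrZ ger0_norm ?divr_ge0//.
    apply: ler_pM => //; [by rewrite divr_ge0|by lra|exact: HC].
  have h20 : 0 <= h / 2 by rewrite divr_ge0.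
  apply: le_trans (ler_normD _ _) _; apply: le_trans (lerD (ler_normD _ _) (lexx _)) _.
  have nZ (v' : 'rV[R]_d) : `|(h / 2) *: v'| = h / 2 * `|v'|.
    by rewrite normrZ (ger0_norm h20).
  rewrite !nZ.
  have e1 := HK _ _ vr ur; have e2 := HK _ _ vr wr.
  have e3 : `|X w - X v| <= K * (`|u - v| + h * C).
    by apply: le_trans e2 _; exact: ler_wpM2l.
  have := ler_wpM2l h20 e1; have := ler_wpM2l h20 e3 => f3 f1.
  apply: le_trans (lerD (lerD (lexx _) f1) f3) _.
  have hh : 0 <= h ^+ 2 * (K * C) by rewrite !mulr_ge0.
  rewrite -subr_ge0 (_ : _ - _ = h ^+ 2 * (K * C) / 2) ?divr_ge0//.
  by field.
have a0 : a 0%N = 0 by rewrite /a muln0 subrr normr0.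
have := @gronwall R a h K (h ^+ 2 * (K * C)) N h0 K0 _ _ aS N (leqnn _).
rewrite a0 add0r => H; apply: le_trans (H _ _) _ => //.
  by rewrite !mulr_ge0.
have hN : N%:R * h = 1 by rewrite divff ?gt_eqF.
have E : N%:R * (h ^+ 2 * (K * C)) = K * C * h.
  by transitivity ((N%:R * h) * (K * C * h)); [ring|rewrite hN mul1r].
by rewrite hN mul1r E -/h mulrAC.
Qed.

Lemma euler_pow2_cvg d (X : 'rV[R]_d -> 'rV[R]_d) : smooth_map setT X -> tame X ->
  exists F : 'rV[R]_d -> 'rV[R]_d, forall r, exists C, 0 <= C /\
    forall k x, `|x| <= r -> `|F x - euler_pow2 X k x| <= C / 2 ^+ k.
Proof.
move=> sX tX.
have /choice[C HC] := euler_double sX tX.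
have step k x : `|euler_pow2 X k.+1 x - euler_pow2 X k x| <= C `|x| / 2 ^+ k.
  have [_ /(_ (2 ^ k)%N x)] := HC `|x|.
  by rewrite expn_gt0/= => /(_ isT (lexx _)); rewrite -expnS natrX.
have /choice[F HF] : forall x, exists l : 'rV[R]_d,
    forall k j, `|l 0 j - euler_pow2 X k x 0 j| <= 2 * C `|x| / 2 ^+ k.
  move=> x.
  have /choice[l Hl] : forall j, exists l : R, forall k,
      `|l - euler_pow2 X k x 0 j| <= 2 * C `|x| / 2 ^+ k.
    move=> j; apply: (@geometric_limit R (fun k => euler_pow2 X k x 0 j)) => k.
    apply: le_trans (step k x); apply: le_trans (coord_le_norm _ j).
    by rewrite !mxE.
  by exists (\row_j l j) => k j; rewrite mxE.
have HF' k x : `|F x - euler_pow2 X k x| <= 2 * C `|x| / 2 ^+ k.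
  apply: norm_le_coord => [|j]; last by rewrite !mxE.
  by rewrite divr_ge0// ?mulr_ge0 ?exprn_ge0//; have [] := HC (`|x|).
exists F => r.
exists (2 * C r); split; first by have [C0 _] := HC r; rewrite mulr_ge0.
move=> k x xr.
have stepr i : `|euler_pow2 X i.+1 x - euler_pow2 X i x| <= C r / 2 ^+ i.
  have [_ /(_ (2 ^ i)%N x)] := HC r.
  by rewrite expn_gt0/= => /(_ isT xr); rewrite -expnS natrX.
apply: norm_le_coord => [|j].
  by have [C0 _] := HC r; rewrite divr_ge0// ?mulr_ge0// exprn_ge0.
have stepj i : `|euler_pow2 X i.+1 x 0 j - euler_pow2 X i x 0 j| <= C r / 2 ^+ i.
  apply: le_trans (stepr i); apply: le_trans (coord_le_norm _ j).
  by rewrite !mxE.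
(* The limit was built with a constant depending on [|x|]. The limit obtained with the constant
   [C r] of the whole ball is shown to be the same number. *)
have [l Hl] := @geometric_limit R (fun k => euler_pow2 X k x 0 j) (C r) stepj.
suff E : l = F x 0 j by rewrite !mxE -E.
apply/eqP; rewrite -subr_eq0 -normr_le0; apply/ler_addgt0Pr => e e0; rewrite add0r.
have [k1 Hk1] := @small_pow2 R (2 * C r + 2 * C `|x|) e e0.
have := Hk1 _ (leqnn _); apply: le_trans.
rewrite -(subrK (euler_pow2 X k1 x 0 j) l) -addrA mulrDl.
apply: le_trans (ler_normD _ _) _; apply: lerD; first exact: Hl.
by rewrite distrC.
Qed.

(** The time-one map of the flow. The quantification over [r] expresses uniform convergence on
    balls; the choice is meaningful for smooth tame fields. *)
Definition eflow d (X : 'rV[R]_d -> 'rV[R]_d) : 'rV[R]_d -> 'rV[R]_d :=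
  get [set F : 'rV[R]_d -> 'rV[R]_d | forall r, exists C, 0 <= C /\
    forall k x, `|x| <= r -> `|F x - euler_pow2 X k x| <= C / 2 ^+ k].

Lemma eflowP d (X : 'rV[R]_d -> 'rV[R]_d) : smooth_map setT X -> tame X ->
  forall r, exists C, 0 <= C /\
    forall k x, `|x| <= r -> `|eflow X x - euler_pow2 X k x| <= C / 2 ^+ k.
Proof.
move=> sX tX; have [F HF] := euler_pow2_cvg sX tX.
exact: (@getPex _ [set F : 'rV[R]_d -> 'rV[R]_d | forall r, exists C, 0 <= C /\
    forall k x, `|x| <= r -> `|F x - euler_pow2 X k x| <= C / 2 ^+ k] (ex_intro _ F HF)).
Qed.

Lemma eflow_cvg d (X : 'rV[R]_d -> 'rV[R]_d) x j : smooth_map setT X -> tame X ->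
  (fun k => euler_pow2 X k x 0 j) @ \oo --> eflow X x 0 j.
Proof.
move=> sX tX; apply/cvgrPdist_le => e e0.
have [C [C0 HC]] := eflowP sX tX `|x|.
have [K HK] := small_pow2 C e0; exists K => // k /= Kk.
apply: le_trans (HK _ Kk); apply: le_trans (HC _ _ (lexx _)).
by apply: le_trans (coord_le_norm _ j); rewrite !mxE.
Qed.

Lemma smooth_euler d (X : 'rV[R]_d -> 'rV[R]_d) N j : smooth_map setT X ->
  smooth_map setT (euler X N j).
Proof.
move=> sX; elim: j => [|j IH]; first exact: smooth_map_id.
have oT : open (@setT 'rV[R]_d) by exact: openT.
rewrite (_ : euler X N j.+1 = fun x => euler X N j x + N%:R^-1 *: (X \o euler X N j) x)//.
apply: smooth_map_add => //; apply: smooth_map_scale => //; first exact: smooth_on_cst.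
exact: smooth_map_comp IH sX.
Qed.

(** The linearised field [(x, v) |-> (X x, DX(x) v)] on the tangent bundle. *)
Definition tangent_field d (X : 'rV[R]_d -> 'rV[R]_d) (y : 'rV[R]_(d + d)) : 'rV[R]_(d + d) :=
  row_mx (X (lsubmx y))
    (\row_l \sum_i rsubmx y 0 i * partial i (fun x => X x 0 l) (lsubmx y)).

Lemma smooth_tangent_field d (X : 'rV[R]_d -> 'rV[R]_d) :
  smooth_map setT X -> smooth_map setT (tangent_field X).
Proof.
move=> sX; have oT n : open (@setT 'rV[R]_n) by exact: openT.
apply: smooth_row_mx.
  by apply: (smooth_map_comp (oT _) (oT _) _ (@smooth_lsubmx _ _ _ _) sX).
move=> l; under eq_fun do rewrite mxE.
apply: smooth_on_sum => // i _; apply: smooth_on_mul => //.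
  exact: smooth_rsubmx.
apply: (@smooth_on_comp _ _ _ setT setT (partial i (fun x => X x 0 l)) (@lsubmx R 1 d d)) => //.
  exact: smooth_lsubmx.
exact: smooth_on_partial.
Qed.

Lemma euler_tangent_l d (X : 'rV[R]_d -> 'rV[R]_d) N j y :
  lsubmx (euler (tangent_field X) N j y) = euler X N j (lsubmx y).
Proof.
elim: j => [//|j IH]; rewrite /euler !iterS -!/(euler _ _ _ _) /euler_step -IH.
by rewrite linearD linearZ /= row_mxKl.
Qed.

Lemma euler_tangent_r d (X : 'rV[R]_d -> 'rV[R]_d) N j y l :
  rsubmx (euler (tangent_field X) N j.+1 y) 0 l =
  rsubmx (euler (tangent_field X) N j y) 0 l + N%:R^-1 *
   \sum_i rsubmx (euler (tangent_field X) N j y) 0 i *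
     partial i (fun x => X x 0 l) (euler X N j (lsubmx y)).
Proof.
rewrite {1}/euler iterS -/(euler _ _ _ _) /euler_step linearD linearZ /= row_mxKr.
by rewrite !mxE euler_tangent_l.
Qed.

(** The base part is bounded because [X] is tame. Along it the derivatives of [X] are bounded, so
    each step multiplies the norm of the vector part by at most [1 + K' / N]. *)
Lemma tame_tangent_field d (X : 'rV[R]_d -> 'rV[R]_d) :
  smooth_map setT X -> tame X -> tame (tangent_field X).
Proof.
move=> sX tX r; have [r' Hr'] := tX r.
have [K [K0 HK]] := @finite_bound R ('I_d * 'I_d)%type _ (fun x : 'rV[R]_d => `|x| <= r')
  (fun il x => `|partial il.1 (fun x => X x 0 il.2) x|)
  (fun il => smooth_setT_bounded r' (smooth_on_partial il.1 (sX il.2))).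
pose K' := K * d%:R.
exists (Num.max r' (`|r| * expR K')) => N j y jN yr.
have lr : `|lsubmx y| <= r by exact: le_trans (norm_lsubmx_le _) yr.
rewrite -[euler _ _ _ _]hsubmxK; apply: norm_row_mx_le.
  by rewrite euler_tangent_l le_max Hr'.
rewrite le_max; apply/orP; right.
pose a j := `|rsubmx (euler (tangent_field X) N j y)|.
have [N0|N0] := posnP N.
  move: jN; rewrite N0 leqn0 => /eqP ->; apply: le_trans (norm_rsubmx_le _) _.
  apply: le_trans yr _; apply: le_trans (ler_norm r) _.
  by rewrite ler_peMr// -expR0 ler_expR mulr_ge0.
have Np : (0 : R) < N%:R by rewrite ltr0n.
have h0 : (0 : R) <= N%:R^-1 by rewrite invr_ge0 ltW.
have aS i : (i < N)%N -> a i.+1 <= (1 + N%:R^-1 * K') * a i + 0.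
  move=> iN; rewrite addr0 /a mulrDl mul1r.
  apply: norm_le_coord => [|l].
    by rewrite addr_ge0// !mulr_ge0.
  rewrite euler_tangent_r; apply: le_trans (ler_normD _ _) _.
  apply: lerD; first exact: coord_le_norm.
  rewrite normrM (ger0_norm h0) -mulrA; apply: ler_wpM2l => //.
  apply: le_trans (ler_norm_sum _ _ _) _.
  rewrite /K' -mulrA; apply: le_trans (ler_wpM2l K0 (sum_norm_coord _)).
  rewrite mulr_sumr; apply: ler_sum => q _; rewrite normrM mulrC.
  apply: ler_wpM2r => //; apply: (HK (q, l)).
  by apply: Hr' => //; exact: ltnW.
have K'0 : 0 <= K' by rewrite mulr_ge0.
have := @gronwall R a _ _ 0 N h0 K'0 (lexx _) (normr_ge0 _) aS j jN.
rewrite mulr0 addr0 => H; apply: le_trans H _.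
apply: ler_pM; [exact: normr_ge0|exact: expR_ge0| |].
  apply: le_trans (norm_rsubmx_le _) _; exact: le_trans yr (ler_norm _).
rewrite ler_expR -[leRHS]mul1r; apply: ler_wpM2r => //.
by rewrite ler_pdivrMr// mul1r ler_nat.
Qed.

Lemma partial_euler d (X : 'rV[R]_d -> 'rV[R]_d) N j x i l : smooth_map setT X ->
  partial i (fun x => euler X N j x 0 l) x =
  rsubmx (euler (tangent_field X) N j (row_mx x (delta_mx 0 i))) 0 l.
Proof.
move=> sX; elim: j l => [|j IH] l.
  by rewrite row_mxKr /euler /= partial_coord mxE eqxx.
have oT : open (@setT 'rV[R]_d) by exact: openT.
have D q : derivable (fun x => euler X N j x 0 q) x (delta_mx 0 i).
  exact: (@smooth_on_derivable _ _ setT _ i x (smooth_euler N j sX q) I).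
have DX : derivable ((fun x => X x 0 l) \o euler X N j) x (delta_mx 0 i).
  apply: (@smooth_on_derivable _ _ setT _ i x _ I).
  exact: (smooth_on_comp oT oT (fun _ _ => I) (smooth_euler N j sX) (sX l)).
rewrite euler_tangent_r -IH row_mxKl.
have -> : (fun x => euler X N j.+1 x 0 l) =
   (fun x => euler X N j x 0 l + N%:R^-1 * (((fun x => X x 0 l) \o euler X N j) x)).
  by apply/funext => z; rewrite /euler iterS -/(euler _ _ _ _) /euler_step !mxE.
have PC := @partial_comp R d d setT (fun x => X x 0 l) (euler X N j) x i oT I (sX l 1%N) D.
have DZ : derivable (fun x => N%:R^-1 * (((fun x => X x 0 l) \o euler X N j) x)) x (delta_mx 0 i).
  exact: derivableZ.
rewrite (partialD (D l) DZ) (partialZ _ DX) PC.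
congr (_ + _ * _).
by apply: eq_bigr => q _; rewrite -IH mulrC.
Qed.

(** Continuity of the candidate derivative is left as a hypothesis: it is supplied by regularity of
    the flow of the tangent field, at a lower level of the induction in [Ck_on_eflow]. *)
Lemma is_derive_eflow d (X : 'rV[R]_d -> 'rV[R]_d) x i l :
  smooth_map setT X -> tame X ->
  {for x, continuous (fun x : 'rV[R]_d => eflow (tangent_field X) (row_mx x (delta_mx 0 i)) 0 (rshift d l))} ->
  is_derive x (delta_mx 0 i) (fun x => eflow X x 0 l)
    (eflow (tangent_field X) (row_mx x (delta_mx 0 i)) 0 (rshift d l)).
Proof.
move=> sX tX ch.
have sT := smooth_tangent_field sX; have tT := tame_tangent_field sX tX.
apply: (@is_derive_limit R d (fun k x => euler_pow2 X k x 0 l) (fun x => eflow X x 0 l) _ x 1 i ltr01 _ _ _ ch).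
- move=> k z _; apply: (@smooth_on_derivable _ _ setT _ i z _ I); exact: smooth_euler.
- by move=> z _; exact: eflow_cvg.
move=> e e0.
have [C [C0 HC]] := eflowP sT tT (`|x| + 1 + 1).
have [K HK] := small_pow2 C e0; exists K => k /HK Kk z zx.
rewrite partial_euler// distrC; apply: le_trans Kk.
have := coord_le_norm (eflow (tangent_field X) (row_mx z (delta_mx 0 i)) -
  euler_pow2 (tangent_field X) k (row_mx z (delta_mx 0 i))) (rshift d l).
rewrite !mxE => /le_trans -> //; apply: HC.
apply: norm_row_mx_le.
  rewrite -(subrK x z) addrC; apply: le_trans (ler_normD _ _) _.
  by rewrite -addrA lerD// ler_wpDr.
apply: norm_le_coord => [|j]; first by rewrite !addr_ge0.
by rewrite mxE eqxx; case: (j == i); rewrite ?normr1 ?normr0 ?lerDr ?addr_ge0.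
Qed.

(** Induction on [k] over all dimensions and fields. Class [C^0] is a locally uniform limit of
    continuous maps; for the step, the partial derivatives are components of the time-one map of the
    tangent field, in dimension [d + d]. *)
Lemma Ck_on_eflow k d (X : 'rV[R]_d -> 'rV[R]_d) l :
  smooth_map setT X -> tame X -> Ck_on k setT (fun x => eflow X x 0 l).
Proof.
have oT n : open (@setT 'rV[R]_n) by exact: openT.
elim: k d X l => [|k IH] d X l sX tX.
  split=> // x _; apply: continuous_estimate => e e0.
  have [C [C0 HC]] := eflowP sX tX (`|x| + 1).
  have e3 : 0 < e / 3 by rewrite divr_gt0.
  have [K /(_ _ (leqnn K)) HK] := small_pow2 C e3.
  have ce : {for x, continuous (fun x => euler_pow2 X K x 0 l)}.
    by apply: (@smooth_on_cont _ _ setT _ _ _ I); exact: smooth_euler.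
  have B (z : 'rV[R]_d) : `|z| <= `|x| + 1 -> `|eflow X z 0 l - euler_pow2 X K z 0 l| <= e / 3.
    move=> zx; apply: le_trans HK; apply: le_trans (HC _ _ zx).
    by apply: le_trans (coord_le_norm _ l); rewrite !mxE.
  have N1 : \forall t \near x, `|euler_pow2 X K x 0 l - euler_pow2 X K t 0 l| <= e / 3.
    by have /cvgrPdist_le := ce; exact.
  have N2 : \forall t \near x, `|x - t| < 1 
    by apply/nbhs_ballP; exists 1 => //= t; rewrite -ball_normE.
  near=> t.
  have tx : `|t| <= `|x| + 1.
    rewrite -(subrK x t) addrC; apply: le_trans (ler_normD _ _) _.
    by rewrite lerD2l distrC ltW//; near: t.
  have B1 := B _ tx; have B2 : `|eflow X x 0 l - euler_pow2 X K x 0 l| <= e / 3 by apply: B; rewrite lerDl.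
  have B3 : `|euler_pow2 X K x 0 l - euler_pow2 X K t 0 l| <= e / 3 by near: t.
  move: B1 B2 B3; rewrite !ler_norml => /andP[? ?] /andP[? ?] /andP[? ?].
  by apply/andP; split; lra.
have sT := smooth_tangent_field sX; have tT := tame_tangent_field sX tX.
pose g i x := eflow (tangent_field X) (row_mx x (delta_mx 0 i)) 0 (rshift d l).
have Cg i : Ck_on k setT (g i).
  have := IH _ _ (rshift d l) sT tT.
  apply: (@Ck_on_comp _ _ _ _ setT setT _ (fun x => row_mx x (delta_mx 0 i))) => // j.
  exact: (smooth_row_mx (@smooth_map_id _ _ _) (@smooth_map_cst _ _ _ _ _)).
have D x i : is_derive x (delta_mx 0 i) (fun x => eflow X x 0 l) (g i x).
  by apply: is_derive_eflow => //; exact: Ck_on_cont (Cg i) I.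
split=> [x _|i]; first exact: Ck_on_cont (IH _ _ l sX tX) I.
split=> [x _|]; first by case: (D x i).
rewrite (_ : partial i _ = g i)//; apply/funext => x.
by rewrite /partial; case: (D x i).
Unshelve. all: by end_near. Qed.

Lemma smooth_eflow d (X : 'rV[R]_d -> 'rV[R]_d) :
  smooth_map setT X -> tame X -> smooth_map setT (eflow X).
Proof. by move=> sX tX l k; exact: Ck_on_eflow. Qed.

Lemma partial_eflow_cvg d (X : 'rV[R]_d -> 'rV[R]_d) x i l :
  smooth_map setT X -> tame X ->
  (fun k => partial i (fun x => euler_pow2 X k x 0 l) x) @ \oo -->
  partial i (fun x => eflow X x 0 l) x.
Proof.
move=> sX tX.
have sT := smooth_tangent_field sX; have tT := tame_tangent_field sX tX.
have oT n : open (@setT 'rV[R]_n) by exact: openT.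
have ch : {for x, continuous (fun x : 'rV[R]_d => eflow (tangent_field X) (row_mx x (delta_mx 0 i)) 0 (rshift d l))}.
  apply: (@Ck_on_cont _ _ 0 setT _ _ _ I).
  apply: (@Ck_on_comp _ _ _ _ setT setT (fun y => eflow (tangent_field X) y 0 (rshift d l))
     (fun x => row_mx x (delta_mx 0 i))) => // [j|].
    exact: (smooth_row_mx (@smooth_map_id _ _ _) (@smooth_map_cst _ _ _ _ _)).
  exact: Ck_on_eflow.
have [_] := is_derive_eflow sX tX ch; rewrite {2}/partial => ->.
under eq_fun do rewrite partial_euler// mxE.
exact: eflow_cvg.
Qed.

End EulerFlow.

(** * Flow of a linear combination of commuting fields *)

Section CommutingFlow.
Variable R : realType.

Lemma norm_sum_le n (F : 'I_n -> R) c : (forall i, `|F i| <= c) ->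
  `|\sum_i F i| <= n%:R * c.
Proof.
move=> H; apply: le_trans (ler_norm_sum _ _ _) _.
apply: le_trans (_ : \sum_(i < n) c <= _); first by apply: ler_sum => i _; exact: H.
by rewrite sumr_const card_ord mulr_natl.
Qed.

Lemma partial_sum m n (F : 'I_n -> 'rV[R]_m -> R) i x :
  (forall q, derivable (F q) x (delta_mx 0 i)) ->
  derivable (fun x => \sum_q F q x) x (delta_mx 0 i) /\
  partial i (fun x => \sum_q F q x) x = \sum_q partial i (F q) x.
Proof.
move=> dF.
have -> : (fun x => \sum_q F q x) = \sum_q F q.
  by apply/funext => z; rewrite fct_sumE.
by split; [exact: derivable_sum|exact: derive_sum].
Qed.

(** The field [(s, x) |-> (0, sum_i s_i X_i(x))]. As [s] is constant along it, its time-one map from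
    [(s, x)] is that of [sum_i s_i X_i] from [x], with [s] treated as part of the initial point. *)
Definition multi_field n m (X : 'I_n -> 'rV[R]_m -> 'rV[R]_m) (y : 'rV[R]_(n + m)) :
    'rV[R]_(n + m) :=
  row_mx 0 (\sum_i lsubmx y 0 i *: X i (rsubmx y)).

Definition multi_flow n m (X : 'I_n -> 'rV[R]_m -> 'rV[R]_m) (y : 'rV[R]_(n + m)) :=
  rsubmx (eflow (multi_field X) y).

Section Fix.
Variables (n m : nat) (X : 'I_n -> 'rV[R]_m -> 'rV[R]_m).
Hypothesis sX : forall i, smooth_map setT (X i).

Let Y := multi_field X.

Lemma smooth_multi_field : smooth_map setT (multi_field X).
Proof.
have oT d : open (@setT 'rV[R]_d) by exact: openT.
apply: smooth_row_mx; first exact: smooth_map_cst.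
apply: smooth_map_sum => // i _; apply: smooth_map_scale => //.
  exact: smooth_lsubmx.
exact: (smooth_map_comp (oT _) (oT _) (fun _ _ => I) (@smooth_rsubmx _ _ _ _) (sX i)).
Qed.

Lemma euler_multi_l N j y : lsubmx (euler Y N j y) = lsubmx y.
Proof.
elim: j => [//|j IH]; rewrite /euler iterS -/(euler _ _ _ _) /euler_step.
by rewrite linearD linearZ /= row_mxKl scaler0 addr0.
Qed.

Lemma euler_multi_r N j y : rsubmx (euler Y N j.+1 y) =
  rsubmx (euler Y N j y) +
  N%:R^-1 *: \sum_i lsubmx y 0 i *: X i (rsubmx (euler Y N j y)).
Proof.
rewrite {1}/euler iterS -/(euler _ _ _ _) /euler_step linearD linearZ /= row_mxKr.
by rewrite euler_multi_l.
Qed.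

Variable C : R.
Hypothesis XC : forall i x, `|X i x| <= C.
Hypothesis C0 : 0 <= C.

Lemma euler_multi_step N j y :
  `|rsubmx (euler Y N j.+1 y) - rsubmx (euler Y N j y)| <=
  N%:R^-1 * (n%:R * (`|lsubmx y| * C)).
Proof.
rewrite euler_multi_r addrC addKr normrZ ger0_norm ?invr_ge0//.
apply: ler_wpM2l; first by rewrite invr_ge0.
apply: norm_le_coord => [|l]; first by rewrite !mulr_ge0.
rewrite summxE; apply: norm_sum_le => i; rewrite mxE normrM.
apply: ler_pM => //; first exact: coord_le_norm.
exact: le_trans (coord_le_norm _ _) (XC _ _).
Qed.

Lemma euler_multi_dist N j y : (j <= N)%N ->
  `|rsubmx (euler Y N j y) - rsubmx y| <= n%:R * (`|lsubmx y| * C).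
Proof.
move=> jN.
have B0 : 0 <= n%:R * (`|lsubmx y| * C) by rewrite !mulr_ge0.
have H : `|rsubmx (euler Y N j y) - rsubmx y| <= j%:R * (N%:R^-1 * (n%:R * (`|lsubmx y| * C))).
  elim: j {jN} => [|j IH]; first by rewrite subrr normr0 mul0r.
  rewrite -(subrK (rsubmx (euler Y N j y)) (rsubmx (euler Y N j.+1 y))) -addrA.
  apply: le_trans (ler_normD _ _) _.
  by rewrite -natr1 mulrDl mul1r [leRHS]addrC; apply: lerD => //; exact: euler_multi_step.
apply: le_trans H _; rewrite mulrA -[leRHS]mul1r; apply: ler_wpM2r => //.
have [N0|N0] := posnP N; first by rewrite N0 invr0 mulr0.
by rewrite ler_pdivrMr ?ltr0n// mul1r ler_nat.
Qed.

(** The coefficients stay constant and, the fields being bounded by [C], the point moves by at most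
    [n |s| C] up to time one. *)
Lemma tame_multi_field : tame (multi_field X).
Proof.
move=> r; exists (`|r| + n%:R * (`|r| * C)) => N j y jN yr.
have yr' : `|y| <= `|r| by exact: le_trans yr (ler_norm _).
have B0 : 0 <= n%:R * (`|r| * C) by rewrite !mulr_ge0.
rewrite -[euler _ _ _ _]hsubmxK euler_multi_l; apply: norm_row_mx_le.
  by apply: le_trans (norm_lsubmx_le _) _; apply: le_trans yr' _; rewrite lerDl.
rewrite -(subrK (rsubmx y) (rsubmx _)) addrC; apply: le_trans (ler_normD _ _) _.
apply: lerD; first exact: le_trans (norm_rsubmx_le _) yr'.
apply: le_trans (euler_multi_dist _ jN) _.
rewrite ler_wpM2l// ler_wpM2r//; exact: le_trans (norm_lsubmx_le _) yr'.
Qed.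

Lemma smooth_multi_flow : smooth_map setT (multi_flow X).
Proof.
move=> j; rewrite /multi_flow; under eq_fun do rewrite mxE.
by apply: smooth_eflow; [exact: smooth_multi_field|exact: tame_multi_field].
Qed.

Lemma multi_flow_approx y : exists D, 0 <= D /\ forall k,
  `|multi_flow X y - rsubmx (euler_pow2 Y k y)| <= D / 2 ^+ k.
Proof.
have [D [D0 HD]] := eflowP smooth_multi_field tame_multi_field `|y|.
exists D; split=> // k; apply: le_trans (HD _ _ (lexx _)).
by rewrite /multi_flow -linearB/=; exact: norm_rsubmx_le.
Qed.

Lemma multi_flow_dist y :
  `|multi_flow X y - rsubmx y| <= n%:R * (`|lsubmx y| * C).
Proof.
have [D [D0 HD]] := multi_flow_approx y.
apply/ler_addgt0Pr => e e0; have [K /(_ _ (leqnn K)) HK] := small_pow2 D e0.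
rewrite -(subrK (rsubmx (euler_pow2 Y K y)) (multi_flow X y)) -addrA addrC.
apply: le_trans (ler_normD _ _) _; apply: lerD; first exact: euler_multi_dist.
exact: le_trans (HD K) HK.
Qed.

Lemma multi_flow0 y : lsubmx y = 0 -> multi_flow X y = rsubmx y.
Proof.
move=> y0; apply/eqP; rewrite -subr_eq0 -normr_le0.
by apply: le_trans (multi_flow_dist y) _; rewrite y0 normr0 mul0r mulr0.
Qed.

(** The discrete variational equation in the coefficient [s_i]: the linearised step, with the source
    term [X i] produced by differentiating [s_i] itself. *)
Lemma partial_euler_multi N j y i l :
  let p j l := partial (lshift m i) (fun y => rsubmx (euler Y N j y) 0 l) y in
  p j.+1 l = p j l + N%:R^-1 * (X i (rsubmx (euler Y N j y)) 0 l +
    \sum_q lsubmx y 0 q * \sum_r partial r (fun x => X q x 0 l) (rsubmx (euler Y N j y)) * p j r).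
Proof.
move=> p; rewrite /p.
have oT d : open (@setT 'rV[R]_d) by exact: openT.
have sE : smooth_map setT (fun y => rsubmx (euler Y N j y)).
  exact: (smooth_map_comp (oT _) (oT _) (fun _ _ => I)
    (smooth_euler N j smooth_multi_field) (@smooth_rsubmx _ _ _ _)).
have dE q : derivable (fun y => rsubmx (euler Y N j y) 0 q) y (delta_mx 0 (lshift m i)).
  exact: (@smooth_on_derivable _ _ setT _ _ y (sE q) I).
pose G q := (fun x => X q x 0 l) \o (fun y => rsubmx (euler Y N j y)).
have dG q : derivable (G q) y (delta_mx 0 (lshift m i)).
  apply: (@smooth_on_derivable _ _ setT _ _ y _ I).
  exact: (smooth_on_comp (oT _) (oT _) (fun _ _ => I) sE (sX q l)).
have dc q : derivable (fun y : 'rV[R]_(n + m) => y 0 (lshift m q)) y (delta_mx 0 (lshift m i)).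
  by case: (is_derive_coord y (delta_mx 0 (lshift m i)) (lshift m q)).
have -> : (fun y => rsubmx (euler Y N j.+1 y) 0 l) = (fun y =>
    rsubmx (euler Y N j y) 0 l + N%:R^-1 * \sum_q y 0 (lshift m q) * G q y).
  apply/funext => z; rewrite euler_multi_r !mxE summxE; congr (_ + _ * _).
  by apply: eq_bigr => q _; rewrite !mxE.
have dcG q : derivable (fun y : 'rV[R]_(n + m) => y 0 (lshift m q) * G q y) y (delta_mx 0 (lshift m i)).
  exact: derivableM.
have [dS ES] := partial_sum dcG.
have dZ : derivable (fun y : 'rV[R]_(n + m) => N%:R^-1 * \sum_q y 0 (lshift m q) * G q y) y (delta_mx 0 (lshift m i)).
  exact: derivableZ.
rewrite (partialD (dE l) dZ) (partialZ _ dS) ES; congr (_ + _ * _).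
have H q : partial (lshift m i) (fun y : 'rV[R]_(n + m) => y 0 (lshift m q) * G q y) y =
   (q == i)%:R * G q y + lsubmx y 0 q * \sum_r partial r (fun x => X q x 0 l) (rsubmx (euler Y N j y)) *
       partial (lshift m i) (fun y => rsubmx (euler Y N j y) 0 r) y.
  rewrite (partialM (dc q) (dG q)) partial_coord mulrC addrC; congr (_ + _).
    by rewrite mulrC (inj_eq (@lshift_inj _ _)).
  rewrite mulrC mxE; congr (_ * _).
  exact: (@partial_comp R (n + m) m setT (fun x => X q x 0 l)
    (fun y => rsubmx (euler Y N j y)) y (lshift m i) (oT _) I (sX q l 1%N) dE).
rewrite (eq_bigr _ (fun q _ => H q)) big_split/=; congr (_ + _).
rewrite (bigD1 i)//= eqxx mul1r big1 ?addr0// => q qi.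
by rewrite (negPf qi) mul0r.
Qed.

Variables (z0 : 'rV[R]_m) (rho : R).
Hypothesis comm : forall x, `|x - z0| <= rho -> forall i q l,
  \sum_r X i x 0 r * partial r (fun x => X q x 0 l) x =
  \sum_r X q x 0 r * partial r (fun x => X i x 0 l) x.

(** Since the fields commute, [(j/N) X_i], evaluated along the Euler iterates, satisfies the
    discrete variational equation up to terms of order [1/N^2]. It starts from the same value 0 as
    the derivative in [s_i], so Gronwall bounds the discrepancy at [j = N] by order [1/N]. The two
    halves of [rho] serve for the initial point and for its displacement. *)
Lemma partial_euler_multi_approx (i : 'I_n) (delta : R) : 0 <= delta ->
  n%:R * (delta * C) <= rho / 2 ->
  exists D, 0 <= D /\ forall N y l, (0 < N)%N -> `|lsubmx y| <= delta ->
    `|rsubmx y - z0| <= rho / 2 ->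
    `|partial (lshift m i) (fun y => rsubmx (euler Y N N y) 0 l) y -
      X i (rsubmx (euler Y N N y)) 0 l| <= D / N%:R.
Proof.
move=> d0 drho.
have rho0 : 0 <= rho.
  have : 0 <= rho / 2 by apply: le_trans drho; rewrite !mulr_ge0.
  by rewrite pmulr_lge0 ?invr_gt0.
pose r := `|z0| + rho.
have ballr x : `|x - z0| <= rho -> `|x| <= r.
  by move=> xz; rewrite -(subrK z0 x) addrC; apply: le_trans (ler_normD _ _) _; rewrite lerD2l.
have [K1 [K10 HK1]] := @finite_bound R ('I_n * 'I_m * 'I_m)%type _ (fun x : 'rV[R]_m => `|x| <= r)
  (fun t x => `|partial t.1.2 (fun x => X t.1.1 x 0 t.2) x|)
  (fun t => smooth_setT_bounded r (smooth_on_partial t.1.2 (sX t.1.1 t.2))).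
have /choice[K2 HK2] := fun l => smooth_setT_taylor r (sX i l).
pose K3 := \sum_l K2 l.
have K2K3 l : K2 l <= K3.
  by rewrite /K3 (bigD1 l)//= lerDl sumr_ge0// => q _; case: (HK2 q).
have K30 : 0 <= K3 by apply: sumr_ge0 => q _; case: (HK2 q).
pose K := n%:R * (delta * (m%:R * K1)).
have K0 : 0 <= K by rewrite !mulr_ge0.
pose D := n%:R * (delta * (m%:R * (C * K1))) + K3 * (n%:R * (delta * C)) ^+ 2.
have D0 : 0 <= D by rewrite addr_ge0// !mulr_ge0.
exists (D * expR K); split; first by rewrite mulr_ge0 ?expR_ge0.
move=> N y l0 N0 ya yz.
have Np : (0 : R) < N%:R by rewrite ltr0n.
pose h : R := N%:R^-1.
have h0 : 0 <= h by rewrite invr_ge0 ltW.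
pose x j := rsubmx (euler Y N j y).
pose p j l := partial (lshift m i) (fun y => rsubmx (euler Y N j y) 0 l) y.
(* The discrepancy between the derivative in [s_i] after [j] steps and its expected value
   [(j/N) X_i]. *)
pose W j : 'rV[R]_m := \row_l (p j l - j%:R * h * X i (x j) 0 l).
have WE j l : W j 0 l = p j l - j%:R * h * X i (x j) 0 l by rewrite mxE.
have xB j : (j <= N)%N -> `|x j - z0| <= rho.
  move=> jN; rewrite -(subrK (rsubmx y) (x j)) -addrA (splitr rho).
  apply: le_trans (ler_normD _ _) _; apply: lerD => //.
  apply: le_trans (euler_multi_dist y jN) _; apply: le_trans drho.
  by rewrite ler_wpM2l// ler_wpM2r.
have aq q : `|lsubmx y 0 q| <= delta by exact: le_trans (coord_le_norm _ _) ya.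
have W0 : W 0%N = 0.
  apply/rowP => l; rewrite WE mxE /p.
  have -> : (fun y : 'rV[R]_(n + m) => rsubmx (euler Y N 0 y) 0 l) = (fun y => y 0 (rshift n l)).
    by apply/funext => z; rewrite mxE.
  by rewrite partial_coord eq_rlshift !mul0r subr0.
have WS j : (j < N)%N -> `|W j.+1| <= (1 + h * K) * `|W j| + h ^+ 2 * D.
  move=> jN; apply: norm_le_coord => [|l].
    by rewrite addr_ge0// mulr_ge0// ?addr_ge0 ?mulr_ge0// exprn_ge0.
  have xj := xB _ (ltnW jN); have xj1 := xB _ jN.
  pose dX q r := partial r (fun x => X q x 0 l) (x j).
  pose T := \sum_q lsubmx y 0 q * \sum_r X q (x j) 0 r * dX i r.
  pose S := \sum_q lsubmx y 0 q * \sum_r dX q r * W j 0 r.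
  (* [h * T] is the first-order change of [X i] over one Euler step, and [eps] the Taylor remainder,
     of order [h ^+ 2]. *)
  pose eps := X i (x j.+1) 0 l - X i (x j) 0 l - h * T.
  have epsE : `|eps| <= K3 * (h * (n%:R * (delta * C))) ^+ 2.
    have [K20 /(_ _ _ (ballr _ xj) (ballr _ xj1)) H] := HK2 l.
    have -> : eps = X i (x j.+1) 0 l - X i (x j) 0 l -
       \sum_q (x j.+1 - x j) 0 q * partial q (fun x => X i x 0 l) (x j).
      rewrite /eps; congr (_ - _); rewrite /x euler_multi_r -/(x j) addrC addKr.
      transitivity (h * \sum_s \sum_q lsubmx y 0 q * X q (x j) 0 s * dX i s).
        congr (_ * _); rewrite exchange_big/=; apply: eq_bigr => q _.
        by rewrite mulr_sumr; apply: eq_bigr => s _; rewrite mulrA.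
      rewrite mulr_sumr; apply: eq_bigr => s _.
      rewrite mxE -mulrA summxE mulr_suml; congr (_ * _).
      by apply: eq_bigr => q _; rewrite !mxE.
    apply: le_trans H _; apply: ler_pM => //.
    apply: lerXn2r; rewrite ?nnegrE// ?mulr_ge0//.
    apply: le_trans (euler_multi_step _ _ _) _.
    by rewrite ler_wpM2l// ler_wpM2l// ler_wpM2r.
  have TE : `|T| <= n%:R * (delta * (m%:R * (C * K1))).
    apply: norm_sum_le => q; rewrite normrM; apply: ler_pM => //.
    apply: norm_sum_le => s; rewrite normrM; apply: ler_pM => //.
      exact: le_trans (coord_le_norm _ _) (XC _ _).
    by apply: (HK1 (i, s, l)); exact: ballr.
  have SE : `|S| <= K * `|W j|.
    rewrite /K -!mulrA; apply: norm_sum_le => q; rewrite normrM; apply: ler_pM => //.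
    apply: norm_sum_le => s; rewrite normrM; apply: ler_pM => //.
      by apply: (HK1 (q, s, l)); exact: ballr.
    exact: coord_le_norm.
  (* Commutation identifies the linearised step applied to [X i] with [T]. The terms in
     [j%:R * h ^+ 2 * T] then cancel, and one [h ^+ 2 * T] is left over. *)
  have E : W j.+1 0 l = W j 0 l + h * S - h ^+ 2 * T - (j.+1%:R * h) * eps.
    rewrite [LHS]WE [p j.+1 l]partial_euler_multi -/(x j) -/h.
    have -> : \sum_q lsubmx y 0 q * (\sum_s partial s (fun x => X q x 0 l) (x j) *
          partial (lshift m i) (fun y => rsubmx (euler Y N j y) 0 s) y) =
        S + j%:R * h * T.
      rewrite /S /T mulr_sumr -big_split/=; apply: eq_bigr => q _.
      rewrite -(comm xj i q l) [X in _ + X]mulrCA -mulrDr; congr (_ * _).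
      rewrite mulr_sumr -big_split/=; apply: eq_bigr => s _.
      by rewrite -/(p j s) WE /dX; ring.
    rewrite -/(p j l) WE /eps -natr1; ring.
  rewrite E; apply: le_trans (ler_normB _ _) _.
  apply: le_trans (lerD (le_trans (ler_normB _ _) (lerD (ler_normD _ _) (lexx _))) (lexx _)) _.
  have h20 : 0 <= h ^+ 2 by exact: exprn_ge0.
  have jh0 : 0 <= j.+1%:R * h by rewrite mulr_ge0.
  rewrite (normrM h S) (normrM _ T) (normrM _ eps) (ger0_norm h0) (ger0_norm h20) (ger0_norm jh0).
  have jh : j.+1%:R * h <= 1 by rewrite ler_pdivrMr// mul1r ler_nat.
  have B1 : j.+1%:R * h * `|eps| <= h ^+ 2 * (K3 * (n%:R * (delta * C)) ^+ 2).
    apply: le_trans (_ : `|eps| <= _).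
      by rewrite -[leRHS]mul1r; apply: ler_wpM2r.
    by apply: le_trans epsE _; rewrite exprMn mulrCA.
  have B2 := ler_wpM2l h0 SE.
  have B3 := ler_wpM2l (exprn_ge0 2 h0) TE.
  have B4 := coord_le_norm (W j) l.
  apply: le_trans (lerD (lerD (lerD B4 B2) B3) B1) _.
  by rewrite le_eqVlt; apply/orP; left; apply/eqP; rewrite /D; ring.
have := @gronwall R (fun j => `|W j|) h K (h ^+ 2 * D) N h0 K0 _ _ WS N (leqnn _).
have hN : N%:R * h = 1 by rewrite divff ?gt_eqF.
rewrite W0 normr0 add0r hN mul1r => H.
have := le_trans (coord_le_norm (W N) l0) (H _ (lexx _)).
rewrite WE hN mul1r => H'; apply: le_trans (H' _) _; first by rewrite mulr_ge0// exprn_ge0.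
have E : N%:R * (h ^+ 2 * D) = D * h.
  by transitivity ((N%:R * h) * (D * h)); [ring|rewrite hN mul1r].
by rewrite E mulrAC.
Qed.

(** Uniqueness of limits: the derivatives of the Euler iterates tend to the left side by
    [partial_eflow_cvg], and to the right side by the preceding estimate. *)
Lemma partial_multi_flow (i : 'I_n) (delta : R) y l : 0 <= delta ->
  n%:R * (delta * C) <= rho / 2 -> `|lsubmx y| <= delta ->
  `|rsubmx y - z0| <= rho / 2 ->
  partial (lshift m i) (fun y => multi_flow X y 0 l) y = X i (multi_flow X y) 0 l.
Proof.
move=> d0 drho ya yz.
have [D [D0 HD]] := partial_euler_multi_approx i d0 drho.
have [D' [D'0 HD']] := multi_flow_approx y.
(* A ball containing the limit and all the iterates, since [D' / 2 ^+ k <= D']. *)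
pose r := `|multi_flow X y| + D'.
have [K [K0 HK]] := smooth_setT_lipschitz r (sX i l).
have mr : `|multi_flow X y| <= r by rewrite lerDl.
have er k : `|rsubmx (euler_pow2 Y k y)| <= r.
  rewrite -(subrK (multi_flow X y) (rsubmx _)) addrC.
  apply: le_trans (ler_normD _ _) _; rewrite lerD2l distrC.
  apply: le_trans (HD' k) _; rewrite ler_pdivrMr ?exprn_gt0// ler_peMr//.
  by rewrite exprn_ege1// ler1n.
have C1 : (fun k => partial (lshift m i) (fun y => euler_pow2 Y k y 0 (rshift n l)) y) @ \oo -->
   partial (lshift m i) (fun y => multi_flow X y 0 l) y.
  rewrite (_ : (fun y => multi_flow X y 0 l) = fun y => eflow Y y 0 (rshift n l)); last first.
    by apply/funext => z; rewrite mxE.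
  apply: partial_eflow_cvg; [exact: smooth_multi_field|exact: tame_multi_field].
have C2 : (fun k => partial (lshift m i) (fun y => euler_pow2 Y k y 0 (rshift n l)) y) @ \oo -->
   X i (multi_flow X y) 0 l.
  apply/cvgrPdist_le => e e0; have [k0 Hk0] := small_pow2 (K * D' + D) e0.
  exists k0 => // k /= /Hk0 kk; apply: le_trans kk.
  have := HD (2 ^ k)%N y l; rewrite expn_gt0/= natrX => /(_ isT ya yz) H1.
  have H2 := HK _ _ (er k) mr.
  have H3 : K * `|multi_flow X y - rsubmx (euler_pow2 Y k y)| <= K * D' / 2 ^+ k.
    by rewrite -mulrA ler_wpM2l.
  have -> : (fun y => euler_pow2 Y k y 0 (rshift n l)) = (fun y => rsubmx (euler_pow2 Y k y) 0 l).
    by apply/funext => z; rewrite mxE.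
  rewrite mulrDl -(subrK (X i (rsubmx (euler_pow2 Y k y)) 0 l) (X i (multi_flow X y) 0 l)) -addrA.
  apply: le_trans (ler_normD _ _) _; apply: lerD; first exact: le_trans H2 H3.
  by rewrite distrC.
by rewrite -(cvg_lim (@Rhausdorff R) C1) (cvg_lim (@Rhausdorff R) C2).
Qed.

End Fix.
End CommutingFlow.

(** * Inverse functions and rectification *)

Section InverseFunction.
Variable R : realType.

Lemma mulmx_bound m d (B : 'M[R]_(m, d)) :
  exists c, 0 < c /\ forall v : 'rV[R]_m, `|v *m B| <= c * `|v|.
Proof.
pose c := \sum_i \sum_l `|B i l|.
have c0 : 0 <= c by apply: sumr_ge0 => i _; exact: sumr_ge0.
exists (c + 1); split=> [|v]; first by rewrite ltr_wpDl.
apply: norm_le_coord => [|l]; first by rewrite mulr_ge0// addr_ge0.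
rewrite mxE; apply: le_trans (ler_norm_sum _ _ _) _.
apply: le_trans (_ : c * `|v| <= _); last by rewrite ler_wpM2r// lerDl.
rewrite /c mulr_suml; apply: ler_sum => i _; rewrite normrM mulrC.
apply: ler_pM => //; last exact: coord_le_norm.
by rewrite (bigD1 l)//= lerDl sumr_ge0.
Qed.

Definition jac m d (Phi : 'rV[R]_m -> 'rV[R]_d) x : 'M[R]_(m, d) :=
  \matrix_(i, l) partial i (fun x => Phi x 0 l) x.

(** The fixed point of [T x = x - g x + y], which contracts by 1/2 and maps the ball into itself.
    Its iterates from [x0] move by at most [(r / 2) / 2 ^+ k], so [geometric_limit] applies to each
    coordinate. *)
Lemma contraction_solve m (g : 'rV[R]_m -> 'rV[R]_m) x0 r y : 0 <= r ->
  (forall x x', `|x - x0| <= r -> `|x' - x0| <= r ->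
     `|g x' - g x - (x' - x)| <= 2^-1 * `|x' - x|) ->
  `|y - g x0| <= r / 2 -> exists x, `|x - x0| <= r /\ g x = y.
Proof.
move=> r0 Hg yr.
pose T x := x - g x + y.
have TT x x' : T x' - T x = - (g x' - g x - (x' - x)).
  by rewrite /T; apply/rowP => i; rewrite !mxE; ring.
have Tx x x' : `|x - x0| <= r -> `|x' - x0| <= r -> `|T x' - T x| <= 2^-1 * `|x' - x|.
  by move=> xr xr'; rewrite TT normrN; exact: Hg.
have T0 : `|T x0 - x0| <= r / 2.
  have -> // : T x0 - x0 = y - g x0.
  by rewrite /T; apply/rowP => i; rewrite !mxE; ring.
have x0r : `|x0 - x0| <= r by rewrite subrr normr0.
have TB x : `|x - x0| <= r -> `|T x - x0| <= r.
  move=> xr; rewrite -(subrK (T x0) (T x)) -addrA (splitr r).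
  apply: le_trans (ler_normD _ _) _; apply: lerD => //.
  by apply: le_trans (Tx _ _ x0r xr) _; rewrite mulrC ler_wpM2r.
pose u k := iter k T x0.
have uB k : `|u k - x0| <= r by elim: k => [//|k IH]; rewrite /u iterS; exact: TB.
have uS k : `|u k.+1 - u k| <= (r / 2) / 2 ^+ k.
  elim: k => [|k IH]; first by rewrite expr0 divr1.
  apply: le_trans (Tx _ _ (uB k) (uB k.+1)) _.
  apply: le_trans (ler_wpM2l _ IH) _ => //.
  by rewrite exprS invfM mulrCA.
have /choice[l Hl] : forall j, exists l : R, forall k, `|l - u k 0 j| <= 2 * (r / 2) / 2 ^+ k.
  move=> j; apply: geometric_limit => k; apply: le_trans (uS k).
  by apply: le_trans (coord_le_norm _ j); rewrite !mxE.
pose x : 'rV[R]_m := \row_j l j.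
have xu k : `|x - u k| <= r / 2 ^+ k.
  apply: norm_le_coord => [|j]; first by rewrite divr_ge0// exprn_ge0.
  rewrite !mxE; apply: le_trans (Hl _ _) _.
  by rewrite [2 * _]mulrC divfK.
have xr : `|x - x0| <= r by have := xu 0%N; rewrite expr0 divr1.
have Txx : T x = x.
  apply/eqP; rewrite -subr_eq0 -normr_le0; apply/ler_addgt0Pr => e e0; rewrite add0r.
  have [K /(_ _ (leqnn K)) HK] := small_pow2 (r + r) e0.
  apply: le_trans HK; rewrite -(subrK (u K.+1) (T x)) -addrA mulrDl.
  apply: le_trans (ler_normD _ _) _; apply: lerD.
    apply: le_trans (Tx _ _ (uB K) xr) _.
    apply: le_trans (ler_wpM2l _ (xu K)) _ => //.
    rewrite -[leRHS]mul1r; apply: ler_wpM2r; first by rewrite divr_ge0// exprn_ge0.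
    by rewrite invf_le1// ler1n.
  rewrite distrC; apply: le_trans (xu _) _; apply: ler_wpM2l => //.
  by rewrite lef_pV2 ?posrE ?exprn_gt0// ler_eXn2l// ltr1n.
exists x; split=> //.
apply/rowP => i; move/rowP: Txx => /(_ i); rewrite /T !mxE => E; lra.
Qed.

Theorem inverse_function m (U : set 'rV[R]_m) (Phi : 'rV[R]_m -> 'rV[R]_m) x0 :
  open U -> U x0 -> smooth_map U Phi -> jac Phi x0 \in unitmx ->
  exists (O O' : set 'rV[R]_m) (Psi : 'rV[R]_m -> 'rV[R]_m),
    [/\ [/\ open O, open O', O x0 & O `<=` U],
        [/\ forall x, O x -> O' (Phi x), forall y, O' y -> O (Psi y),
            forall x, O x -> Psi (Phi x) = x & forall y, O' y -> Phi (Psi y) = y],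
        forall y, O' y -> jac Phi (Psi y) \in unitmx /\
          forall i k, partial i (fun y => Psi y 0 k) y = invmx (jac Phi (Psi y)) i k &
        smooth_map O' Psi].
Proof.
move=> oU Ux0 sPhi uJ.
pose A := invmx (jac Phi x0).
(* This normalises the Jacobian at [x0] to the identity, so that [g] is nearly a translation around
   [x0]. *)
pose g x := Phi x *m A.
have gE x l : g x 0 l = \sum_k Phi x 0 k * A k l by rewrite mxE.
have sg : smooth_map U g.
  move=> l; under eq_fun do rewrite gE.
  by apply: smooth_on_sum => // k _; apply: smooth_on_mul => //; exact: smooth_on_cst.
have Jg x : U x -> jac g x = jac Phi x *m A.
  move=> Ux; apply/matrixP => i l; rewrite !mxE.
  under eq_fun do rewrite gE.
  have dk k : derivable (fun x => Phi x 0 k * A k l) x (delta_mx 0 i).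
    apply: (@smooth_on_derivable _ _ U _ _ x _ Ux).
    by apply: smooth_on_mul => //; exact: smooth_on_cst.
  have -> : (fun x => \sum_k Phi x 0 k * A k l) = \sum_k (fun x => Phi x 0 k * A k l).
    by apply/funext => z; rewrite fct_sumE.
  rewrite /partial derive_sum//; apply: eq_bigr => k _.
  under eq_fun do rewrite mulrC.
  rewrite -/(partial i (fun x => A k l * Phi x 0 k) x) partialZ.
    by rewrite mulrC mxE.
  exact: (smooth_on_derivable (sPhi k) Ux).
(* The tolerance on each entry of the Jacobian: the sum over [m] coordinates is then at most 1/2,
   the constant of [contraction_solve]. *)
pose e : R := (2 * (m%:R + 1))^-1.
have m1 : 0 < (m%:R : R) + 1 by rewrite ltr_wpDl.
have e0 : 0 < e by rewrite invr_gt0 mulr_gt0.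
have em : e * m%:R <= 2^-1.
  rewrite /e invfM -mulrA ler_piMr ?invr_ge0// mulrC ler_pdivrMr// mul1r.
  by rewrite lerDl.
have N1 : \forall z \near x0, U z /\ forall il : 'I_m * 'I_m,
    `|partial il.1 (fun x => g x 0 il.2) z - (il.1 == il.2)%:R| <= e.
  near=> z; split; first by near: z; exact: open_nbhs_nbhs.
  near: z; apply: filter_forall => -[i l] /=.
  have c := smooth_on_cont (smooth_on_partial i (sg l)) Ux0.
  have E : partial i (fun x => g x 0 l) x0 = (i == l)%:R.
    have := Jg x0 Ux0; rewrite mulmxV// => /matrixP/(_ i l).
    by rewrite !mxE.
  have /cvgrPdist_le/(_ e e0) := c; rewrite E.
  by apply: filterS => z; rewrite distrC.
have [r0 /= r00 Hr0] := (nbhs_ballP _ _).1 N1.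
pose r := r0 / 2.
have rr : 0 < r by rewrite divr_gt0.
have Hr z : `|z - x0| <= r -> U z /\ forall i l,
    `|partial i (fun x => g x 0 l) z - (i == l)%:R| <= e.
  move=> zr; have [|Uz H] := Hr0 z.
    rewrite -ball_normE /= distrC; apply: le_lt_trans zr _.
    by rewrite /r ltr_pdivrMr// ltr_pMr// ltr1n.
  by split=> // i l; exact: (H (i, l)).
have gMV x y : `|x - x0| <= r -> `|y - x0| <= r ->
     `|g y - g x - (y - x)| <= 2^-1 * `|y - x|.
  move=> xr yr; apply: norm_le_coord => [|l]; first by rewrite mulr_ge0.
  have := @mean_value R m (fun x => g x 0 l) x0 r e (fun i => (i == l)%:R) _ x y xr yr.
  have -> : \sum_i (y - x) 0 i * (i == l)%:R = (y - x) 0 l.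
    rewrite (bigD1 l)//= eqxx mulr1 big1 ?addr0// => i il.
    by rewrite (negPf il) mulr0.
  move=> H; rewrite [X in `|X|](_ : _ = g y 0 l - g x 0 l - (y - x) 0 l); last by rewrite !mxE.
  apply: le_trans (H _) _.
    move=> z zr i; have [Uz Hz] := Hr _ zr.
    by split; [exact: (smooth_on_derivable (sg l) Uz)|exact: Hz].
  apply: le_trans (ler_wpM2l (ltW e0) (sum_norm_coord _)) _.
  by rewrite mulrA ler_wpM2r.
have ginj x y : `|x - x0| <= r -> `|y - x0| <= r -> `|y - x| <= 2 * `|g y - g x|.
  move=> xr yr; have H := gMV _ _ xr yr.
  have H2 : `|y - x| <= `|g y - g x| + 2^-1 * `|y - x|.
    have {1}-> : y - x = (g y - g x) - (g y - g x - (y - x)) by rewrite opprB addrCA subrr addr0.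
    by apply: le_trans (ler_normB _ _) _; rewrite lerD2l.
  lra.
have [cA [cA0 HcA]] := mulmx_bound A.
(* The Jacobian of [g] stays so close to the identity that a vector [v] with [v *m jac g x = 0]
   satisfies [|v| <= |v| / 2]. *)
have uJx x : `|x - x0| <= r -> jac Phi x \in unitmx.
  move=> xr; have [Ux Hx] := Hr _ xr.
  have : jac g x \in unitmx.
    rewrite -row_free_unit; apply: inj_row_free => v vJ.
    apply/eqP; rewrite -normr_le0.
    have H : `|v| <= 2^-1 * `|v|.
      apply: norm_le_coord => [|l]; first by rewrite mulr_ge0.
      have : (v *m jac g x) 0 l = 0 by rewrite vJ mxE.
      rewrite mxE => E.
      have -> : v 0 l = - \sum_i v 0 i * (partial i (fun x => g x 0 l) x - (i == l)%:R).
        under eq_bigr do rewrite mulrBr; rewrite sumrB.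
        have -> : \sum_i v 0 i * (i == l)%:R = v 0 l.
          rewrite (bigD1 l)//= eqxx mulr1 big1 ?addr0// => i il.
          by rewrite (negPf il) mulr0.
        have -> : \sum_i v 0 i * partial i (fun x => g x 0 l) x = 0.
          by rewrite -[RHS]E; apply: eq_bigr => i _; rewrite mxE.
        by rewrite sub0r opprK.
      rewrite normrN; apply: le_trans (ler_norm_sum _ _ _) _.
      apply: le_trans (_ : \sum_i `|v 0 i| * e <= _).
        by apply: ler_sum => i _; rewrite normrM ler_wpM2l.
      rewrite -mulr_suml mulrC; apply: le_trans (ler_wpM2l (ltW e0) (sum_norm_coord _)) _.
      by rewrite mulrA ler_wpM2r.
    lra.
  by rewrite Jg// unitmx_mul => /andP[].
(* The points whose image under [A] satisfies the hypothesis of [contraction_solve]; being written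
   through [A], this set is visibly open. *)
pose O' : set 'rV[R]_m := [set y | `|y *m A - g x0| < r / 2].
pose O : set 'rV[R]_m := [set x | `|x - x0| < r /\ O' (Phi x)].
have oO' : open O'.
  rewrite openE => y Oy; rewrite /interior/=.
  have d0 : 0 < (r / 2 - `|y *m A - g x0|) / cA by rewrite divr_gt0// subr_gt0.
  apply/nbhs_ballP; exists ((r / 2 - `|y *m A - g x0|) / cA) => //= z.
  rewrite -ball_normE/= ltr_pdivlMr// => H; rewrite /O' /=.
  rewrite -(subrK (y *m A) (z *m A)) -addrA -mulmxBl.
  apply: le_lt_trans (ler_normD _ _) _; rewrite -ltrBrDr.
  by apply: le_lt_trans (HcA _) _; rewrite distrC mulrC.
have cPhi x : U x -> {for x, continuous Phi} by exact: smooth_map_cont.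
have oO : open O.
  rewrite openE => x [xr Ox]; rewrite /interior/=.
  have Ux : U x by have [] := Hr _ (ltW xr).
  have N2 : nbhs x (Phi @^-1` O') by apply: cPhi => //; exact: open_nbhs_nbhs.
  have N3 : nbhs x [set z | `|z - x0| < r].
    apply/nbhs_ballP; exists (r - `|x - x0|) => /=; first by rewrite subr_gt0.
    move=> z; rewrite -ball_normE/= distrC ltrBrDr; apply: le_lt_trans.
    by rewrite -(subrK x z) -addrA; apply: le_trans (ler_normD _ _) _; rewrite subrK.
  by apply: filterS2 N2 N3 => z; split.
have /choice[Psi HPsi] : forall y, exists x, O' y -> O x /\ Phi x = y.
  move=> y; have [Oy|nOy] := pselect (O' y); last by exists 0.
  have [x [xr gx]] := contraction_solve (ltW rr) gMV (ltW Oy).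
  exists x => _.
  have Px : Phi x = y.
    by have := congr1 (mulmx^~ (jac Phi x0)) gx; rewrite /g -!mulmxA mulVmx// !mulmx1.
  split=> //; split; last by rewrite Px.
  have x0r : `|x0 - x0| <= r by rewrite subrr normr0 ltW.
  have := gMV _ _ x0r xr; rewrite gx => H.
  have H2 : `|x - x0| <= `|y *m A - g x0| + 2^-1 * `|x - x0|.
    have {1}-> : x - x0 = (y *m A - g x0) - (y *m A - g x0 - (x - x0)).
      by rewrite opprB addrCA subrr addr0.
    by apply: le_trans (ler_normB _ _) _; rewrite lerD2l.
  move: Oy; rewrite /O' /= => Oy; lra.
have PsiO y : O' y -> O (Psi y) by move=> /HPsi[].
have PsiK y : O' y -> Phi (Psi y) = y by move=> /HPsi[].
have PhiK x : O x -> Psi (Phi x) = x.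
  move=> [xr Ox]; have [[zr _] E] := HPsi _ Ox.
  apply/eqP; rewrite -subr_eq0 -normr_le0.
  apply: le_trans (ginj _ _ (ltW xr) (ltW zr)) _.
  by rewrite /g E subrr normr0 mulr0.
have lipPsi y y' : O' y -> O' y' -> `|Psi y' - Psi y| <= 2 * cA * `|y' - y|.
  move=> Oy Oy'; have [yr _] := PsiO _ Oy; have [yr' _] := PsiO _ Oy'.
  apply: le_trans (ginj _ _ (ltW yr) (ltW yr')) _.
  rewrite /g !PsiK// -mulmxBl -mulrA ler_wpM2l//; exact: HcA.
have dPsi y i k : O' y ->
    is_derive y (delta_mx 0 i) (fun y => Psi y 0 k) (invmx (jac Phi (Psi y)) i k).
  move=> Oy; set x := Psi y; have [xr Ox] := PsiO _ Oy.
  have Ux : U x by have [] := Hr _ (ltW xr).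
  have uJy := uJx _ (ltW xr); set J := jac Phi x in uJy *.
  have [c [c0 Hc]] := mulmx_bound (invmx J).
  set v : 'rV[R]_m := delta_mx 0 i.
  have v1 : `|v| <= 1.
    apply: norm_le_coord => // j; rewrite mxE eqxx /=.
    by case: (j == i); rewrite ?normr1 ?normr0.
  apply: is_derive_estimate => d d0.
  have L0 : 0 < 2 * cA by rewrite mulr_gt0.
  pose d' := d / (c * (2 * cA)).
  have d'0 : 0 < d' by rewrite divr_gt0// mulr_gt0.
  have N2 l := C1_estimate oU Ux (sPhi l 1%N) d'0.
  have [s /= s0 Hs] := (nbhs_ballP _ _).1 (filter_forall _ N2).
  have N3 : \forall h \near (0 : R), O' (y + h *: v).
    have : nbhs y O' by exact: open_nbhs_nbhs.
    move=> /nbhs_ballP[t /= t0 Ht]; apply/nbhs_ballP; exists t => //= h.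
    rewrite -ball_normE /= sub0r normrN => ht; apply: Ht.
    rewrite -ball_normE /= opprD addNKr normrN normrZ.
    by apply: le_lt_trans ht; rewrite ler_piMr.
  have N4 : \forall h \near (0 : R), 2 * cA * `|h| < s.
    apply/nbhs_ballP; exists (s / (2 * cA)) => /=; first exact: divr_gt0.
    by move=> h; rewrite -ball_normE /= sub0r normrN ltr_pdivlMr// mulrC.
  apply: filterS2 N3 N4 => h Oh hs.
  pose dl := Psi (y + h *: v) - x.
  have dlh : `|dl| <= 2 * cA * `|h|.
    apply: le_trans (lipPsi _ _ Oy Oh) _; rewrite [y + _]addrC addrK normrZ.
    by rewrite mulrA ler_piMr// mulr_ge0// ltW.
  (* Since [Psi] is a section, [Phi] moves by exactly [h *: v] when its argument moves by [dl]; the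
     first-order expansion at [x] bounds the rest. *)
  have H1 : `|h *: v - dl *m J| <= d' * `|dl|.
    apply: norm_le_coord => [|l]; first by rewrite mulr_ge0// ltW.
    have := Hs dl; rewrite -ball_normE /= sub0r normrN => /(_ (le_lt_trans dlh hs) l).
    rewrite /dl subrK PsiK// /x PsiK// -/x -/dl.
    rewrite [y + _]addrC mxE addrK.
    have -> // : (h *: v - dl *m J) 0 l = (h *: v) 0 l - lform (fun i => partial i (fun x => Phi x 0 l) x) dl.
    have -> : lform (fun i => partial i (fun x => Phi x 0 l) x) dl = (dl *m J) 0 l.
      by rewrite mxE; apply: eq_bigr => q _; rewrite [J q l]mxE.
    by rewrite mxE [X in _ + X]mxE.
  have -> : Psi (y + h *: v) 0 k - x 0 k - h * invmx J i k =
      (- ((h *: v - dl *m J) *m invmx J)) 0 k.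
    rewrite mulmxBl -mulmxA mulmxV// mulmx1 -scalemxAl opprB !mxE.
    congr (_ - h * _); rewrite (bigD1 i)//= mxE !eqxx mul1r big1 ?addr0// => q qi.
    by rewrite mxE (negPf qi) andbF mul0r.
  apply: le_trans (coord_le_norm _ _) _; rewrite normrN.
  apply: le_trans (Hc _) _; apply: le_trans (ler_wpM2l (ltW c0) H1) _.
  apply: le_trans (ler_wpM2l (ltW c0) (ler_wpM2l (ltW d'0) dlh)) _.
  rewrite le_eqVlt; apply/orP; left; apply/eqP; rewrite /d'; field.
  by rewrite !gt_eqF.
have contPsi y k : O' y -> {for y, continuous (fun y => Psi y 0 k)}.
  move=> Oy; apply: continuous_estimate => d d0.
  have N2 : nbhs y O' by exact: open_nbhs_nbhs.
  have N3 : \forall z \near y, 2 * cA * `|z - y| <= d.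
    have L0 : 0 < 2 * cA by rewrite mulr_gt0.
    apply/nbhs_ballP; exists (d / (2 * cA)) => /=; first exact: divr_gt0.
    by move=> h; rewrite -ball_normE /= distrC ltr_pdivlMr// mulrC => /ltW.
  apply: filterS2 N2 N3 => z Oz zd; rewrite distrC; apply: le_trans zd.
  apply: le_trans (lipPsi _ _ Oy Oz).
  by apply: le_trans (coord_le_norm _ k); rewrite !mxE.
have sinv i k : smooth_on O (fun x => invmx (jac Phi x) i k).
  apply: smooth_on_invmx => // [a b|x [xr _]]; last exact: uJx (ltW xr).
  under eq_fun do rewrite mxE.
  apply: smooth_on_subset (smooth_on_partial a (sPhi b)) => x [xr _].
  by have [] := Hr _ (ltW xr).
(* Bootstrap: the partial derivatives of [Psi] are entries of [invmx (jac Phi)] composed with [Psi],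
   so each class of regularity of [Psi] yields the next one. *)
have sPsi : smooth_map O' Psi.
  move=> k n; elim: n k => [|n IH] k; first by split=> // y Oy; exact: contPsi.
  split=> [y Oy|i]; first exact: contPsi.
  split=> [y Oy|]; first by case: (dPsi y i k Oy).
  have H : Ck_on n O' ((fun x => invmx (jac Phi x) i k) \o Psi).
    by apply: (Ck_on_comp oO oO') => //; exact: sinv.
  apply: (eq_Ck_on oO' _ H) => y Oy.
  by have [_ E] := dPsi y i k Oy; rewrite /partial E.
exists O, O', Psi; split=> //.
- split=> //.
    split; first by rewrite subrr normr0.
    by rewrite /O' /= subrr normr0 divr_gt0.
  by move=> x [xr _]; have [] := Hr _ (ltW xr).
- by split=> // x [].
- move=> y Oy; split; first by have [xr _] := PsiO _ Oy; exact: uJx (ltW xr).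
  by move=> i k; have [_ E] := dPsi y i k Oy; rewrite /partial E.
Unshelve. all: by end_near. Qed.

End InverseFunction.

(** * Smooth bump functions *)

Section Bump.
Variable R : realType.

(* t^-j exp(-1/t) for t > 0; this family is closed under differentiation up to
   linear combinations *)
Definition flat (j : nat) (t : R) : R :=
  if 0 < t then t^-1 ^+ j * expR (- t^-1) else 0.

Lemma flat_le0 j t : t <= 0 -> flat j t = 0.
Proof. by move=> t0; rewrite /flat ltNge t0. Qed.

Lemma flat_gt0 j t : 0 < t -> 0 < flat j t.
Proof. by move=> t0; rewrite /flat t0 mulr_gt0 ?expR_gt0// exprn_gt0// invr_gt0. Qed.

Lemma flat_ge0 j t : 0 <= flat j t.
Proof. by have [/flat_le0->//|/(flat_gt0 j)/ltW] := leP t 0. Qed.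

(** [expR s >= (s / n) ^+ n] with [s = t^-1] and [n = j + 2]. A quadratic bound is what gives
    [flat j] the derivative 0 at the origin. *)
Lemma flat_bound j : exists c, 0 < c /\ forall t, `|flat j t| <= c * t ^+ 2.
Proof.
pose n := j.+2.
have n0 : (0 : R) < n%:R by rewrite ltr0n.
exists (n%:R ^+ n); split=> [|t]; first exact: exprn_gt0.
have c0 : 0 <= (n%:R : R) ^+ n by rewrite exprn_ge0.
rewrite ger0_norm ?flat_ge0//.
have [t0|t0] := leP t 0; first by rewrite flat_le0// mulr_ge0// sqr_ge0.
rewrite /flat t0; set s := t^-1.
have s0 : 0 < s by rewrite invr_gt0.
have E : (s / n%:R) ^+ n <= expR s.
  have -> : expR s = expR (s / n%:R) ^+ n.
    by rewrite -expRM_natr divfK// gt_eqF.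
  apply: lerXn2r; rewrite ?nnegrE ?expR_ge0 ?divr_ge0 ?(ltW s0)//.
  apply: le_trans (expR_ge1Dx _); by rewrite lerDr.
rewrite expRN -(ler_pM2r (expR_gt0 s)) mulfVK ?gt_eqF ?expR_gt0//.
have tE : t = s^-1 by rewrite invrK.
apply: le_trans (_ : n%:R ^+ n * t ^+ 2 * (s / n%:R) ^+ n <= _); last first.
  by apply: ler_wpM2l => //; rewrite mulr_ge0// sqr_ge0.
rewrite le_eqVlt; apply/orP; left; apply/eqP.
have ts : t * s = 1 by rewrite divff// gt_eqF.
transitivity (t ^+ 2 * (n%:R * (s / n%:R)) ^+ n); last by rewrite exprMn; ring.
rewrite [n%:R * _]mulrC divfK ?gt_eqF// /n !exprS expr0.
transitivity ((t * s) * (t * s) * s ^+ j); last by ring.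
by rewrite ts !mul1r.
Qed.

Lemma is_derive_flat (j : nat) (t : R) :
  is_derive t (1 : R) (flat j) (- j%:R * flat j.+1 t + flat j.+2 t).
Proof.
have [t0|t0|->] := ltgtP t 0.
- rewrite !flat_le0 ?(ltW t0)// mulr0 addr0.
  apply: (@near_eq_is_derive R R R (cst 0) (flat j) t 1 0).
  have : nbhs t [set x | x < 0] by apply: open_nbhs_nbhs; split => //; exact: open_lt.
  by apply: filterS => x /= x0; rewrite flat_le0// ltW.
- pose E (s : R) := s ^+ j * expR (- s).
  pose inv (x : R) := x^-1.
  apply: (@near_eq_is_derive R R R (E \o inv)).
    have : nbhs t [set x | 0 < x] by apply: open_nbhs_nbhs; split => //; exact: open_gt.
    by apply: filterS => x /= x0; rewrite /flat x0.
  have dinv : is_derive t 1 inv (- t ^- 2).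
    apply: DeriveDef; first by apply: derivableV; rewrite ?gt_eqF//; exact: derivable_id.
    by rewrite /inv deriveV ?gt_eqF// derive_id [_%:A]mulr1.
  have dexp (s : R) : is_derive s (1 : R) (fun x : R => expR (- x)) (- expR (- s)).
    rewrite -mulrN1; exact: (@is_derive1_comp R expR -%R s (expR (- s)) (- 1) (is_derive_expR _)
      (is_deriveNid s 1)).
  have dX (s : R) : is_derive s (1 : R) (fun x : R => x ^+ j) (j%:R * s ^+ j.-1).
    apply: DeriveDef; first exact: exprn_derivable.
    by rewrite exp_derive [LHS]mulr1.
  have dE (s : R) : is_derive s (1 : R) E (j%:R * s ^+ j.-1 * expR (- s) - s ^+ j * expR (- s)).
    have := @is_deriveM _ _ (fun x : R => x ^+ j) (fun x : R => expR (- x)) s 1 _ _ (dX s) (dexp s).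
    move=> [H1 H2]; apply: (DeriveDef H1); rewrite [LHS]H2 /GRing.scale/=; ring.
  have := @is_derive1_comp _ E inv t _ _ (dE _) dinv.
  move=> [H1 H2]; apply: (DeriveDef H1); rewrite [LHS]H2 /flat t0 /inv.
  clear H1 H2 dE dX E dinv dexp; case: j => [|j] /=; rewrite -exprVn ?exprS; ring.
- rewrite !flat_le0// mulr0 addr0.
  apply: is_derive_estimate => e e0.
  have [c [c0 Hc]] := flat_bound j.
  have : \forall h \near (0 : R), `|h| < e / c.
    by apply: nbhs0_lt; rewrite divr_gt0.
  apply: filterS => h he.
  rewrite add0r mulr0 subr0 (@flat_le0 j 0)// subr0 [h *: _]mulr1.
  apply: le_trans (Hc h) _; rewrite -normr_id -(@real_normK _ h) ?num_real// normr_id.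
  rewrite expr2 mulrA ler_wpM2r//; move: he.
  by rewrite ltr_pdivlMr// mulrC => /ltW.
Qed.

Lemma derive_line (V W : normedModType R) (f : V -> W) x v :
  'D_(1 : R) (fun h : R => f (h *: v + x)) 0 = 'D_v f x.
Proof.
rewrite /derive; have -> // : (fun h : R => h^-1 *:
    (((fun h : R => f (h *: v + x)) \o shift 0) (h *: (1 : R)) - f (0 *: v + x))) =
  (fun h => h^-1 *: ((f \o shift x) (h *: v) - f x)).
by apply/funext => h /=; rewrite addr0 scale0r add0r [h%:A]mulr1.
Qed.

Lemma smooth_flat m (g : 'rV[R]_m -> R) j : smooth_on setT g ->
  smooth_on setT (fun x => flat j (g x)).
Proof.
move=> sg k; have oT : open (@setT 'rV[R]_m) by exact: openT.
have cf t : {for t, continuous (flat j)}.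
  by apply/differentiable_continuous/derivable1_diffP; case: (is_derive_flat j t).
elim: k j cf => [|k IH] j cf.
  by split=> // x _; apply: continuous_comp (cf _); exact: smooth_on_cont sg I.
split=> [x _|i].
  by apply: continuous_comp (cf _); exact: smooth_on_cont sg I.
have D x : is_derive x (delta_mx 0 i) (fun x => flat j (g x))
    ((- j%:R * flat j.+1 (g x) + flat j.+2 (g x)) * partial i g x).
  have dg : derivable g x (delta_mx 0 i) by exact: (@smooth_on_derivable _ _ setT g i x sg I).
  pose v : 'rV[R]_m := delta_mx 0 i.
  have dg1 : is_derive (0 : R) 1 (fun h : R => g (h *: v + x)) (partial i g x).
    by apply: DeriveDef; [exact: (derivable1P _ _ _).1|exact: derive_line].
  have df : is_derive (g (0 *: v + x)) 1 (flat j) (- j%:R * flat j.+1 (g x) + flat j.+2 (g x)).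
    by rewrite scale0r add0r; exact: is_derive_flat.
  have H := @is_derive1_comp _ (flat j) (fun h : R => g (h *: v + x)) 0 _ _ df dg1.
  apply: DeriveDef; first by apply: (derivable1P _ _ _).2; case: H.
  by case: H => _ <-; rewrite -derive_line.
split=> [x _|]; first by case: (D x).
have cF j' t : {for t, continuous (flat j')}.
  by apply/differentiable_continuous/derivable1_diffP; case: (is_derive_flat j' t).
have H : Ck_on k setT (fun x => (- j%:R * flat j.+1 (g x) + flat j.+2 (g x)) * partial i g x).
  apply: Ck_on_mul => //; last exact: smooth_on_partial.
  by apply: Ck_on_add => //; [apply: Ck_on_mul => //; [exact: Ck_on_cst|exact: IH]|exact: IH].
apply: (eq_Ck_on oT _ H) => x _.
by rewrite /partial; case: (D x) => _ ->.
Qed.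

(** The quotient of [flat 0 u] by [flat 0 u + flat 0 (1 - u)], which is 1 for [u >= 1] and 0 for
    [u <= 0]. The denominator is positive because [u] and [1 - u] are never both nonpositive. *)
Lemma bump_exists m (x0 : 'rV[R]_m) r : 0 < r ->
  exists (chi : 'rV[R]_m -> R) (r1 : R), [/\ smooth_on setT chi, 0 < r1,
    forall x, `|x - x0| < r1 -> chi x = 1 & forall x, r <= `|x - x0| -> chi x = 0].
Proof.
move=> r0; have oT : open (@setT 'rV[R]_m) by exact: openT.
pose S (x : 'rV[R]_m) := \sum_i (x 0 i - x0 0 i) * (x 0 i - x0 0 i).
have sS : smooth_on setT S.
  apply: smooth_on_sum => // i _.
  have sc : smooth_on setT (fun x : 'rV[R]_m => x 0 i - x0 0 i).
    by apply: smooth_on_add => //; [exact: smooth_on_coord|exact: smooth_on_cst].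
  exact: smooth_on_mul.
(* The sup norm is not smooth, so the squared Euclidean distance [S] is used instead; [S >= r ^+ 2]
   outside the sup-norm ball, whence [u <= 0] there. *)
pose u x := 2 + (- 2 / r ^+ 2) * S x.
have su : smooth_on setT u.
  apply: smooth_on_add => //; first exact: smooth_on_cst.
  by apply: smooth_on_mul => //; exact: smooth_on_cst.
have su' : smooth_on setT (fun x => 1 + -1 * u x).
  apply: smooth_on_add => //; first exact: smooth_on_cst.
  by apply: smooth_on_mul => //; exact: smooth_on_cst.
pose den x := flat 0 (u x) + flat 0 (1 + -1 * u x).
have den0 x : 0 < den x.
  rewrite /den; have [ux|ux] := ltP 0 (u x).
    by apply: ltr_wpDr; [exact: flat_ge0|exact: flat_gt0].
  apply: ltr_wpDl; first exact: flat_ge0.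
  by apply: flat_gt0; lra.
have r20 : 0 < r ^+ 2 by rewrite exprn_gt0.
(* On the ball of this radius [S <= m * r1 ^+ 2 <= r ^+ 2 / 2], that is [u >= 1]. *)
pose r1 := r / (2 * (m%:R + 1)).
have m1 : 0 < (m%:R : R) + 1 by rewrite ltr_wpDl.
exists (fun x => flat 0 (u x) * (den x)^-1), r1; split.
- apply: smooth_on_mul => //; first exact: smooth_flat.
  apply: smooth_on_inv => //; first by move=> x _; rewrite gt_eqF.
  by apply: smooth_on_add => //; exact: smooth_flat.
- by rewrite divr_gt0// mulr_gt0.
- move=> x xr.
  have Sx : S x <= m%:R * r1 ^+ 2.
    apply: le_trans (_ : \sum_(i < m) r1 ^+ 2 <= _); last first.
      by rewrite sumr_const card_ord mulr_natl.
    apply: ler_sum => i _; rewrite -expr2 -real_normK ?num_real//.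
    apply: lerXn2r; rewrite ?nnegrE//; first by rewrite divr_ge0// ?mulr_ge0 ?ltW.
    by apply: le_trans (ltW xr); apply: le_trans (coord_le_norm _ i); rewrite !mxE.
  have ux : 1 <= u x.
    rewrite /u; have : 2 / r ^+ 2 * S x <= 1; last by lra.
    rewrite mulrAC ler_pdivrMr// mul1r.
    apply: le_trans (_ : 2 * (m%:R * r1 ^+ 2) <= _); first exact: ler_wpM2l.
    rewrite /r1 expr_div_n mulrA mulrA ler_pdivrMr ?exprn_gt0 ?mulr_gt0//.
    rewrite mulrC ler_wpM2l ?(ltW r20)// exprMn.
    have : (0 : R) <= m%:R by [].
    by move: (m%:R : R) => y y0; nra.
  by rewrite /den (@flat_le0 0 (1 + _)) ?addr0 ?divff// ?gt_eqF ?flat_gt0//; lra.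
- move=> x xr; rewrite flat_le0 ?mul0r//.
  have Sx : r ^+ 2 <= S x.
    have [i Hi] : exists i, r <= `|(x - x0) 0 i|.
      apply: contrapT => H; have : `|x - x0| < r; last by rewrite ltNge xr.
      pose t := \big[Num.max/0]_i `|(x - x0) 0 i|.
      apply: le_lt_trans (_ : t < r).
        apply: norm_le_coord => [|j]; last exact: le_bigmax.
        by rewrite /t bigmax_idl le_max lexx.
      apply/bigmax_ltP; split=> // i _; rewrite ltNge; apply/negP => ri.
      by apply: H; exists i.
    rewrite /S (bigD1 i)//= -expr2; apply: le_trans (_ : (x 0 i - x0 0 i) ^+ 2 <= _).
      rewrite -[leRHS]real_normK ?num_real//; apply: lerXn2r; rewrite ?nnegrE// ?(ltW r0)//.
      by move: Hi; rewrite !mxE.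
    by rewrite lerDl sumr_ge0// => j _; rewrite -expr2 sqr_ge0.
  rewrite /u; have : 2 <= 2 / r ^+ 2 * S x; last by lra.
  by rewrite mulrAC ler_pdivlMr// ler_wpM2l.
Qed.

End Bump.

(** * Simultaneous rectification of commuting fields *)

Section Rectification.
Variable R : realType.

Lemma sum_delta n (F : 'I_n -> R) i : \sum_j F j * (j == i)%:R = F i.
Proof.
rewrite (bigD1 i)//= eqxx mulr1 big1 ?addr0// => j /negPf ->.
by rewrite mulr0.
Qed.

Lemma smooth_on_setU m (U V : set 'rV[R]_m) f :
  smooth_on U f -> smooth_on V f -> smooth_on (U `|` V) f.
Proof.
move=> sU sV; apply: smooth_on_local => x [Ux|Vx]; first by exists U.
by exists V.
Qed.

Lemma open_norm_lt m (x0 : 'rV[R]_m) r : open [set x : 'rV[R]_m | `|x - x0| < r].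
Proof.
rewrite (_ : mkset _ = ball x0 r); first exact: ball_open.
by rewrite -ball_normE; apply/seteqP; split=> x /=; rewrite distrC.
Qed.

Lemma open_norm_gt m (x0 : 'rV[R]_m) r : open [set x : 'rV[R]_m | r < `|x - x0|].
Proof.
have cN : continuous (fun x : 'rV[R]_m => `|x - x0|).
  move=> x; apply: (@cvg_norm _ _ _ (nbhs x) _ (fun x => x - x0)).
  by apply: cvgB; [exact: cvg_id|exact: cvg_cst].
exact: open_comp (fun x _ => cN x) (@open_gt _ r).
Qed.

(** [W] and the exterior of the closed ball cover the space, and on the exterior the product is 0
    whatever values [f] takes there. *)
Lemma smooth_cutoff m (W : set 'rV[R]_m) (f chi : 'rV[R]_m -> R) x0 r :
  open W -> smooth_on W f -> smooth_on setT chi ->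
  (forall x, `|x - x0| <= r -> W x) -> (forall x, r <= `|x - x0| -> chi x = 0) ->
  smooth_on setT (fun x => chi x * f x).
Proof.
move=> oW sf sc rW c0.
have sW : smooth_on W (fun x => chi x * f x).
  by apply: smooth_on_mul => //; apply: smooth_on_subset sc.
have sV : smooth_on [set x | r < `|x - x0|] (fun x => chi x * f x).
  apply: (@eq_smooth_on R m _ (fun=> 0)); first exact: open_norm_gt.
    by move=> x /= rx; rewrite c0 ?mul0r// ltW.
  exact: smooth_on_cst.
apply: smooth_on_subset (smooth_on_setU sW sV) => x _.
by have [/rW xW|xr] := leP `|x - x0| r; [left|right].
Qed.

Lemma bounded_cutoff m (F : 'rV[R]_m -> R) x0 r : smooth_on setT F ->
  (forall x, r <= `|x - x0| -> F x = 0) ->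
  exists C, 0 <= C /\ forall x, True -> `|F x| <= C.
Proof.
move=> sF F0.
have [x _|C [C0 HC]] := @bounded_on_ball R m F x0 r.
  exact: (@smooth_on_cont _ _ setT F x sF I).
exists C; split=> // x _.
have [xr|/ltW rx] := leP `|x - x0| r; first exact: HC.
by rewrite F0// normr0.
Qed.

Lemma row_free_complement n d (A : 'M[R]_(n, n + d)) : row_free A ->
  exists B : 'M[R]_(d, n + d), col_mx A B \in unitmx.
Proof.
move=> fA; have rA : \rank (A^C)%MS = d.
  by rewrite mxrank_compl (eqP fA) addKn.
have [B HB] : exists B : 'M[R]_(d, n + d), (B :=: A^C)%MS.
  by move: (row_base (A^C)%MS) (eq_row_base (A^C)%MS); rewrite rA => B HB; exists B.
exists B; rewrite -row_full_unit -col_leq_rank.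
have := addsmx_compl_full A; rewrite -col_leq_rank.
by rewrite -(adds_eqmx (eqmx_refl A) HB) (addsmxE A B).
Qed.

(** Vanishing of the Lie brackets, in components. *)
Definition commuting m n (W : set 'rV[R]_m) (X : 'I_n -> 'rV[R]_m -> 'rV[R]_m) :=
  forall x, W x -> forall i q l,
    \sum_r X i x 0 r * partial r (fun x => X q x 0 l) x =
    \sum_r X q x 0 r * partial r (fun x => X i x 0 l) x.

(** [Phi (s, t)] is the time-one flow of [sum_i s_i X_i] from the point [x0 + t *m B] of an affine
    slice transverse to the fields at [x0]. *)
Lemma slice_flow n d (X : 'I_n -> 'rV[R]_(n + d) -> 'rV[R]_(n + d))
    (W : set 'rV[R]_(n + d)) x0 :
  open W -> W x0 -> (forall i, smooth_map W (X i)) -> commuting W X ->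
  row_free (\matrix_(i, j) X i x0 0 j) ->
  exists (U : set 'rV[R]_(n + d)) (Phi : 'rV[R]_(n + d) -> 'rV[R]_(n + d)) u0,
    [/\ open U, U u0 & smooth_map U Phi] /\
    [/\ Phi u0 = x0, forall u, U u -> W (Phi u), jac Phi u0 \in unitmx &
      forall u, U u -> forall i l,
        partial (lshift d i) (fun u => Phi u 0 l) u = X i (Phi u) 0 l].
Proof.
move=> oW Wx0 sX cX fX.
have oT k : open (@setT 'rV[R]_k) by exact: openT.
have [r /= r0 rW] : exists2 r, 0 < r & forall x, `|x - x0| <= r -> W x.
  have : nbhs x0 W by exact: open_nbhs_nbhs.
  move=> /nbhs_ballP[s /= s0 Hs]; exists (s / 2); first by rewrite divr_gt0.
  move=> x xs; apply: Hs; rewrite -ball_normE /= distrC; apply: le_lt_trans xs _.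
  by rewrite ltr_pdivrMr// ltr_pMr// ltr1n.
(* The fields are cut off around [x0], to be bounded and defined on the whole space as the flow
   requires. *)
have [chi [r1 [sc r10 c1 c0]]] := bump_exists x0 r0.
pose Z i x := chi x *: X i x.
have ZE i l : (fun x => Z i x 0 l) = (fun x => chi x * X i x 0 l).
  by apply/funext => x; rewrite mxE.
have sZ i : smooth_map setT (Z i).
  by move=> l; rewrite ZE; exact: smooth_cutoff (sX i l) sc rW c0.
have [C [C0 HC]] : exists C, 0 <= C /\ forall i x, `|Z i x| <= C.
  have [C [C0 HC]] := @finite_bound R ('I_n * 'I_(n + d))%type _ (fun _ => True)
    (fun il x => `|Z il.1 x 0 il.2|)
    (fun il => @bounded_cutoff _ _ x0 r (sZ il.1 il.2)
      (fun x xr => etrans (mxE _ _ _ _) (etrans (congr1 (fun c => c * _) (c0 x xr)) (mul0r _)))).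
  exists C; split=> // i x; apply: norm_le_coord => // l.
  exact: (HC (i, l)).
pose rho := r1 / 2.
have rho0 : 0 < rho by rewrite divr_gt0.
have rhor1 : rho < r1 by rewrite ltr_pdivrMr// ltr_pMr// ltr1n.
have Z1 i x : `|x - x0| < r1 -> Z i x = X i x by move=> xr; rewrite /Z c1// scale1r.
have rhoW x : `|x - x0| <= rho -> `|x - x0| < r1 /\ W x.
  move=> xr; have xr1 := le_lt_trans xr rhor1; split=> //; apply: rW.
  rewrite leNgt; apply/negP => /ltW/c0; rewrite c1// => /eqP.
  by rewrite oner_eq0.
(* The cutoff may destroy commutation, but not where [chi] is 1; [rho] is taken inside that
   region. *)
have cZ x : `|x - x0| <= rho -> forall i q l,
    \sum_r Z i x 0 r * partial r (fun x => Z q x 0 l) x =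
    \sum_r Z q x 0 r * partial r (fun x => Z i x 0 l) x.
  move=> /rhoW[xr Wx] i q l; rewrite !Z1//.
  have pE a b : partial a (fun x => Z b x 0 l) x = partial a (fun x => X b x 0 l) x.
    apply: (@eq_partial R _ [set x | `|x - x0| < r1]) => //; first exact: open_norm_lt.
    by move=> y yr; rewrite Z1.
  under eq_bigr do rewrite pE.
  under [RHS]eq_bigr do rewrite pE.
  exact: cX.
pose A : 'M[R]_(n, n + d) := \matrix_(i, j) X i x0 0 j.
have [B uB] := @row_free_complement n d A fX.
(* With coefficients bounded by [delta] the flow displaces points by at most [rho / 2]; the [+ 1]
   covers the case where [n%:R * C] is 0. *)
pose delta := rho / (2 * (n%:R * C + 1)).
have nC0 : 0 < n%:R * C + 1 by rewrite ltr_wpDl// mulr_ge0.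
have d0 : 0 < delta by rewrite divr_gt0// mulr_gt0.
have drho : n%:R * (delta * C) <= rho / 2.
  rewrite mulrCA /delta mulrAC ler_pdivrMr ?mulr_gt0// [leRHS]mulrA divfK//.
  by rewrite ler_wpM2l ?(ltW rho0)// lerDl.
have [cB [cB0 HB]] := mulmx_bound B.
pose t := Num.min delta (rho / 2 / cB).
have t0 : 0 < t by rewrite lt_min d0 !divr_gt0.
(* Initial data: the first [n] coordinates become the coefficients, the others place the starting
   point on the slice. *)
pose sl (u : 'rV[R]_(n + d)) : 'rV[R]_(n + (n + d)) := row_mx (lsubmx u) (x0 + rsubmx u *m B).
have ssl : smooth_map setT sl.
  apply: smooth_row_mx; first exact: smooth_lsubmx.
  apply: smooth_map_add => //; first exact: smooth_map_cst.
  move=> l; under eq_fun do rewrite mxE.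
  apply: smooth_on_sum => // i _; apply: smooth_on_mul => //; last exact: smooth_on_cst.
  exact: smooth_rsubmx.
pose E := multi_flow Z.
have sE : smooth_map setT E by exact: smooth_multi_flow HC C0.
pose U : set 'rV[R]_(n + d) := [set u | `|u - 0| < t].
have U0 : U 0 by rewrite /U /= subrr normr0.
have Ul u : U u -> `|lsubmx (sl u)| <= delta.
  rewrite /U /= subr0 row_mxKl => ut; apply: le_trans (norm_lsubmx_le _) _.
  by move/ltW: ut; rewrite le_min => /andP[].
have Ur u : U u -> `|rsubmx (sl u) - x0| <= rho / 2.
  rewrite /U /= subr0 row_mxKr [x0 + _]addrC addrK => ut.
  apply: le_trans (HB _) _; rewrite mulrC -ler_pdivlMr//.
  apply: le_trans (norm_rsubmx_le _) _.
  by move/ltW: ut; rewrite le_min => /andP[].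
have Erho u : U u -> `|E (sl u) - x0| <= rho.
  move=> Uu; rewrite -(subrK (rsubmx (sl u)) (E _)) -addrA (splitr rho).
  apply: le_trans (ler_normD _ _) _; apply: lerD; last exact: Ur.
  apply: le_trans (multi_flow_dist sZ HC C0 _) _; apply: le_trans drho.
  rewrite ler_wpM2l// ler_wpM2r//; exact: Ul.
have dsl u j i : derivable (fun u => sl u 0 j) u (delta_mx 0 i).
  exact: (@smooth_on_derivable _ _ setT _ _ u (ssl j) I).
have chain u i l : partial i (fun u => E (sl u) 0 l) u =
    \sum_j partial j (fun y => E y 0 l) (sl u) * partial i (fun u => sl u 0 j) u.
  exact: (@partial_comp R _ _ setT (fun y => E y 0 l) sl u i (oT _) I (sE l 1%N) (fun j => dsl u j i)).
have sl_l u j i : partial i (fun u => sl u 0 (lshift _ j)) u = (lshift d j == i)%:R.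
  rewrite (_ : (fun u => _) = (fun u : 'rV[R]_(n + d) => u 0 (lshift d j))) ?partial_coord//.
  by apply/funext => z; rewrite row_mxEl mxE.
have sl_r u j i : partial i (fun u => sl u 0 (rshift _ j)) u =
    \sum_k (rshift n k == i)%:R * B k j.
  rewrite (_ : (fun u => _) = (fun u : 'rV[R]_(n + d) => x0 0 j + \sum_k (B k j) * u 0 (rshift n k))); last first.
    apply/funext => z; rewrite row_mxEr !mxE; congr (_ + _); apply: eq_bigr => k _.
    by rewrite mulrC mxE.
  have dk k : derivable (fun u : 'rV[R]_(n + d) => B k j * u 0 (rshift n k)) u (delta_mx 0 i).
    apply: (@smooth_on_derivable _ _ setT _ _ u _ I); apply: smooth_on_mul => //.
      exact: smooth_on_cst.
    exact: smooth_on_coord.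
  have [dS ES] := partial_sum dk.
  have dC : derivable (fun=> x0 0 j) u (delta_mx 0 i) by exact: derivable_cst.
  rewrite (partialD dC dS) ES [partial i (fun=> _) u]derive_cst add0r.
  apply: eq_bigr => k _.
  have [dck _] := is_derive_coord u (delta_mx 0 i) (rshift n k).
  by rewrite (partialZ _ dck) partial_coord mulrC.
have PL u i l : U u -> partial (lshift d i) (fun u => E (sl u) 0 l) u = X i (E (sl u)) 0 l.
  move=> Uu; rewrite chain big_split_ord /= [X in _ + X]big1 ?addr0; last first.
    move=> j _; rewrite sl_r big1 ?mulr0// => k _.
    by rewrite eq_rlshift mul0r.
  under eq_bigr do rewrite sl_l (inj_eq (@lshift_inj _ _)).
  rewrite sum_delta.
  rewrite [LHS](partial_multi_flow sZ HC C0 cZ i l (ltW d0) drho (Ul _ Uu) (Ur _ Uu)).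
  by rewrite Z1//; have [] := rhoW _ (Erho _ Uu).
have sl0 : sl 0 = row_mx 0 x0.
  by rewrite /sl !linear0 mul0mx addr0.
have E0 : E (sl 0) = x0.
  by rewrite sl0 /E (multi_flow0 sZ HC C0) ?row_mxKl ?row_mxKr.
exists U, (E \o sl), 0; split; first split => //.
- exact: open_norm_lt.
- move=> j; apply: (@smooth_on_subset _ _ setT) => //.
  exact: smooth_map_comp (oT _) (oT _) (fun _ _ => I) ssl sE j.
split=> //.
- by move=> u Uu; have [] := rhoW _ (Erho _ Uu).
(* At the origin the first [n] rows are the fields at [x0] and the others span the slice; [B] was
   chosen to make this matrix invertible. *)
- suff -> : jac (E \o sl) 0 = col_mx A B by [].
  apply/matrixP => i l; rewrite mxE.
  case: (fintype.splitP i) => i' ii'.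
    have -> : i = lshift d i' by exact: val_inj.
    by rewrite PL// E0 col_mxEu mxE.
  have -> : i = rshift n i' by exact: val_inj.
  rewrite chain big_split_ord /= [X in X + _]big1 ?add0r; last first.
    by move=> j _; rewrite sl_l eq_lrshift mulr0.
  (* With zero coefficients the flow is the identity, so this derivative is computed on a line along
     which [E] returns the starting point. *)
  have PE j : partial (rshift n j) (fun y => E y 0 l) (sl 0) = (l == j)%:R.
    rewrite -(partial_coord x0 j l) /partial.
    rewrite -(derive_line (fun y : 'rV[R]_(n + (n + d)) => E y 0 l)).
    rewrite -(derive_line (fun x : 'rV[R]_(n + d) => x 0 l) x0).
    have -> // : (fun h : R => E (h *: delta_mx 0 (rshift n j) + sl 0) 0 l) =
      (fun h : R => (h *: delta_mx 0 j + x0) 0 l).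
    apply/funext => h; congr (fun_of_matrix _ 0 l).
    have -> : h *: delta_mx 0 (rshift n j) + sl 0 = row_mx 0 (h *: delta_mx 0 j + x0).
      rewrite sl0; apply/rowP => k; rewrite !mxE; case: (fintype.splitP k) => k' kk'.
        have -> : k = lshift _ k' by exact: val_inj.
        by rewrite eq_lrshift andbF mulr0 !mxE add0r.
      have -> : k = rshift _ k' by exact: val_inj.
      by rewrite (inj_eq (@rshift_inj _ _)) !mxE.
    by rewrite /E (multi_flow0 sZ HC C0) ?row_mxKl ?row_mxKr.
  under eq_bigr do rewrite PE.
  rewrite (bigD1 l)//= eqxx mul1r big1 ?addr0; last first.
    by move=> j /negPf jl; rewrite eq_sym jl mul0r.
  rewrite sl_r col_mxEd (bigD1 i')//= eqxx mul1r big1 ?addr0//.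
  by move=> j /negPf jl; rewrite (inj_eq (@rshift_inj _ _)) jl mul0r.
- by move=> u Uu i l; exact: PL.
Qed.

(** [psi] is the slice flow and [phi] its local inverse. The inequality [n <= m] comes from the rank
    and is returned because [widen_ord] depends on it. *)
Theorem rectification m n (W : set 'rV[R]_m) (X : 'I_n -> 'rV[R]_m -> 'rV[R]_m) x0 :
  open W -> W x0 -> (forall i, smooth_map W (X i)) -> commuting W X ->
  row_free (\matrix_(i, j) X i x0 0 j) ->
  exists (hnm : (n <= m)%N) (O O' : set 'rV[R]_m) (phi psi : 'rV[R]_m -> 'rV[R]_m),
    [/\ [/\ open O, open O', O x0 & O `<=` W],
        [/\ forall x, O x -> O' (phi x), forall y, O' y -> O (psi y),
            forall x, O x -> psi (phi x) = x & forall y, O' y -> phi (psi y) = y],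
        smooth_map O phi, smooth_map O' psi &
        forall y, O' y -> forall i l,
          partial (widen_ord hnm i) (fun y => psi y 0 l) y = X i (psi y) 0 l].
Proof.
move=> oW Wx0 sX cX fX.
have hnm : (n <= m)%N by rewrite -(eqP fX) rank_leq_col.
have [d md] : exists d, m = (n + d)%N by exists (m - n)%N; rewrite subnKC.
subst m; exists hnm.
have [U [Phi [u0 [[oU Uu0 sPhi] [Pu0 PW uJ PX]]]]] := slice_flow oW Wx0 sX cX fX.
have [V [V' [Psi [[oV oV' Vu0 VU] [h1 h2 h3 h4] _ sPsi]]]] := inverse_function oU Uu0 sPhi uJ.
exists V', V, Psi, Phi; split=> //.
- split=> //; first by rewrite -Pu0; exact: h1.
  by move=> y Vy; rewrite -(h4 _ Vy); apply/PW/VU/h2.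
- by move=> j; apply: smooth_on_subset (sPhi j).
- move=> y Vy i l; have -> : widen_ord hnm i = lshift d i by exact: val_inj.
  exact: PX (VU _ Vy) i l.
Qed.

End Rectification.

(** * Decomposable forms *)

Section Slots.
Variables (n : nat) (T : Type).
Implicit Types w : 'I_n -> T.

Lemma dfwith_id w i : dfwith w i (w i) = w.
Proof. by apply/funext => j; case: dfwithP. Qed.

Lemma dfwith_dfwith w i x y : dfwith (dfwith w i x) i y = dfwith w i y.
Proof.
apply/funext => j; have [->|ij] := eqVneq j i; first by rewrite !dfwithin.
by rewrite !dfwithout// eq_sym.
Qed.

Lemma dfwithC w i j x y : i != j ->
  dfwith (dfwith w i x) j y = dfwith (dfwith w j y) i x.
Proof.
move=> ij; apply/funext => k; have [->|ki] := eqVneq k i.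
  by rewrite dfwithin dfwithout ?dfwithin// eq_sym.
have [->|kj] := eqVneq k j; first by rewrite dfwithin dfwithout ?dfwithin.
by rewrite !dfwithout// eq_sym.
Qed.

(** Arguments are freed one slot at a time, by induction on the number of free slots. The step
    hypothesis is where linearity in one slot enters; [Q] itself may be any property, such as the
    vanishing of a form or the smoothness of a bracket. *)
Lemma slots_ind (G S : T -> Prop) (Q : ('I_n -> T) -> Prop) :
  (forall x, G x -> S x) ->
  (forall w, (forall i, G (w i)) -> Q w) ->
  (forall w i x, (forall j, S (w j)) -> S x ->
     (forall y, G y -> Q (dfwith w i y)) -> Q (dfwith w i x)) ->
  forall w, (forall i, S (w i)) -> Q w.
Proof.
move=> GS base step.
have H k w : (forall i : 'I_n, (i < k)%N -> S (w i)) ->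
    (forall i : 'I_n, (k <= i)%N -> G (w i)) -> Q w.
  elim: k w => [|k IH] w HS HG; first by apply: base => i; exact: HG.
  have [kn|nk] := ltnP k n; last first.
    apply: IH => i ik; first by apply: HS; exact: ltnW.
    by have := leq_trans nk ik; rewrite leqNgt ltn_ord.
  pose i0 := Ordinal kn.
  rewrite -(dfwith_id w i0); apply: step.
  - move=> j; have [jk|kj] := ltnP j k.+1; first exact: HS.
    by apply: GS; exact: HG.
  - exact: HS.
  move=> y Gy; apply: IH => i ik.
    rewrite dfwithout; first by apply: HS; exact: ltnW.
    by apply: contraTneq ik => <-; rewrite -leqNgt.
  have [->|ii0] := eqVneq i i0; first by rewrite dfwithin.
  rewrite dfwithout 1?eq_sym//; apply: HG; rewrite ltn_neqAle ik andbT.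
  by apply: contraNneq ii0 => ki; apply/eqP/val_inj.
move=> w Sw; apply: (H n) => // i.
by rewrite leqNgt ltn_ord.
Qed.

End Slots.

Section Alternating.
Variables (R : realType) (V : lmodType R) (n : nat).
Implicit Types (A B : ('I_n -> V) -> R) (w : 'I_n -> V).

Lemma alt_lin A w i a x y : alternating A ->
  A (dfwith w i (a *: x + y)) = a * A (dfwith w i x) + A (dfwith w i y).
Proof. by case=> + _; exact. Qed.

Lemma alt_eq A w i j : alternating A -> i != j -> w i = w j -> A w = 0.
Proof. by case=> _; exact. Qed.

Lemma altD A w i x y : alternating A ->
  A (dfwith w i (x + y)) = A (dfwith w i x) + A (dfwith w i y).
Proof. by move=> hA; rewrite -[x]scale1r alt_lin// mul1r scale1r. Qed.

Lemma alt0 A w i : alternating A -> A (dfwith w i 0) = 0.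
Proof.
move=> hA; have := altD w i 0 0 hA; rewrite addr0 => /eqP.
by rewrite -subr_eq0 opprD addNKr oppr_eq0 => /eqP.
Qed.

Lemma altZ A w i a x : alternating A -> A (dfwith w i (a *: x)) = a * A (dfwith w i x).
Proof. by move=> hA; rewrite -[a *: x]addr0 alt_lin// alt0// addr0. Qed.

Lemma alt_sum A w i (I : Type) (r : seq I) (P : pred I) (c : I -> R) (x : I -> V) :
  alternating A ->
  A (dfwith w i (\sum_(j <- r | P j) c j *: x j)) =
  \sum_(j <- r | P j) c j * A (dfwith w i (x j)).
Proof.
move=> hA; elim: r => [|j r IH]; first by rewrite !big_nil alt0.
by rewrite !big_cons; case: ifP => // _; rewrite alt_lin// IH.
Qed.

Lemma alt_swap A w i j x y : alternating A -> i != j ->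
  A (dfwith (dfwith w i x) j y) = - A (dfwith (dfwith w i y) j x).
Proof.
move=> hA ij; apply/eqP; rewrite -addr_eq0; apply/eqP.
have : A (dfwith (dfwith w i (x + y)) j (x + y)) = 0.
  apply: (alt_eq hA ij); rewrite dfwithin dfwithout ?dfwithin// eq_sym//.
rewrite (altD _ _ _ _ hA) !(dfwithC _ _ _ ij) !(altD _ _ _ _ hA) -!(dfwithC _ _ _ ij).
have Z z : A (dfwith (dfwith w i z) j z) = 0.
  by apply: (alt_eq hA ij); rewrite dfwithin dfwithout ?dfwithin// eq_sym.
by rewrite !Z add0r addr0 addrC.
Qed.

Lemma alt_tperm A w i j : alternating A -> i != j -> A (w \o tperm i j) = - A w.
Proof.
move=> hA ij.
have -> : w \o tperm i j = dfwith (dfwith w i (w j)) j (w i).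
  apply/funext => k /=; case: tpermP => [->|->|/eqP ki /eqP kj].
  - by rewrite dfwithout ?dfwithin// eq_sym.
  - by rewrite dfwithin.
  - by rewrite !dfwithout// eq_sym.
by rewrite alt_swap// dfwith_id dfwith_id.
Qed.

(** Only vanishing is transported along a product of transpositions, so the sign of [s] does not
    appear. *)
Lemma alt_perm0 A w (s : {perm 'I_n}) : alternating A -> A w = 0 -> A (w \o s) = 0.
Proof.
move=> hA; have [ts -> _] := prod_tpermP s.
elim: ts w => [|t ts IH] w Aw.
  rewrite big_nil (_ : w \o _ = w)//; apply/funext => k /=.
  by rewrite perm1.
rewrite big_cons.
have -> : w \o (tperm t.1 t.2 * \prod_(t <- ts) tperm t.1 t.2)%g =
    (w \o (\prod_(t <- ts) tperm t.1 t.2)%g) \o tperm t.1 t.2.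
  by apply/funext => k /=; rewrite permM.
have [tt|tt] := eqVneq t.1 t.2; last by rewrite alt_tperm// IH// oppr0.
rewrite tt tperm1 (_ : _ \o _ = w \o (\prod_(t <- ts) tperm t.1 t.2)%g) ?IH//.
by apply/funext => k /=; rewrite perm1.
Qed.

Lemma alternating_sub A B : alternating A -> alternating B ->
  alternating (fun w => A w - B w).
Proof.
move=> hA hB; split=> [w i a x y|w i j ij wij].
  by rewrite !alt_lin//; ring.
by rewrite (alt_eq hA ij wij) (alt_eq hB ij wij) subrr.
Qed.

Lemma alternating_det (X : 'I_n -> V -> R) :
  (forall b a x y, X b (a *: x + y) = a * X b x + X b y) ->
  alternating (fun w => \det (\matrix_(a, b) X b (w a))).
Proof.
move=> lX; split=> [w i a x y|w i j ij wij].
  rewrite -[\det (\matrix_(_, _) X _ (dfwith w i y _))]mul1r.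
  apply: (determinant_multilinear (i0 := i)).
  - apply/rowP => b; rewrite !mxE !dfwithin lX mul1r//.
  - apply/matrixP => p b; rewrite !mxE !dfwithout//; exact: neq_lift.
  - apply/matrixP => p b; rewrite !mxE !dfwithout//; exact: neq_lift.
by apply: (determinant_alternate ij) => b; rewrite !mxE wij.
Qed.

End Alternating.

(** * Quadratic relations imply decomposability *)

Section Decomposable.
Variables (R : realType) (V : lmodType R) (n : nat).
Variable L : ('I_n -> V) -> R.
Hypothesis hL : alternating L.
(** A relation of Pluecker type in which [u p] occurs twice: the first factor keeps it in slot [p],
    the second receives it in slot [i]. The repetition reflects the square of a function from which
    the relation is obtained. *)
Hypothesis star : forall (u g : 'I_n -> V) (p q : 'I_n), p != q ->
  \sum_i L (dfwith u q (g i)) * L (dfwith g i (u p)) = 0.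

(* polarization of [star] *)
Lemma pluecker_shared (u g : 'I_n -> V) (p q j : 'I_n) b : p != q -> g j = u p ->
  L (dfwith u q b) * L g = \sum_i L (dfwith u q (g i)) * L (dfwith g i b).
Proof.
move=> pq; set al := u p => gj.
have uE x : dfwith u q x = dfwith (dfwith u p al) q x by rewrite /al dfwith_id.
(* The two occurrences of [u p] are made independent. As [S x x = 0], bilinearity gives
   [S al b = - S b al]. *)
pose S x y := \sum_i L (dfwith (dfwith u p x) q (g i)) * L (dfwith g i y).
have S0 x : S x x = 0.
  have := star (dfwith u p x) g pq; rewrite dfwithin => <-; exact: eq_bigr.
have Sab : S al b + S b al = 0.
  have E : S (al + b) (al + b) = (S al al + S al b) + (S b al + S b b).
    rewrite /S -!big_split/=; apply: eq_bigr => i _.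
    by rewrite (dfwithC _ (al + b) _ pq) !(altD _ _ _ _ hL) -!(dfwithC _ _ _ pq); ring.
  by move: E; rewrite !S0 add0r addr0.
(* Only [i = j] survives: in every other term the second factor contains [al] twice. *)
have Sba : S b al = - (L (dfwith u q b) * L g).
  rewrite /S (bigD1 j)//= big1 ?addr0 => [|i ij].
    by rewrite {1}gj (alt_swap _ _ _ hL pq) -uE -gj dfwith_id mulNr.
  rewrite [X in _ * X](alt_eq hL ij) ?mulr0//.
  by rewrite dfwithin dfwithout.
move/eqP: Sab; rewrite Sba subr_eq0 => /eqP <-.
by rewrite /S; apply: eq_bigr => i _; rewrite -uE.
Qed.

Hypothesis n2 : (2 < n)%N.
Variable e : 'I_n -> V.
Hypothesis Le : L e = 1.

(** The coordinate forms dual to [e]. Their common kernel [K] is a complement of the span of [e],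
    and [pure] vectors are those adapted to this splitting. *)
Let X b v := L (dfwith e b v).

Let XE b a : X b (e a) = (a == b)%:R.
Proof.
have [->|ab] := eqVneq a b; first by rewrite /X dfwith_id Le.
by rewrite /X (alt_eq hL ab)// dfwithin dfwithout// eq_sym.
Qed.

Let K v := forall b, X b v = 0.
Let pure v := (exists a, v = e a) \/ K v.

Let lX b a x y : X b (a *: x + y) = a * X b x + X b y.
Proof. exact: alt_lin. Qed.

(** As one entry lies in [K], some [e l] is missing from [w]. The polarized relation with [u = e],
    shared vector [e a] and [b = e l] expresses [L w] as a sum with factors [X l (w i)], all of
    which vanish. *)
Let mixed (w : 'I_n -> V) i0 j0 a : (forall i, pure (w i)) -> K (w i0) -> w j0 = e a ->
  L w = 0.
Proof.
move=> pw Ki0 wj0.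
have [l Hl] : exists l, forall i, w i <> e l.
  apply: contrapT => nH.
  have /choice[f Hf] : forall l, exists i, w i = e l.
    by move=> l; apply: contrapT => nl; apply: nH; exists l => i wi; apply: nl; exists i.
  have finj : injective f.
    move=> l l' ll'; have := XE l l'; rewrite -Hf -ll' Hf XE eqxx.
    by case: eqVneq => [->//|_] /eqP; rewrite oner_eq0.
  have [g fK gK] := injF_bij finj.
  have wi0 : w i0 = e (g i0) by rewrite -{1}(gK i0) Hf.
  have := Ki0 (g i0); rewrite wi0 XE eqxx => /eqP.
  by rewrite oner_eq0.
have al : a != l by apply/eqP => al; apply: (Hl j0); rewrite wj0 al.
have := @pluecker_shared e w a l j0 (e l) al wj0.
rewrite dfwith_id Le mul1r => ->; apply: big1 => i _.
have [[b wi]|Kwi] := pw i; last by rewrite -/(X l (w i)) Kwi mul0r.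
rewrite -/(X l (w i)) wi XE; case: eqVneq => [bl|_]; last by rewrite mul0r.
by case: (Hl i); rewrite wi bl.
Qed.

(** No vector of [e] occurs in [w], so the relation is applied with the shared vector
    [al = e o + w o]. Expansion leaves [L w] on the left. On the right, the term with both slots [o]
    and [q] of [e] replaced still contains [e r], so [mixed] applies to it; the third slot [r]
    exists because [n > 2]. *)
Let allK (w : 'I_n -> V) : (forall i, K (w i)) -> L w = 0.
Proof.
move=> Kw; have n0 : (0 < n)%N by exact: ltn_trans n2.
have n1 : (1 < n)%N by exact: ltn_trans n2.
pose o := Ordinal n0; pose q := Ordinal n1; pose r := Ordinal n2.
pose al := e o + w o.
pose u := dfwith e o al; pose g := dfwith w o al.
have oq : o != q by [].
have gu : g o = u o by rewrite /g /u !dfwithin.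
have := pluecker_shared (e q) oq gu.
have pe a : pure (e a) by left; exists a.
have pk i : pure (w i) by right; exact: Kw.
have pdf (f : 'I_n -> V) j x : (forall i, pure (f i)) -> pure x -> forall i, pure (dfwith f j x i).
  move=> pf px i; have [->|ij] := eqVneq i j; first by rewrite dfwithin.
  by rewrite dfwithout// eq_sym.
have -> : L (dfwith u q (e q)) = 1.
  rewrite /u (dfwithC _ _ _ oq) dfwith_id /al (altD _ _ _ _ hL).
  by rewrite dfwith_id Le [X in 1 + X]Kw addr0.
have -> : L g = L w.
  rewrite /g /al (altD _ _ _ _ hL) dfwith_id.
  rewrite (@mixed (dfwith w o (e o)) q o o) ?add0r ?dfwithin//.
    exact: pdf.
  by rewrite dfwithout.
rewrite mul1r => ->; apply: big1 => i _.
have [->|io] := eqVneq i o.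
  rewrite gu (alt_eq hL oq) ?mul0r// dfwithin dfwithout 1?eq_sym//.
have -> : g i = w i by rewrite /g dfwithout// eq_sym.
rewrite /u (dfwithC _ _ _ oq) /al (altD _ _ _ _ hL) -!(dfwithC _ _ _ oq) dfwith_id.
rewrite -/(X q (w i)) Kw add0r.
have -> : L (dfwith (dfwith e o (w o)) q (w i)) = 0; last by rewrite mul0r.
apply: (@mixed _ q r r).
- apply: (pdf (dfwith e o (w o)) q (w i) _ (pk i)); exact: (pdf e o (w o) pe (pk o)).
- by rewrite dfwithin.
- by rewrite !dfwithout.
Qed.

(** The difference of the two sides is alternating, and modulo [K] every vector is a combination of
    the [e b], so pure tuples suffice. An entry in [K] makes the left side vanish by [mixed] or
    [allK], and gives the determinant a zero row. A tuple of vectors of [e] has a repetition or is a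
    permutation of [e]. *)
Theorem decomposable w : L w = \det (\matrix_(a, b) L (dfwith e b (w a))).
Proof.
have hD := @alternating_det R V n X lX.
have hR := alternating_sub hL hD.
apply/eqP; rewrite -subr_eq0; apply/eqP.
pose Q w := L w - \det (\matrix_(a, b) X b (w a)) = 0.
have n0 : (0 < n)%N by exact: ltn_trans n2.
have XK x : K (x - \sum_b X b x *: e b).
  move=> l; rewrite -[- _]scaleN1r addrC lX mulN1r.
  have -> : X l (\sum_b X b x *: e b) = X l x.
    rewrite /X alt_sum// (bigD1 l)//= -/(X l (e l)) XE eqxx mulr1 big1 ?addr0//.
    by move=> b bl; rewrite -/(X l (e b)) XE (negPf bl) mulr0.
  by rewrite addNr.
apply: (@slots_ind n V pure (fun=> True) Q) => // {w} [w pw|w i x _ _ H]; last first.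
  pose D v := L v - \det (\matrix_(a, b) X b (v a)).
  have E : D (dfwith w i x) = D (dfwith w i (x - \sum_b X b x *: e b)) +
      \sum_b X b x * D (dfwith w i (e b)).
    rewrite -{1}(subrK (\sum_b X b x *: e b) x).
    by rewrite [LHS](altD _ _ _ _ hR) [X in _ + X](alt_sum _ _ _ _ _ _ hR).
  rewrite /Q -/(D _) E [X in X + _](H _ (or_intror (XK x))) add0r big1// => b _.
  by rewrite [X in _ * X](H (e b)) ?mulr0//; left; exists b.
rewrite /Q; have [[i0 Ki0]|nK] := pselect (exists i0, K (w i0)).
  have -> : \det (\matrix_(a, b) X b (w a)) = 0.
    rewrite (expand_det_row _ i0) big1// => b _.
    by rewrite mxE Ki0 mul0r.
  rewrite subr0; have [[j0 [a wj0]]|ne] := pselect (exists j0 a, w j0 = e a).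
    exact: mixed Ki0 wj0.
  apply: allK => i; have [[a wi]|//] := pw i.
  by case: ne; exists i, a.
have /choice[s Hs] : forall i, exists a, w i = e a.
  move=> i; have [//|Kwi] := pw i.
  by case: nK; exists i.
have [si|ns] := pselect (injective s).
  have -> : w = e \o perm si by apply/funext => i; rewrite Hs /= permE.
  apply: (alt_perm0 (perm si) hR); rewrite Le.
  have -> : \matrix_(a, b) X b (e a) = 1%:M.
    by apply/matrixP => a b; rewrite !mxE XE.
  by rewrite det1 subrr.
have [i [j [ij sij]]] : exists i j, i != j /\ s i = s j.
  apply: contrapT => H; apply: ns => i j sij; apply/eqP; apply: contrapT => /negP ij.
  by apply: H; exists i, j.
by apply: (alt_eq hR ij); rewrite !Hs sij.
Qed.

End Decomposable.

(** * Calculus on manifolds *)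

Section Manifolds.
Variables (R : realType) (m : nat) (M : manifold R m).
Implicit Types (c : chart R m M) (f g : M -> R) (p q : M).

Lemma open_chart_preimage c (U : set M) : open U ->
  open (cod c `&` cinv c @^-1` U).
Proof.
move=> oU; rewrite openE => x [cx Ux]; rewrite /interior/=.
have N1 : nbhs x (cod c) by apply: open_nbhs_nbhs; split=> //; exact: cod_open.
have N2 : nbhs x (cinv c @^-1` U).
  by apply: (cinv_continuous cx); apply: open_nbhs_nbhs.
exact: filterI N1 N2.
Qed.

Lemma open_chart_image c (W : set 'rV[R]_m) : open W ->
  open (cdom c `&` cmap c @^-1` W).
Proof.
move=> oW; rewrite openE => x [cx Wx]; rewrite /interior/=.
have N1 : nbhs x (cdom c) by apply: open_nbhs_nbhs; split=> //; exact: cdom_open.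
have N2 : nbhs x (cmap c @^-1` W).
  by apply: (cmap_continuous cx); apply: open_nbhs_nbhs.
exact: filterI N1 N2.
Qed.

Lemma partial_change c c' (A : set 'rV[R]_m) f q j :
  smooth_transition c c' -> open A -> A `<=` cod c' -> smooth_on A (f \o cinv c') ->
  cdom c q -> cdom c' q -> A (cmap c' q) ->
  partial j (f \o cinv c) (cmap c q) =
  \sum_i partial i (f \o cinv c') (cmap c' q) *
     partial j (coord c' i \o cinv c) (cmap c q).
Proof.
move=> tr oA Ac sf cq c'q Aq.
pose V := cod c `&` cinv c @^-1` (cdom c' `&` cmap c' @^-1` A).
have oV : open V := @open_chart_preimage c _ (@open_chart_image c' _ oA).
have Vq : V (cmap c q) by split; [exact: cmap_cod|rewrite /= cmapK].
pose T x := cmap c' (cinv c x).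
have E : partial j (f \o cinv c) (cmap c q) = partial j ((f \o cinv c') \o T) (cmap c q).
  by apply: (eq_partial j oV) => // x [cx [dx _]]; rewrite /T /= cmapK.
have TA : A (T (cmap c q)) by rewrite /T cmapK.
have dT i : derivable (fun x => T x 0 i) (cmap c q) (delta_mx 0 j).
  apply: (smooth_on_derivable (tr i)); split; first exact: cmap_cod.
  by rewrite /= cmapK.
rewrite E (partial_comp oA TA (sf 1%N) dT); apply: eq_bigr => i _.
by rewrite /T cmapK.
Qed.

(** [df = sum_i (df/dx_i) dx_i] in a chart [c] that may differ from the chart [chart_at q]
    representing the cotangent space. Smoothness on a part [A] of the chart is enough, so [f] may be
    a local coordinate. *)
Lemma differentialE c (A : set 'rV[R]_m) f q :
  smooth_transition (chart_at q) c -> open A -> A `<=` cod c ->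
  smooth_on A (f \o cinv c) -> cdom c q -> A (cmap c q) ->
  differential f q = \sum_i partial i (f \o cinv c) (cmap c q) *: differential (coord c i) q.
Proof.
move=> tr oA Ac sf cq Aq; apply/matrixP => j k; rewrite !mxE summxE.
rewrite (partial_change j tr oA Ac sf (chart_at_dom q) cq Aq).
by apply: eq_bigr => i _; rewrite !mxE.
Qed.

Lemma smooth_transition_refl c : smooth_transition c c.
Proof.
have oV := @open_chart_preimage c _ (@cdom_open _ _ _ c).
move=> j; apply: (eq_smooth_on oV _ (@smooth_on_coord _ _ _ j)) => x [cx _].
by rewrite cinvK.
Qed.

Lemma smooth_on_coord_cinv c i : smooth_on (cod c) (coord c i \o cinv c).
Proof.
apply: (eq_smooth_on (@cod_open _ _ _ c) _ (@smooth_on_coord _ _ _ i)) => x cx.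
by rewrite /coord /= cinvK.
Qed.

Lemma partial_coord_cinv c i j x : cod c x ->
  partial j (coord c i \o cinv c) x = (i == j)%:R.
Proof.
move=> cx; rewrite -(partial_coord x j i); apply: (eq_partial j (@cod_open _ _ _ c)) => // y cy.
by rewrite /coord /= cinvK.
Qed.

Lemma differential_coord_chart_at q i :
  differential (coord (chart_at q) i) q = delta_mx i 0 :> 'cV[R]_m.
Proof.
apply/matrixP => j k; rewrite !mxE partial_coord_cinv; last exact/cmap_cod/chart_at_dom.
by rewrite (ord1 k) eqxx andbT eq_sym.
Qed.

Lemma eq_differential (U : set M) f g q : open U -> U q ->
  (forall x, U x -> f x = g x) -> differential f q = differential g q.
Proof.
move=> oU Uq fg; apply/matrixP => j k; rewrite !mxE.
have oV := @open_chart_preimage (chart_at q) _ oU.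
apply: (eq_partial j oV) => [x [cx Ux]|]; first exact: fg.
split; first exact/cmap_cod/chart_at_dom.
by rewrite /= cmapK//; exact: chart_at_dom.
Qed.

Lemma smooth_chart_derivable f q j : smooth f ->
  derivable (f \o cinv (chart_at q)) (cmap (chart_at q) q) (delta_mx 0 j).
Proof.
move=> sf; apply: (smooth_on_derivable (sf _ (chart_at_atlas q))).
exact/cmap_cod/chart_at_dom.
Qed.

Lemma differentialD f g q : smooth f -> smooth g ->
  differential (fun x => f x + g x) q = differential f q + differential g q.
Proof.
move=> sf sg; apply/matrixP => j k; rewrite !mxE.
exact: partialD (@smooth_chart_derivable f q j sf) (@smooth_chart_derivable g q j sg).
Qed.

Lemma differentialZ a f q : smooth f ->
  differential (fun x => a * f x) q = a *: differential f q.
Proof.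
move=> sf; apply/matrixP => j k; rewrite !mxE.
exact: partialZ (@smooth_chart_derivable f q j sf).
Qed.

Lemma differentialM f g q : smooth f -> smooth g ->
  differential (fun x => f x * g x) q = f q *: differential g q + g q *: differential f q.
Proof.
move=> sf sg; apply/matrixP => j k; rewrite !mxE.
have := partialM (@smooth_chart_derivable f q j sf) (@smooth_chart_derivable g q j sg).
by rewrite /= cmapK//; exact: chart_at_dom.
Qed.

Lemma differential_cst (a : R) q : differential ((fun=> a) : M -> R) q = 0 :> 'cV[R]_m.
Proof.
apply/matrixP => j k; rewrite !mxE /partial.
rewrite (_ : _ \o _ = cst a); first exact: derive_cst.
by apply/funext.
Qed.

Lemma smooth_cst (a : R) : smooth ((fun=> a) : M -> R).
Proof. by move=> c _; exact: smooth_on_cst. Qed.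

Lemma smoothD f g : smooth f -> smooth g -> smooth (fun x => f x + g x).
Proof. by move=> sf sg c ac; exact: (smooth_on_add (@cod_open _ _ _ c) (sf c ac) (sg c ac)). Qed.

Lemma smoothM f g : smooth f -> smooth g -> smooth (fun x => f x * g x).
Proof. by move=> sf sg c ac; exact: (smooth_on_mul (@cod_open _ _ _ c) (sf c ac) (sg c ac)). Qed.

Lemma smoothZ a f : smooth f -> smooth (fun x => a * f x).
Proof. by move=> sf; apply: smoothM => //; exact: smooth_cst. Qed.

Lemma smooth_sum (I : Type) (r : seq I) (P : pred I) (F : I -> M -> R) :
  (forall i, P i -> smooth (F i)) -> smooth (fun x => \sum_(i <- r | P i) F i x).
Proof.
move=> sF c ac; apply: (@smooth_on_sum _ _ _ _ r P (fun i => F i \o cinv c)).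
  exact: cod_open.
by move=> i Pi; exact: sF.
Qed.

Lemma smooth_prod (I : Type) (r : seq I) (P : pred I) (F : I -> M -> R) :
  (forall i, P i -> smooth (F i)) -> smooth (fun x => \prod_(i <- r | P i) F i x).
Proof.
move=> sF c ac; apply: (@smooth_on_prod _ _ _ _ r P (fun i => F i \o cinv c)).
  exact: cod_open.
by move=> i Pi; exact: sF.
Qed.

Lemma differential_sum (I : Type) (r : seq I) (P : pred I) (F : I -> M -> R) q :
  (forall i, P i -> smooth (F i)) ->
  differential (fun x => \sum_(i <- r | P i) F i x) q =
  \sum_(i <- r | P i) differential (F i) q :> 'cV[R]_m.
Proof.
move=> sF; elim: r => [|i r IH].
  have -> : (fun x => \sum_(i <- [::] | P i) F i x) = fun=> 0.
    by apply/funext => x; rewrite big_nil.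
  by rewrite big_nil differential_cst.
rewrite big_cons; have [Pi|nPi] := ifPn.
  have -> : (fun x => \sum_(j <- i :: r | P j) F j x) =
      fun x => F i x + \sum_(j <- r | P j) F j x.
    by apply/funext => x; rewrite big_cons Pi.
  by rewrite -IH differentialD//; [exact: sF|exact: smooth_sum].
have -> : (fun x => \sum_(j <- i :: r | P j) F j x) = fun x => \sum_(j <- r | P j) F j x.
  by apply/funext => x; rewrite big_cons (negPf nPi).
exact: IH.
Qed.

Lemma smooth_continuous f p : smooth f -> {for p, continuous f}.
Proof.
move=> sf; set c := chart_at p; have cp : cdom c p := chart_at_dom p.
have oc := @cdom_open _ _ _ c.
have C : {for p, continuous ((f \o cinv c) \o cmap c)}.
  apply: continuous_comp; first exact: cmap_continuous.
  by apply: (smooth_on_cont (sf c (chart_at_atlas p))); exact: cmap_cod.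
have N : {near p, (f \o cinv c) \o cmap c =1 f}.
  have : nbhs p (cdom c) by exact: open_nbhs_nbhs.
  by apply: filterS => q cq /=; rewrite cmapK.
rewrite /prop_for /continuous_at -(nbhs_singleton N).
exact: cvg_trans (near_eq_cvg N) C.
Qed.

(** Multiplication by a bump function in the chart and extension by zero. At points outside the
    chart domain the Hausdorff axiom is used: the image of the closed ball is compact, hence closed,
    and the extension is zero on its complement. *)
Lemma smooth_extension c (A : set 'rV[R]_m) f p :
  atlas c -> cdom c p -> open A -> A `<=` cod c -> A (cmap c p) ->
  smooth_on A (f \o cinv c) ->
  exists F, smooth F /\ exists U, [/\ open U, U p, U `<=` cdom c & forall q, U q -> F q = f q].
Proof.
move=> ac cp oA Ac Ap sf; set x0 := cmap c p.
have [r /= r0 rA] : exists2 r, 0 < r & forall x, `|x - x0| <= r -> A x.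
  have : nbhs x0 A by exact: open_nbhs_nbhs.
  move=> /nbhs_ballP[s /= s0 Hs]; exists (s / 2); first by rewrite divr_gt0.
  move=> x xs; apply: Hs; rewrite -ball_normE /= distrC; apply: le_lt_trans xs _.
  by rewrite ltr_pdivrMr// ltr_pMr// ltr1n.
have [chi [r1 [sc r10 c1 c0]]] := bump_exists x0 r0.
have sg := smooth_cutoff oA sf sc rA c0.
pose F q : R := if `[< cdom c q >] then chi (cmap c q) * f q else 0.
have oT : open (@setT 'rV[R]_m) by exact: openT.
exists F; split; last first.
  exists (cdom c `&` cmap c @^-1` [set x | `|x - x0| < r1]); split.
  - apply: open_chart_image; exact: open_norm_lt.
  - by split=> //=; rewrite subrr normr0.
  - by move=> q [].
  - by move=> q [cq /= qr]; rewrite /F asboolT// c1// mul1r.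
move=> c' ac'; apply: smooth_on_local => x cx.
have [dx|ndx] := pselect (cdom c (cinv c' x)).
  exists (cod c' `&` cinv c' @^-1` cdom c); split=> //.
  have oV := @open_chart_preimage c' _ (@cdom_open _ _ _ c).
  have := smooth_on_comp oT oV (fun _ _ => I) (atlas_compatible ac' ac) sg.
  apply: (eq_smooth_on oV) => y [cy dy] /=.
  by rewrite /F asboolT// cmapK.
pose B : set 'rV[R]_m := [set x | `|x - x0| <= r].
have cB : compact B.
  apply: bounded_closed_compact.
    exists (`|x0| + r); split; first exact: num_real.
    move=> N HN z /= zB; rewrite -(subrK x0 z); apply: le_trans (ler_normD _ _) _.
    by apply: le_trans (ltW HN); rewrite addrC; exact: lerD.
  rewrite (_ : B = ~` [set x : 'rV[R]_m | r < `|x - x0|]).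
    by apply: open_closedC; exact: open_norm_gt.
  by apply/seteqP; split=> z; rewrite /B /= leNgt => /negP.
have cK : closed (cinv c @` B).
  apply: compact_closed; first exact: carrier_hausdorff.
  apply: continuous_compact => //; apply: continuous_in_subspaceT => y; rewrite inE => By.
  exact/cinv_continuous/Ac/rA.
have oV := @open_chart_preimage c' _ (closed_openC cK).
exists (cod c' `&` cinv c' @^-1` (~` (cinv c @` B))); split.
  by split=> // -[y By E]; apply: ndx; rewrite -E; exact/cinv_dom/Ac/rA.
apply: (eq_smooth_on oV _ (@smooth_on_cst _ _ _ 0)) => y [cy nK] /=.
rewrite /F; case: asboolP => // dy; rewrite c0 ?mul0r// leNgt; apply/negP => /ltW yB.
by apply: nK; exists (cmap c (cinv c' y)) => //; rewrite cmapK.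
Qed.

(** Global functions realise every covector, so identities between functions yield identities for
    the form [L p]. The normalisation [F p = 0] is what the argument with squares requires. *)
Lemma covector_differential p (w : 'cV[R]_m) :
  exists F : M -> R, [/\ smooth F, F p = 0 & differential F p = w].
Proof.
set c := chart_at p; have cp : cdom c p := chart_at_dom p.
have ac : atlas c := chart_at_atlas p.
pose f q : R := \sum_i w i 0 * coord c i q.
have sf : smooth_on (cod c) (f \o cinv c).
  apply: smooth_on_sum; first exact: cod_open.
  move=> i _; apply: smooth_on_mul; first exact: cod_open.
    exact: smooth_on_cst.
  exact: smooth_on_coord_cinv.
have [F [sF [U [oU Up Uc FE]]]] := smooth_extension ac cp (@cod_open _ _ _ c) (@subset_refl _ _) (cmap_cod cp) sf.
exists (fun q => F q + - F p); split.
- by apply: smoothD => //; exact: smooth_cst.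
- exact: subrr.
rewrite differentialD//; last exact: smooth_cst.
rewrite differential_cst addr0 (eq_differential oU Up FE).
rewrite (differentialE (smooth_transition_refl c) (@cod_open _ _ _ c) (@subset_refl _ _) sf cp (cmap_cod cp)).
apply/matrixP => j k; rewrite summxE (bigD1 j)//= big1 ?addr0; last first.
  by move=> i ij; rewrite mxE differential_coord_chart_at mxE eq_sym (negPf ij) mulr0.
rewrite mxE differential_coord_chart_at mxE eqxx (ord1 k) eqxx mulr1.
have cx := cmap_cod cp.
have dk i : derivable (fun x => w i 0 * coord c i (cinv c x)) (cmap c p) (delta_mx 0 j).
  apply: derivableZ; exact: (smooth_on_derivable (smooth_on_coord_cinv c i) cx).
have [_ E] := partial_sum dk; rewrite [LHS]E (bigD1 j)//= big1 ?addr0 => [|i ij].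
  rewrite partialZ ?partial_coord_cinv// ?eqxx ?mulr1//.
  exact: (smooth_on_derivable (smooth_on_coord_cinv c j) cx).
rewrite partialZ ?partial_coord_cinv// ?(negPf ij) ?mulr0//.
exact: (smooth_on_derivable (smooth_on_coord_cinv c i) cx).
Qed.

End Manifolds.

(** * Nambu brackets *)

Section Bracket.
Variables (R : realType) (m : nat) (M : manifold R m) (n : nat).
Variable L : forall p : M, multivector n p.
Arguments L : clear implicits.
Hypothesis hL : multivector_field L.
Implicit Types (g u : 'I_n -> M -> R) (x y f : M -> R) (p q : M).

Definition diffs g p : 'I_n -> 'cV[R]_m := fun a => differential (g a) p.

Lemma alt_at p : @alternating R 'cV[R]_m n (L p).
Proof. by case: hL. Qed.

Lemma diffs_dfwith g i f p :
  diffs (dfwith g i f) p = dfwith (diffs g p) i (differential f p).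
Proof.
apply/funext => a; rewrite /diffs; have [->|ai] := eqVneq a i.
  by rewrite !dfwithin.
by rewrite !dfwithout// eq_sym.
Qed.

Lemma bracketE g p : bracket L g p = L p (diffs g p).
Proof. by []. Qed.

Lemma bracket_dfwith g i f p :
  bracket L (dfwith g i f) p = L p (dfwith (diffs g p) i (differential f p)).
Proof. by rewrite bracketE diffs_dfwith. Qed.

Lemma bracket_lin g i a x y p : smooth x -> smooth y ->
  bracket L (dfwith g i (fun q => a * x q + y q)) p =
  a * bracket L (dfwith g i x) p + bracket L (dfwith g i y) p.
Proof.
move=> sx sy; rewrite !bracket_dfwith differentialD ?differentialZ//; last exact: smoothZ.
exact: (alt_lin _ _ _ _ _ (alt_at p)).
Qed.

Lemma bracket_eq g i j p : i != j -> differential (g i) p = differential (g j) p ->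
  bracket L g p = 0.
Proof. by move=> ij gij; apply: (alt_eq (alt_at p) ij). Qed.

Lemma bracket_diff0 g i f p : differential f p = 0 :> 'cV[R]_m ->
  bracket L (dfwith g i f) p = 0.
Proof. by move=> f0; rewrite bracket_dfwith f0; exact: (alt0 _ _ (alt_at p)). Qed.

Lemma bracket_swap g i j x y p : i != j ->
  bracket L (dfwith (dfwith g i x) j y) p = - bracket L (dfwith (dfwith g i y) j x) p.
Proof.
move=> ij; rewrite !bracket_dfwith !diffs_dfwith.
exact: (alt_swap _ _ _ (alt_at p) ij).
Qed.

(** Slot by slot, a function is replaced by the coordinates through [df = sum_j (df/dx_j) dx_j];
    brackets of coordinates are smooth by definition of a multivector field. *)
Lemma bracket_smooth_on c g : atlas c -> (forall i, smooth_on (cod c) (g i \o cinv c)) ->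
  smooth_on (cod c) (bracket L g \o cinv c).
Proof.
move=> ac sg.
pose G (f : M -> R) := exists i, f = coord c i.
pose S (f : M -> R) := smooth_on (cod c) (f \o cinv c).
pose Q h := smooth_on (cod c) (bracket L h \o cinv c).
have oc := @cod_open _ _ _ c.
apply: (@slots_ind n (M -> R) G S Q).
- by move=> f [i ->]; exact: smooth_on_coord_cinv.
- move=> w /choice[I HI]; have [_ /(_ c ac I)] := hL.
  rewrite /Q (_ : w = fun a => coord c (I a))//.
  by apply/funext => a; rewrite HI.
- move=> w i f _ Sf H.
  have H' : smooth_on (cod c) (fun x : 'rV[R]_m => \sum_j partial j (f \o cinv c) x *
      (bracket L (dfwith w i (coord c j)) \o cinv c) x).
    apply: smooth_on_sum => // j _; apply: smooth_on_mul => //.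
      exact: smooth_on_partial.
    by apply: H; exists j.
  apply: (eq_smooth_on oc _ H') => x cx /=.
  have dq := cinv_dom cx; set q := cinv c x in dq *.
  have xE : x = cmap c q by rewrite /q cinvK.
  rewrite bracket_dfwith (differentialE (atlas_compatible (chart_at_atlas q) ac) oc (@subset_refl _ _) Sf dq (cmap_cod dq)).
  rewrite (alt_sum _ _ _ _ _ _ (alt_at q)) -xE.
  by apply: eq_bigr => j _; rewrite bracket_dfwith.
- exact: sg.
Qed.

Lemma bracket_smooth g : (forall i, smooth (g i)) -> smooth (bracket L g).
Proof. by move=> sg c ac; apply: bracket_smooth_on => // i; exact: sg. Qed.

End Bracket.

(** * The Jacobiator and its values on squares *)

Section Jacobiator.
Variables (R : realType) (m : nat) (M : manifold R m) (k : nat).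
Variable L : forall p : M, multivector k.+1 p.
Arguments L : clear implicits.
Hypothesis hL : multivector_field L.
Implicit Types (g u : 'I_k.+1 -> M -> R) (x y f : M -> R) (p q : M).

(* The last entry of [u] is irrelevant: it only serves to index the other k
   functions by the slots of the bracket. *)
Definition jacobiator u g p :=
  bracket L (dfwith u ord_max (bracket L g)) p -
  \sum_i bracket L (dfwith g i (bracket L (dfwith u ord_max (g i)))) p.

Lemma frcons_dfwith (T : Type) (u : 'I_k.+1 -> T) (x : T) :
  frcons (fun i : 'I_k.+1.-1 => u (lift ord_max i)) x = dfwith u ord_max x :> ('I_k.+1 -> T).
Proof.
apply/funext => i; rewrite /frcons; have [ik|ki] := ltnP i k.
  rewrite insubT/= dfwithout; first by congr u; apply/val_inj; rewrite /= /bump /= leqNgt ik.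
  by apply: contraTneq ik => <- /=; rewrite ltnn.
rewrite insubF/=; last by rewrite ltnNge ki.
have -> : i = ord_max; last by rewrite dfwithin.
by apply/val_inj/eqP; rewrite eqn_leq ki -ltnS ltn_ord.
Qed.

Lemma nambu_poissonE : nambu_poisson L <->
  (1 < k.+1)%N /\ (forall u g, (forall i, smooth (u i)) -> (forall i, smooth (g i)) ->
     forall p, jacobiator u g p = 0).
Proof.
split=> [[k1 _ H]|[k1 H]].
  split=> // u g su sg p; apply/eqP; rewrite subr_eq0; apply/eqP.
  have := H (fun i => u (lift ord_max i)) g (fun i => su _) sg p.
  rewrite frcons_dfwith => ->; apply: eq_bigr => i _.
  by rewrite frcons_dfwith.
split=> // f g sf sg p.
(* The slot [ord_max] receives a dummy value, overwritten in every bracket. *)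
pose u i := if unlift ord_max i is Some j then f j else fun=> 0.
have su i : smooth (u i) by rewrite /u; case: unlift => [j|]; [exact: sf|exact: smooth_cst].
have fE : f = fun i : 'I_k.+1.-1 => u (lift ord_max i).
  by apply/funext => i; rewrite /u liftK.
have := H u g su sg p; move/eqP; rewrite subr_eq0 => /eqP.
rewrite fE frcons_dfwith => ->; apply: eq_bigr => i _.
by rewrite frcons_dfwith.
Qed.

Lemma smooth_dfwith (N : nat) (u : 'I_N -> M -> R) i x : (forall j, smooth (u j)) -> smooth x ->
  forall j, smooth (dfwith u i x j).
Proof.
move=> su sx j; have [->|ij] := eqVneq j i; first by rewrite dfwithin.
by rewrite dfwithout// eq_sym.
Qed.

Lemma smooth_bracket_dfwith u i x : (forall j, smooth (u j)) -> smooth x ->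
  smooth (bracket L (dfwith u i x)).
Proof. by move=> su sx; apply: bracket_smooth => //; exact: smooth_dfwith. Qed.

Lemma bracket_lin_fun u i a x y : smooth x -> smooth y ->
  bracket L (dfwith u i (fun q => a * x q + y q)) =
  fun q => a * bracket L (dfwith u i x) q + bracket L (dfwith u i y) q.
Proof. by move=> sx sy; apply/funext => q; exact: bracket_lin. Qed.

Lemma jacobiator_lin_r u g i a x y p :
  (forall j, smooth (u j)) -> (forall j, smooth (g j)) -> smooth x -> smooth y ->
  jacobiator u (dfwith g i (fun q => a * x q + y q)) p =
  a * jacobiator u (dfwith g i x) p + jacobiator u (dfwith g i y) p.
Proof.
move=> su sg sx sy; rewrite /jacobiator mulrBr addrACA -opprD; congr (_ - _).
  rewrite bracket_lin_fun// bracket_lin//; exact: smooth_bracket_dfwith.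
rewrite mulr_sumr -big_split/=; apply: eq_bigr => j _.
have [->|ji] := eqVneq j i.
  rewrite !dfwithin !dfwith_dfwith bracket_lin_fun// bracket_lin//;
    exact: smooth_bracket_dfwith.
have ij : i != j by rewrite eq_sym.
by rewrite !(dfwithout _ _ ij) !(dfwithC _ _ _ ij) bracket_lin.
Qed.

Lemma jacobiator_lin_l u g i a x y p : i != ord_max ->
  (forall j, smooth (u j)) -> (forall j, smooth (g j)) -> smooth x -> smooth y ->
  jacobiator (dfwith u i (fun q => a * x q + y q)) g p =
  a * jacobiator (dfwith u i x) g p + jacobiator (dfwith u i y) g p.
Proof.
move=> im su sg sx sy; rewrite /jacobiator mulrBr addrACA -opprD; congr (_ - _).
  by rewrite !(dfwithC _ _ _ im) bracket_lin.
rewrite mulr_sumr -big_split/=; apply: eq_bigr => j _.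
rewrite !(dfwithC _ _ _ im) bracket_lin_fun// bracket_lin//;
  apply: smooth_bracket_dfwith => //; exact: smooth_dfwith.
Qed.

Lemma bracket_eq_fun g i j : i != j -> g i = g j -> bracket L g = fun=> 0.
Proof. by move=> ij gij; apply/funext => q; apply: (bracket_eq hL ij); rewrite gij. Qed.

Lemma jacobiator_eq_l u g i j p : i != j -> i != ord_max -> j != ord_max -> u i = u j ->
  jacobiator u g p = 0.
Proof.
move=> ij im jm uij.
have Z x : bracket L (dfwith u ord_max x) = fun=> 0.
  by apply: (@bracket_eq_fun _ i j ij); rewrite !dfwithout 1?eq_sym.
rewrite /jacobiator Z big1 ?subr0// => l _.
by rewrite Z; apply: bracket_diff0 => //; exact: differential_cst.
Qed.

(** Of the sum only the terms [i] and [j] survive, and a swap of these two slots turns one into the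
    negative of the other. *)
Lemma jacobiator_eq_r u g i j p : i != j -> g i = g j -> jacobiator u g p = 0.
Proof.
move=> ij gij; have ji : j != i by rewrite eq_sym.
rewrite /jacobiator (bracket_eq_fun ij gij) bracket_diff0//; last exact: differential_cst.
rewrite (bigD1 i)//= (bigD1 j)//= big1 ?addr0 => [|l /andP[li lj]]; last first.
  by apply: (bracket_eq hL ij); rewrite (dfwithout _ _ li) (dfwithout _ _ lj) gij.
pose Y := bracket L (dfwith u ord_max (g i)).
have -> : bracket L (dfwith u ord_max (g j)) = Y by rewrite -gij.
rewrite -/Y.
have E1 : dfwith g i Y = dfwith (dfwith g i Y) j (g j).
  by rewrite dfwithC// dfwith_id.
have E2 : dfwith g j Y = dfwith (dfwith g i (g j)) j Y by rewrite -gij dfwith_id.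
by rewrite E1 E2 (bracket_swap hL _ _ _ _ ij) addNr subr0.
Qed.

Lemma differential_sq x y p : smooth x -> smooth y -> x p = 0 ->
  differential (fun q => x q * y q) p = y p *: differential x p.
Proof. by move=> sx sy x0; rewrite differentialM// x0 scale0r add0r. Qed.

Lemma bracket_sq u i x p : smooth x ->
  bracket L (dfwith u i (fun q => x q * x q)) p = x p * (2 * bracket L (dfwith u i x) p).
Proof.
move=> sx; rewrite !bracket_dfwith differentialM// (altD _ _ _ _ (alt_at hL p)).
by rewrite !(altZ _ _ _ _ (alt_at hL p)); ring.
Qed.

(** The square has zero differential at [p], its bracket need not have: this is the second-order
    part of the Jacobiator. *)
Lemma differential_bracket_sq u i x p : (forall j, smooth (u j)) -> smooth x -> x p = 0 ->
  differential (bracket L (dfwith u i (fun q => x q * x q))) p =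
  (2 * bracket L (dfwith u i x) p) *: differential x p.
Proof.
move=> su sx x0; have sb := smooth_bracket_dfwith i su sx.
have -> : bracket L (dfwith u i (fun q => x q * x q)) =
    fun q => x q * (2 * bracket L (dfwith u i x) q).
  by apply/funext => q; exact: bracket_sq.
by rewrite (differential_sq sx (smoothZ 2 sb) x0).
Qed.

Lemma differential_sq0 x p : smooth x -> x p = 0 ->
  differential (fun q => x q * x q) p = 0 :> 'cV[R]_m.
Proof. by move=> sx x0; rewrite differential_sq// x0 scale0r. Qed.

(** Two terms survive, the outer bracket of [u] and the summand of index [r]. Each is twice the
    product of the brackets of [u] and of [g] with [x] inserted, so they cancel for every
    multivector field. *)
Lemma jacobiator_sq_r u g r x p :
  (forall j, smooth (u j)) -> (forall j, smooth (g j)) -> smooth x -> x p = 0 ->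
  jacobiator u (dfwith g r (fun q => x q * x q)) p = 0.
Proof.
move=> su sg sx x0; rewrite /jacobiator (bigD1 r)//= big1 ?addr0 => [|j jr]; last first.
  rewrite dfwithC 1?eq_sym//; apply: bracket_diff0 => //; exact: differential_sq0.
rewrite dfwithin dfwith_dfwith !bracket_dfwith !differential_bracket_sq//.
rewrite !(altZ _ _ _ _ (alt_at hL p)) -!bracket_dfwith; ring.
Qed.

(** The hypothesis of [decomposable], for the form at [p]. *)
Definition star_at p := forall (u g : 'I_k.+1 -> 'cV[R]_m) (a b : 'I_k.+1), a != b ->
  \sum_i L p (dfwith u b (g i)) * L p (dfwith g i (u a)) = 0.

(** The Jacobiator singles out the slot [ord_max]; a transposition of the arguments of [u] brings
    any other slot [b] there and only changes a sign. *)
Lemma star_last p :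
  (forall (u g : 'I_k.+1 -> 'cV[R]_m) (a : 'I_k.+1), a != ord_max ->
    \sum_i L p (dfwith u ord_max (g i)) * L p (dfwith g i (u a)) = 0) -> star_at p.
Proof.
move=> H u g a b ab; have hA := alt_at hL p.
have [bE|bm] := eqVneq b ord_max; first by rewrite bE in ab *; exact: H.
pose s := tperm b ord_max; pose u' := u \o s.
have sa : s a != ord_max.
  by rewrite -[ord_max](tpermL b ord_max) -/s (inj_eq perm_inj).
have ua : u' (s a) = u a by rewrite /u' /= tpermK.
have uE (x : 'cV[R]_m) : L p (dfwith u' ord_max x) = - L p (dfwith u b x).
  rewrite -(alt_tperm _ hA bm); congr (L p _); apply/funext => i.
  have [->|im] := eqVneq i ord_max; first by rewrite /= tpermR !dfwithin.
  rewrite dfwithout 1?eq_sym// /u' /= dfwithout//.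
  by rewrite -[X in X != _](tpermR b ord_max) -/s (inj_eq perm_inj) eq_sym.
have := H u' g (s a) sa; rewrite ua => E.
apply/eqP; rewrite -oppr_eq0 -sumrN; apply/eqP; rewrite -[RHS]E.
by apply: eq_bigr => i _; rewrite uE mulNr.
Qed.

(** With a square in slot [a] of [u] the outer bracket vanishes, while every inner bracket
    contributes its nonzero differential. Up to sign, the Jacobiator becomes twice the sum in
    [star_at], at functions realising the given covectors. *)
Lemma star_of_jacobiator p :
  (forall u g (a : 'I_k.+1) x, (forall j, smooth (u j)) -> (forall j, smooth (g j)) ->
     smooth x -> a != ord_max -> x p = 0 ->
     jacobiator (dfwith u a (fun q => x q * x q)) g p = 0) -> star_at p.
Proof.
move=> H; apply: star_last => u g a am.
have /choice[U HU] := fun i => @covector_differential R m M p (u i).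
have /choice[G HG] := fun i => @covector_differential R m M p (g i).
have sU i : smooth (U i) by case: (HU i).
have sG i : smooth (G i) by case: (HG i).
have [_ Ua0 _] := HU a.
have := H U G a (U a) sU sG (sU a) am Ua0; rewrite /jacobiator.
rewrite (dfwithC _ _ _ am) bracket_diff0//; last exact: differential_sq0.
rewrite sub0r => /eqP; rewrite oppr_eq0 => /eqP E.
have dU : diffs U p = u by apply/funext => i; case: (HU i).
have dG : diffs G p = g by apply/funext => i; case: (HG i).
have dGi i : differential (G i) p = g i by case: (HG i).
have dUi i : differential (U i) p = u i by case: (HU i).
have E2 : 2 * \sum_i L p (dfwith u ord_max (g i)) * L p (dfwith g i (u a)) = 0.
  rewrite -[RHS]E mulr_sumr; apply: eq_bigr => i _.
  rewrite (dfwithC _ _ _ am) bracket_dfwith differential_bracket_sq//; last exact: smooth_dfwith.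
  rewrite (altZ _ _ _ _ (alt_at hL p)) -(dfwithC _ _ _ am) dfwith_id.
  by rewrite bracket_dfwith dU dG dGi dUi mulrA.
by apply/eqP; move/eqP: E2; rewrite mulf_eq0 pnatr_eq0.
Qed.

End Jacobiator.

(** * Decomposability near a regular point *)

Section RegularPoints.
Variables (R : realType) (m : nat) (M : manifold R m) (k : nat).
Variable L : forall p : M, multivector k.+1 p.
Arguments L : clear implicits.
Hypothesis hL : multivector_field L.
Hypothesis k1 : (1 < k)%N.

Lemma regular_unit p : regular_point L p ->
  exists e : 'I_k.+1 -> 'cV[R]_m, L p e = 1.
Proof.
move=> rp; have [w Lw] : exists w, L p w <> 0.
  by apply: contrapT => H; apply: rp; apply/funext => w; apply: contrapT => Lw; apply: H; exists w.
exists (dfwith w ord0 ((L p w)^-1 *: w ord0)).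
by rewrite (altZ _ _ _ _ (alt_at hL p)) dfwith_id mulVf//; exact/eqP.
Qed.

(** [decomposable] applied to [L / L e]. Clearing denominators makes it a polynomial identity, which
    can be read for smooth functions around [p] and differentiated. *)
Lemma decomposable_at p (e : 'I_k.+1 -> 'cV[R]_m) w : star_at L p -> L p e != 0 ->
  L p e ^+ k * L p w = \det (\matrix_(a, b) L p (dfwith e b (w a))).
Proof.
move=> st le0; set l := L p e in le0 *.
pose L' (w : 'I_k.+1 -> 'cV[R]_m) := l^-1 * L p w.
have hA := alt_at hL p.
have hL' : @alternating R 'cV[R]_m k.+1 L'.
  split=> [v i a x y|v i j ij vij]; rewrite /L'.
    by rewrite (alt_lin _ _ _ _ _ hA); ring.
  by rewrite (alt_eq hA ij vij) mulr0.
have st' (u g : 'I_k.+1 -> 'cV[R]_m) (a b : 'I_k.+1) : a != b ->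
    \sum_i L' (dfwith u b (g i)) * L' (dfwith g i (u a)) = 0.
  move=> ab; have := st u g a b ab => E.
  rewrite -[RHS](mulr0 (l^-1 * l^-1)) -[in RHS]E mulr_sumr; apply: eq_bigr => i _.
  by rewrite /L'; ring.
have Le1 : L' e = 1 by rewrite /L' mulVf.
have k2 : (2 < k.+1)%N by [].
have := decomposable hL' st' k2 Le1 w.
have -> : \matrix_(a, b) L' (dfwith e b (w a)) = l^-1 *: \matrix_(a, b) L p (dfwith e b (w a)).
  by apply/matrixP => a b; rewrite !mxE.
rewrite detZ /L' => E.
have -> : L p w = l * (l^-1 * L p w) by rewrite mulVKf.
rewrite E mulrA -exprSr mulrA -exprMn divff// expr1n mul1r//.
Qed.

Lemma annihilated p (e w : 'I_k.+1 -> 'cV[R]_m) j : star_at L p -> L p e != 0 ->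
  (forall b, L p (dfwith e b (w j)) = 0) -> L p w = 0.
Proof.
move=> st le0 H; have := decomposable_at w st le0.
rewrite (expand_det_row _ j) big1 => [/eqP|b _]; last by rewrite mxE H mul0r.
by rewrite mulf_eq0 expf_eq0 (negPf le0) andbF => /eqP.
Qed.

Lemma smoothX (f : M -> R) j : smooth f -> smooth (fun q => f q ^+ j).
Proof.
move=> sf; elim: j => [|j IH]; first exact: smooth_cst.
under eq_fun do rewrite exprS.
exact: smoothM.
Qed.

(** Where the bracket [l] of [e] is nonzero, [l ^+ k] times the bracket of [g] is a determinant of
    smooth functions. Its rows [r1] and [r2] vanish at [p], so each of its terms has a double zero
    there. As the bracket of [g] vanishes at [p] too, differentiating the product isolates its
    differential. *)
Lemma differential_bracket_annihilated p (e g : 'I_k.+1 -> M -> R) (r1 r2 : 'I_k.+1) :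
  (forall q, star_at L q) -> (forall i, smooth (e i)) -> (forall i, smooth (g i)) ->
  bracket L e p != 0 -> r1 != r2 ->
  (forall b, bracket L (dfwith e b (g r1)) p = 0) ->
  (forall b, bracket L (dfwith e b (g r2)) p = 0) ->
  differential (bracket L g) p = 0 :> 'cV[R]_m.
Proof.
move=> st se sg l0 r12 A1 A2.
pose c a b := bracket L (dfwith e b (g a)).
have sc a b : smooth (c a b) by exact: smooth_bracket_dfwith.
pose T (s : 'S_k.+1) (q : M) := (-1) ^+ s * \prod_a c a (s a) q.
have sP (s : 'S_k.+1) (P : pred 'I_k.+1) : smooth (fun q => \prod_(a | P a) c a (s a) q).
  by apply: smooth_prod => a _; exact: sc.
have sT s : smooth (T s) by apply: smoothZ; exact: sP.
have dT s : differential (T s) p = 0 :> 'cV[R]_m.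
  rewrite differentialZ; last exact: sP.
  have -> : (fun q => \prod_a c a (s a) q) =
    fun q => c r1 (s r1) q * (c r2 (s r2) q * \prod_(a | (a != r1) && (a != r2)) c a (s a) q).
    by apply/funext => q; rewrite (bigD1 r1)//= (bigD1 r2)//= eq_sym.
  rewrite differentialM//; last by apply: smoothM => //; exact: sP.
  have c1 : c r1 (s r1) p = 0 by exact: A1.
  have c2 : c r2 (s r2) p = 0 by exact: A2.
  by rewrite c1 c2 mul0r !scale0r addr0 scaler0.
pose D q := \sum_(s : 'S_k.+1) T s q.
have dD : differential D p = 0 :> 'cV[R]_m.
  by rewrite differential_sum// big1// => s _; exact: dT.
pose l := bracket L e; have sl : smooth l by exact: bracket_smooth.
pose U := [set q | l q != 0].
have oU : open U.
  rewrite openE => q lq; rewrite /interior/=.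
  have N : nbhs (l q) [set t : R | t != 0].
    by apply: open_nbhs_nbhs; split=> //; exact: open_neq.
  exact: (@smooth_continuous R m M l q sl _ N).
have E q : U q -> l q ^+ k * bracket L g q = D q.
  move=> lq; rewrite !bracketE (decomposable_at _ (st q))// /D /determinant.
  apply: eq_bigr => s _; congr (_ * _); apply: eq_bigr => a _.
  by rewrite mxE /c bracket_dfwith.
have sb : smooth (bracket L g) by exact: bracket_smooth.
have := eq_differential oU l0 E; rewrite dD differentialM//; last exact: smoothX.
have -> : bracket L g p = 0.
  apply: (@annihilated p (diffs e p) (diffs g p) r1 (st p) l0) => b.
  by rewrite -[RHS](A1 b) bracket_dfwith.
rewrite scale0r addr0 => /eqP; rewrite scaler_eq0 expf_eq0 (negPf l0) andbF /=.
by move=> /eqP.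
Qed.

(** Replacing one [g i] leaves an annihilated argument in place, which kills every summand. In the
    outer bracket it is the differential of the inner bracket that vanishes, and this takes both
    annihilated arguments. *)
Lemma jacobiator_annihilated p (e u g : 'I_k.+1 -> M -> R) (r1 r2 : 'I_k.+1) :
  (forall q, star_at L q) -> (forall i, smooth (e i)) -> (forall i, smooth (g i)) ->
  bracket L e p != 0 -> r1 != r2 ->
  (forall b, bracket L (dfwith e b (g r1)) p = 0) ->
  (forall b, bracket L (dfwith e b (g r2)) p = 0) ->
  jacobiator L u g p = 0.
Proof.
move=> st se sg l0 r12 A1 A2; rewrite /jacobiator bracket_diff0//; last first.
  exact: differential_bracket_annihilated A1 A2.
rewrite big1 ?subrr// => i _; rewrite bracket_dfwith.
have [r [ri Ar]] : exists r, i != r /\ forall b, bracket L (dfwith e b (g r)) p = 0.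
  by have [->|ir] := eqVneq i r1; [exists r2|exists r1].
apply: (@annihilated p (diffs e p) _ r (st p) l0) => b.
by rewrite dfwithout// -[RHS](Ar b) bracket_dfwith.
Qed.

End RegularPoints.

(** * From equal first arguments to the vanishing of the Jacobiator *)

Section FromContractions.
Variables (R : realType) (m : nat) (M : manifold R m) (k : nat).
Variable L : forall p : M, multivector k.+1 p.
Arguments L : clear implicits.
Hypothesis hL : multivector_field L.
Hypothesis k1 : (1 < k)%N.
Hypothesis H0 : forall u g : 'I_k.+1 -> M -> R,
  (forall i, smooth (u i)) -> (forall i, smooth (g i)) -> u ord0 = g ord0 ->
  forall p, jacobiator L u g p = 0.
Implicit Types (h : 'I_(k + k.+1) -> M -> R) (x y : M -> R).

(** With [n = k + 1], the [2n - 1] arguments form a single family [h], the first [k] on the left and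
    the other [k + 1] on the right, so that exchanges between both sides can be expressed. The dummy
    slot [ord_max] of the left part is filled with 0. *)
Definition lpart h : 'I_k.+1 -> M -> R :=
  fun j => if unlift ord_max j is Some i then h (lshift k.+1 i) else fun=> 0.
Definition rpart h : 'I_k.+1 -> M -> R := fun j => h (rshift k j).
Let A h p := jacobiator L (lpart h) (rpart h) p.
Let smoothh h := forall i, smooth (h i).

Lemma lpart_l h i x : lpart (dfwith h (lshift k.+1 i) x) = dfwith (lpart h) (lift ord_max i) x.
Proof.
apply/funext => j; rewrite /lpart; have [i' ->|->] := unliftP ord_max j.
  have [->|ii'] := eqVneq i' i; first by rewrite !dfwithin.
  have ii : i != i' by rewrite eq_sym.
  rewrite !dfwithout ?(inj_eq (@lshift_inj _ _)) ?(inj_eq (@lift_inj _ _))//.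
  by rewrite liftK.
by rewrite dfwithout ?unlift_none// eq_sym neq_lift.
Qed.

Lemma lpart_r h i x : lpart (dfwith h (rshift k i) x) = lpart h.
Proof.
apply/funext => j; rewrite /lpart; case: (unlift ord_max j) => // i'.
by rewrite dfwithout// eq_rlshift.
Qed.

Lemma rpart_l h i x : rpart (dfwith h (lshift k.+1 i) x) = rpart h.
Proof. by apply/funext => j; rewrite /rpart dfwithout// eq_lrshift. Qed.

Lemma rpart_r h i x : rpart (dfwith h (rshift k i) x) = dfwith (rpart h) i x.
Proof.
apply/funext => j; rewrite /rpart; have [->|ji] := eqVneq j i; first by rewrite !dfwithin.
have ij : i != j by rewrite eq_sym.
by rewrite !dfwithout// (inj_eq (@rshift_inj _ _)).
Qed.

Lemma smooth_lpart h : smoothh h -> forall i, smooth (lpart h i).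
Proof. by move=> sh i; rewrite /lpart; case: unlift => [j|] //; exact: smooth_cst. Qed.

Lemma smooth_rpart h : smoothh h -> forall i, smooth (rpart h i).
Proof. by move=> sh i; exact: sh. Qed.

Lemma lift_max_neq (i : 'I_k) : lift ord_max i != ord_max :> 'I_k.+1.
Proof. by rewrite eq_sym neq_lift. Qed.

Let sd h i x : smoothh h -> smooth x -> smoothh (dfwith h i x).
Proof. by move=> sh sx; exact: smooth_dfwith. Qed.

Let sd2 h i j x y : smoothh h -> smooth x -> smooth y ->
  smoothh (dfwith (dfwith h i x) j y).
Proof. by move=> sh sx sy; apply: sd => //; exact: sd. Qed.

Let A_lin h i a x y p : smoothh h -> smooth x -> smooth y ->
  A (dfwith h i (fun q => a * x q + y q)) p = a * A (dfwith h i x) p + A (dfwith h i y) p.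
Proof.
move=> sh sx sy; rewrite /A; have sl := smooth_lpart sh; have sr := smooth_rpart sh.
case: (fintype.split_ordP i) => j ->.
  by rewrite !lpart_l !rpart_l jacobiator_lin_l//; exact: lift_max_neq.
by rewrite !lpart_r !rpart_r jacobiator_lin_r.
Qed.

(** Polarization for a single pair of slots. The vanishing on equal arguments is a hypothesis for
    that pair because it is known for all pairs only after [A_eq]. *)
Let A_swap h i j p : smoothh h -> i != j ->
  (forall h, smoothh h -> h i = h j -> A h p = 0) ->
  A h p = - A (dfwith (dfwith h i (h j)) j (h i)) p.
Proof.
move=> sh ij H; set x := h i; set y := h j.
have sx : smooth x by exact: sh.
have sy : smooth y by exact: sh.
pose z q := 1 * x q + y q.
have sz : smooth z by apply: smoothD => //; exact: smoothZ.
have Z v : smooth v -> A (dfwith (dfwith h i v) j v) p = 0.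
  move=> sv; apply: H; first exact: sd2.
  by rewrite dfwithin dfwithout ?dfwithin// eq_sym.
have := Z z sz; rewrite A_lin//; last exact: sd.
rewrite !(dfwithC _ _ _ ij) !A_lin//; try exact: sd.
rewrite -!(dfwithC _ _ _ ij) !Z// !mul1r add0r addr0 => /eqP.
rewrite addr_eq0 => /eqP E.
have {1}-> : h = dfwith (dfwith h i x) j y by rewrite !dfwith_id.
by rewrite E opprK.
Qed.

(** Pairs on the same side are covered by antisymmetry of the brackets. For one argument on each
    side, [H0] treats the two first slots; exchanges among the right arguments, then among the left
    ones, bring any mixed pair there. *)
Let A_eq h i j p : smoothh h -> i != j -> h i = h j -> A h p = 0.
Proof.
have LL h' (a b : 'I_k) : smoothh h' -> a != b -> h' (lshift k.+1 a) = h' (lshift k.+1 b) -> A h' p = 0.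
  move=> sh ab hab; apply: (@jacobiator_eq_l _ _ _ _ _ hL _ _ (lift ord_max a) (lift ord_max b)).
  - by rewrite (inj_eq (@lift_inj _ _)).
  - exact: lift_max_neq.
  - exact: lift_max_neq.
  - by rewrite /lpart !liftK.
have RR h' (a b : 'I_k.+1) : smoothh h' -> a != b -> h' (rshift k a) = h' (rshift k b) -> A h' p = 0.
  by move=> sh ab hab; exact: (@jacobiator_eq_r _ _ _ _ _ hL _ _ a b).
have k0 : (0 < k)%N by exact: ltn_trans k1.
pose o : 'I_k := Ordinal k0.
have oE : lift ord_max o = ord0 :> 'I_k.+1.
  by apply/val_inj; rewrite /= /bump /= leqNgt k0.
have C0 h' : smoothh h' -> h' (lshift k.+1 o) = h' (rshift k ord0) -> A h' p = 0.
  move=> sh E; apply: H0; [exact: smooth_lpart|exact: smooth_rpart|].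
  by rewrite -[in LHS]oE /lpart liftK.
have C1 h' b : smoothh h' -> h' (lshift k.+1 o) = h' (rshift k b) -> A h' p = 0.
  move=> sh E; have [b0|b0] := eqVneq b ord0; first by apply: C0; rewrite // -b0.
  have bb : rshift k b != rshift k ord0 by rewrite (inj_eq (@rshift_inj _ _)).
  rewrite (A_swap sh bb); last by move=> h'' sh'' E''; exact: RR E''.
  rewrite C0 ?oppr0//; first exact: (sd2 _ _ sh (sh _) (sh _)).
  by rewrite dfwithin !dfwithout// ?eq_rlshift.
have C2 h' a b : smoothh h' -> h' (lshift k.+1 a) = h' (rshift k b) -> A h' p = 0.
  move=> sh E; have [a0|a0] := eqVneq a o; first by apply: (C1 _ b); rewrite // -a0.
  have aa : lshift k.+1 a != lshift k.+1 o by rewrite (inj_eq (@lshift_inj _ _)).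
  rewrite (A_swap sh aa); last by move=> h'' sh'' E''; exact: LL E''.
  rewrite (C1 _ b) ?oppr0//; first exact: (sd2 _ _ sh (sh _) (sh _)).
  by rewrite dfwithin !dfwithout// ?eq_lrshift.
move=> sh; case: (fintype.split_ordP i) => a ->; case: (fintype.split_ordP j) => b -> ab E.
- by apply: (LL _ a b) => //; move: ab; rewrite (inj_eq (@lshift_inj _ _)).
- exact: C2 E.
- by apply: (C2 _ b a).
- by apply: (RR _ a b) => //; move: ab; rewrite (inj_eq (@rshift_inj _ _)).
Qed.

Lemma jacobiator_ext u v g p : (forall j : 'I_k, u (lift ord_max j) = v (lift ord_max j)) ->
  jacobiator L u g p = jacobiator L v g p.
Proof.
move=> uv; have E : dfwith u ord_max = dfwith v ord_max.
  apply/funext => y; apply/funext => i.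
  have [j ->|->] := unliftP ord_max i; last by rewrite !dfwithin.
  by rewrite !dfwithout ?uv// neq_lift.
by rewrite /jacobiator E.
Qed.

(** Exchanging the square in a left slot with a right argument puts it where [jacobiator_sq_r]
    applies. *)
Lemma star_of_contractions p : star_at L p.
Proof.
apply: star_of_jacobiator => // u g a x su sg sx am x0.
pose h i := match fintype.split i with
  inl j => dfwith u a (fun q => x q * x q) (lift ord_max j) | inr j => g j end.
have sx2 : smooth (fun q => x q * x q) by exact: smoothM.
have su' := smooth_dfwith a su sx2.
have sh : smoothh h by move=> i; rewrite /h; case: fintype.split => j.
have [a' aE] : exists a', a = lift ord_max a'.
  by have := unlift_some am; case=> a' _ _; case: (unliftP ord_max a) am => [a'' -> _|->]; [exists a''|rewrite eqxx].
have hl j : h (lshift k.+1 j) = dfwith u a (fun q => x q * x q) (lift ord_max j).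
  by rewrite /h (unsplitK (inl j)).
have hr j : h (rshift k j) = g j by rewrite /h (unsplitK (inr j)).
have rE : rpart h = g by apply/funext => j; rewrite /rpart hr.
have AE : A h p = jacobiator L (dfwith u a (fun q => x q * x q)) g p.
  by rewrite /A rE; apply: jacobiator_ext => j; rewrite /lpart liftK hl.
rewrite -AE.
have ij : lshift k.+1 a' != rshift k ord0 by rewrite eq_lrshift.
rewrite (A_swap sh ij) => [|h' sh' E]; last exact: A_eq ij E.
rewrite /A rpart_r rpart_l rE hl -aE dfwithin jacobiator_sq_r ?oppr0//.
apply: smooth_lpart => i; apply: smooth_dfwith => //.
by apply: smooth_dfwith.
Qed.

Let A_annihilated h i j p (e : 'I_k.+1 -> M -> R) :
  (forall i, smooth (e i)) -> bracket L e p != 0 -> smoothh h -> i != j ->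
  (forall b, bracket L (dfwith e b (h i)) p = 0) ->
  (forall b, bracket L (dfwith e b (h j)) p = 0) -> A h p = 0.
Proof.
move=> se l0.
pose ann x := forall b, bracket L (dfwith e b x) p = 0.
have RR h' a b : smoothh h' -> a != b -> ann (h' (rshift k a)) -> ann (h' (rshift k b)) -> A h' p = 0.
  move=> sh ab A1 A2; apply: (@jacobiator_annihilated _ _ _ _ _ hL k1 p e _ _ a b) => //.
  - exact: star_of_contractions.
  - exact: smooth_rpart.
have sw h' a b : smoothh h' -> a != b -> A h' p = - A (dfwith (dfwith h' a (h' b)) b (h' a)) p.
  by move=> sh ab; apply: A_swap => // h'' sh''; exact: A_eq.
have C1 h' a b : smoothh h' -> a != rshift k b -> ann (h' a) -> ann (h' (rshift k b)) -> A h' p = 0.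
  move=> sh; case: (fintype.split_ordP a) => a' -> ab A1 A2; last first.
    by apply: (RR _ a' b) => //; move: ab; rewrite (inj_eq (@rshift_inj _ _)).
  have [b' bb'] : exists b' : 'I_k.+1, b' != b.
    have [->|b0] := eqVneq b ord0; last by exists ord0; rewrite eq_sym.
    by exists ord_max; rewrite -val_eqE /= -lt0n; exact: ltn_trans k1.
  have lr : lshift k.+1 a' != rshift k b' by rewrite eq_lrshift.
  rewrite (sw _ _ _ sh lr) (RR _ b' b) ?oppr0//; first exact: (sd2 _ _ sh (sh _) (sh _)).
    by rewrite dfwithin.
  by rewrite !dfwithout ?eq_lrshift// (inj_eq (@rshift_inj _ _)).
move=> sh; case: (fintype.split_ordP j) => b -> ab A1 A2; last exact: C1 ab A1 A2.
case: (fintype.split_ordP i) ab A1 => a -> ab A1; last first.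
  by apply: (C1 _ _ a sh _ A2 A1); rewrite eq_sym.
have lr : lshift k.+1 b != rshift k ord0 by rewrite eq_lrshift.
rewrite (sw _ _ _ sh lr) (C1 _ (lshift k.+1 a) ord0) ?oppr0//.
- exact: (sd2 _ _ sh (sh _) (sh _)).
- by rewrite eq_lrshift.
- by rewrite !dfwithout ?eq_rlshift// 1?eq_sym.
- by rewrite dfwithin.
Qed.

Lemma jacobiator_of_contractions u g p :
  (forall i, smooth (u i)) -> (forall i, smooth (g i)) -> jacobiator L u g p = 0.
Proof.
move=> su sg.
have [rp|nrp] := pselect (regular_point L p); last first.
  (* Every term of the Jacobiator at [p] is an outer bracket, evaluated by [L p]. *)
  have L0 : L p = fun=> 0 by apply: contrapT.
  by rewrite /jacobiator /bracket L0 big1 ?subrr.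
have [e' Le'] := regular_unit hL rp.
have /choice[e He] := fun i => @covector_differential R m M p (e' i).
have se i : smooth (e i) by case: (He i).
have de : diffs e p = e' by apply/funext => i; case: (He i).
have Le : bracket L e p = 1 by rewrite bracketE de.
have l0 : bracket L e p != 0 by rewrite Le oner_eq0.
have hA := alt_at hL p.
pose ann x := forall b, bracket L (dfwith e b x) p = 0.
pose G x := smooth x /\ ((exists a, x = e a) \/ ann x).
have key : forall h, smoothh h -> A h p = 0.
  apply: (@slots_ind (k + k.+1) (M -> R) G (@smooth R m M) (fun h => A h p = 0)).
  - by move=> x [].
  - move=> h Gh; have sh : smoothh h by move=> i; case: (Gh i).
    have [[i [j [ij hij]]]|dist] := pselect (exists i j, i != j /\ h i = h j).
      exact: A_eq ij hij.
    have /choice[lab Hlab] : forall i, exists a, ann (h i) \/ h i = e a.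
      by move=> i; have [_ [[a ha]|hi]] := Gh i; [exists a; right|exists ord0; left].
    pose KS := finset (fun i : 'I_(k + k.+1) => `[< ann (h i) >]).
    (* The entries being distinct, those outside [KS] are distinct functions [e a], at most [k + 1]
       in number. Of the [k + (k + 1)] entries at least [k > 1] are therefore annihilated. *)
    have inj : {in ~: KS &, injective lab}.
      move=> i j; rewrite !inE => /asboolPn Ki /asboolPn Kj lij.
      apply/eqP; apply: contrapT => /negP ij; apply: dist; exists i, j; split=> //.
      by case: (Hlab i) => // ->; case: (Hlab j) => // ->; rewrite lij.
    have c1 : (#|~: KS| <= k.+1)%N.
      by rewrite -(card_in_imset inj) -[X in (_ <= X)%N]card_ord max_card.
    have c2 : (1 < #|KS|)%N.
      have := cardsC KS; rewrite card_ord => E.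
      apply: leq_trans k1 _; rewrite -(leq_add2r #|~: KS|) E leq_add2l//.
    have /card_gt1P[i [j [iK jK ij]]] := c2.
    have Ki : ann (h i) by move: iK; rewrite inE => /asboolP.
    have Kj : ann (h j) by move: jK; rewrite inE => /asboolP.
    exact (@A_annihilated h i j p e se l0 sh ij Ki Kj).
  move=> w i x sw sx HG.
  pose X b := bracket L (dfwith e b x) p.
  (* The coefficients are the values at [p], kept constant because the Jacobiator is linear over
     constants only; accordingly [r] is annihilated at [p], not necessarily nearby. *)
  pose r q := \sum_b (- X b) * e b q + x q.
  have sS (c : 'I_k.+1 -> R) (s : seq 'I_k.+1) : smooth (fun q => \sum_(b <- s) c b * e b q).
    by apply: smooth_sum => b _; exact: smoothZ.
  have sr : smooth r by apply: smoothD.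
  have annr : ann r.
    move=> b; rewrite bracket_dfwith de differentialD//.
    rewrite differential_sum => [|c _]; last exact: smoothZ.
    have dc c : differential (fun q => - X c * e c q) p = - X c *: e' c.
      by rewrite differentialZ// -de.
    rewrite (eq_bigr _ (fun c _ => dc c)).
    rewrite (altD _ _ _ _ hA) (alt_sum _ _ _ _ _ _ hA).
    rewrite (bigD1 b)//= dfwith_id Le' mulr1 big1 ?addr0 => [|c cb].
      by rewrite /X bracket_dfwith de addNr.
    rewrite (alt_eq hA cb) ?mulr0//.
    by rewrite dfwithin dfwithout// eq_sym.
  have -> : x = fun q => \sum_(b <- enum 'I_k.+1) X b * e b q + r q.
    apply/funext => q; rewrite /r big_enum/= addrA -big_split/= big1 ?add0r// => b _.
    by rewrite mulNr subrr.
  have Ae b : A (dfwith w i (e b)) p = 0 by apply: HG; split=> //; left; exists b.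
  have Ar : A (dfwith w i r) p = 0 by apply: HG; split=> //; right.
  elim: (enum _) => [|b s IH].
    have E0 : (fun q => \sum_(b <- [::]) X b * e b q + r q) = r.
      apply/funext => q; rewrite big_nil; exact: add0r.
    rewrite E0; exact: Ar.
  have -> : (fun q => \sum_(b <- b :: s) X b * e b q + r q) =
      fun q => X b * e b q + (\sum_(b <- s) X b * e b q + r q).
    by apply/funext => q; rewrite big_cons -addrA.
  rewrite A_lin//; last exact: smoothD.
  by rewrite Ae mulr0 add0r IH.
pose h i := match fintype.split i with inl j => u (lift ord_max j) | inr j => g j end.
have sh : smoothh h by move=> i; rewrite /h; case: fintype.split => j.
have := key h sh; rewrite /A.
have -> : rpart h = g by apply/funext => j; rewrite /rpart /h (unsplitK (inr j)).
move=> <-; apply: jacobiator_ext => j.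
by rewrite /lpart liftK /h (unsplitK (inl j)).
Qed.

End FromContractions.

(** * Contraction with df *)

Section Contraction.
Variables (R : realType) (m : nat) (M : manifold R m) (j : nat).
Variable L : forall p : M, multivector j.+2 p.
Arguments L : clear implicits.
Hypothesis hL : multivector_field L.

Local Notation fc := (@fcons _ j.+2).

Lemma fcons_lift (T : Type) (x : T) (w : 'I_j.+1 -> T) i :
  (fc x w   : 'I_j.+2 -> T) (lift ord0 i) = w i.
Proof.
by rewrite /fcons /= valK.
Qed.

Lemma fcons_dfwith (T : Type) (x y : T) (w : 'I_j.+1 -> T) i :
  fc x (dfwith w i y) = dfwith (fc x w) (lift ord0 i) y :> ('I_j.+2 -> T).
Proof.
apply/funext => l; have [l' ->|->] := unliftP ord0 l; last first.
  by rewrite dfwithout.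
rewrite fcons_lift; have [->|li] := eqVneq l' i; first by rewrite !dfwithin.
have il : i != l' by rewrite eq_sym.
by rewrite !dfwithout ?(inj_eq (@lift_inj _ _))// fcons_lift.
Qed.

Lemma fcons_map (T S : Type) (F : T -> S) (x : T) (w : 'I_j.+1 -> T) :
  (fun a => F ((fc x w : 'I_j.+2 -> T) a)) = fc (F x) (fun a => F (w a)).
Proof.
by apply/funext => l; have [l' ->|->] := unliftP ord0 l; rewrite ?fcons_lift.
Qed.

Lemma interior_productE f p w :
  interior_product L f w = L p (fc (differential f p) w).
Proof. by []. Qed.

Lemma bracket_interior f (g : 'I_j.+1 -> M -> R) :
  bracket (k := j.+1) (interior_product L f) g = bracket L (fc f g).
Proof.
apply/funext => p; rewrite /bracket interior_productE; congr (L p _).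
by rewrite (fcons_map (fun h => differential h p)).
Qed.

Lemma interior_multivector_field f : smooth f ->
  multivector_field (k := j.+1) (interior_product L f).
Proof.
move=> sf; split=> [p|c ac I].
  have hA := alt_at hL p.
  split=> [w i a x y|w i l il wil].
    rewrite !interior_productE !fcons_dfwith; exact: (alt_lin _ _ _ _ _ hA).
  rewrite interior_productE; apply: (@alt_eq _ _ _ (L p) _ (lift ord0 i) (lift ord0 l) hA).
    by rewrite (inj_eq (@lift_inj _ _)).
  by rewrite !fcons_lift.
have := @bracket_smooth_on _ _ _ _ _ hL c (fc f (fun a => coord c (I a))) ac.
rewrite -bracket_interior; apply.
move=> i; have [l ->|->] := unliftP ord0 i; last exact: sf.
rewrite fcons_lift; exact: smooth_on_coord_cinv.
Qed.

(** The right side has one more summand, of index 0; its inner bracket contains [f] twice and is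
    zero. *)
Lemma jacobiator_interior f (u g : 'I_j.+1 -> M -> R) p :
  jacobiator (interior_product L f : forall p : M, multivector j.+1 p) u g p =
  jacobiator L (fc f u) (fc f g) p.
Proof.
have maxE : ord_max = lift ord0 ord_max :> 'I_j.+2 by exact: val_inj.
have E x : dfwith (fc f u : 'I_j.+2 -> _) ord_max x = fc f (dfwith u ord_max x).
  by rewrite fcons_dfwith maxE.
rewrite /jacobiator !bracket_interior E; congr (_ - _).
rewrite [RHS]big_ord_recl /= [X in _ = X + _](_ : _ = 0) ?add0r.
  apply: eq_bigr => i _; rewrite !bracket_interior fcons_dfwith E.
  by rewrite fcons_lift.
have Z : bracket L (dfwith (fc f u : 'I_j.+2 -> M -> R) ord_max f) = fun=> 0.
  apply: (@bracket_eq_fun _ _ _ _ _ hL _ ord0 ord_max) => //.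
  by rewrite dfwithin dfwithout.
apply: bracket_diff0 => //; rewrite Z; exact: differential_cst.
Qed.

(** When [u] and [g] begin with the same function, their Jacobiator is that of a contraction. This
    is the only input that [jacobiator_of_contractions] asks for. *)
Lemma nambu_poisson_contractions : (0 < j)%N ->
  nambu_poisson L <-> (forall f : M -> R, smooth f -> nambu_poisson (interior_product L f)).
Proof.
move=> j0; split=> [/nambu_poissonE - /(_ hL)[_ H] f sf|H].
  apply/(@nambu_poissonE _ _ _ _ (interior_product L f : forall p : M, multivector j.+1 p)).
    exact: interior_multivector_field.
  split=> // u g su sg p; rewrite jacobiator_interior.
  have sm (w : 'I_j.+1 -> M -> R) : (forall i, smooth (w i)) ->
      forall i, smooth ((fc f w : 'I_j.+2 -> M -> R) i).
    by move=> sw i; have [l ->|->] := unliftP ord0 i; rewrite ?fcons_lift.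
  by apply: H; exact: sm.
apply/nambu_poissonE => //; split=> // u g su sg p.
apply: jacobiator_of_contractions => // {u g su sg p} u g su sg ug p.
have E (w : 'I_j.+2 -> M -> R) : w = fc (w ord0) (fun i => w (lift ord0 i)).
  by apply/funext => i; have [l ->|->] := unliftP ord0 i; rewrite ?fcons_lift.
rewrite (E u) (E g) ug -jacobiator_interior.
have := H _ (sg ord0).
move=> /(@nambu_poissonE _ _ _ _ (interior_product L (g ord0) : forall p : M, multivector j.+1 p)).
by move=> /(_ (interior_multivector_field (sg ord0))) [_]; apply.
Qed.

End Contraction.

(** * The local form *)

Section Dual.
Variable R : realType.

(** The chain rule for [phi \o psi], the identity on [V']: in the coordinates [phi], the field [X i]
    is the coordinate field of index [i]. *)
Lemma rectified_coordinates m n (hnm : (n <= m)%N) (V V' : set 'rV[R]_m)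
    (X : 'I_n -> 'rV[R]_m -> 'rV[R]_m) (phi psi : 'rV[R]_m -> 'rV[R]_m) :
  open V -> open V' -> (forall x, V x -> V' (phi x)) -> (forall y, V' y -> V (psi y)) ->
  (forall x, V x -> psi (phi x) = x) -> (forall y, V' y -> phi (psi y) = y) ->
  smooth_map V phi -> smooth_map V' psi ->
  (forall y, V' y -> forall i l,
     partial (widen_ord hnm i) (fun y => psi y 0 l) y = X i (psi y) 0 l) ->
  forall x, V x -> forall i j,
    \sum_l partial l (fun x => phi x 0 j) x * X i x 0 l = (j == widen_ord hnm i)%:R.
Proof.
move=> oV oV' VV' V'V phiK psiK sphi spsi PX x Vx i j.
have V'x := VV' _ Vx.
have Vpx : V (psi (phi x)) by rewrite phiK.
have d l : derivable (fun y => psi y 0 l) (phi x) (delta_mx 0 (widen_ord hnm i)).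
  exact: (smooth_on_derivable (spsi l) V'x).
have := @partial_comp R m m V (fun x => phi x 0 j) psi (phi x) (widen_ord hnm i) oV Vpx (sphi j 1%N) d.
rewrite phiK// => E.
have <- : partial (widen_ord hnm i) ((fun x => phi x 0 j) \o psi) (phi x) = (j == widen_ord hnm i)%:R.
  rewrite -(partial_coord (phi x) (widen_ord hnm i) j).
  by apply: (eq_partial _ oV') => // y Vy /=; rewrite psiK.
by rewrite E; apply: eq_bigr => l _; rewrite PX// phiK.
Qed.

End Dual.

(** * Adapted coordinates at a regular point *)

Section LocalForm.
Variables (R : realType) (m : nat) (M : manifold R m) (k : nat).
Variable L : forall p : M, multivector k.+1 p.
Arguments L : clear implicits.
Hypothesis hL : multivector_field L.
Hypothesis k1 : (1 < k)%N.
Hypothesis jac0 : forall u g : 'I_k.+1 -> M -> R,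
  (forall i, smooth (u i)) -> (forall i, smooth (g i)) -> forall p, jacobiator L u g p = 0.

Lemma star_everywhere p : star_at L p.
Proof.
apply: star_of_jacobiator => // u g a x su sg sx _ _.
by apply: jac0 => //; apply: smooth_dfwith => //; exact: smoothM.
Qed.

(** Transposing [i] with the last slot of [u] changes the sign of both sides. *)
Lemma jacobi_slot i (u g : 'I_k.+1 -> M -> R) p :
  (forall i, smooth (u i)) -> (forall i, smooth (g i)) ->
  bracket L (dfwith u i (bracket L g)) p =
  \sum_l bracket L (dfwith g l (bracket L (dfwith u i (g l)))) p.
Proof.
move=> su sg; have [->|im] := eqVneq i ord_max.
  by have /eqP := jac0 su sg p; rewrite /jacobiator subr_eq0 => /eqP.
pose s := tperm i ord_max; pose u' := u \o s.
have su' l : smooth (u' l) by exact: su.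
have uE x q : bracket L (dfwith u' ord_max x) q = - bracket L (dfwith u i x) q.
  rewrite /bracket -(alt_tperm _ (alt_at hL q) im); congr (L q _); apply/funext => l /=.
  have [->|lm] := eqVneq l ord_max; first by rewrite tpermR !dfwithin.
  rewrite dfwithout 1?eq_sym// /u' /= dfwithout//.
  by rewrite -[X in X != _](tpermR i ord_max) -/s (inj_eq perm_inj) eq_sym.
have := jac0 su' sg p; rewrite /jacobiator uE => /eqP; rewrite subr_eq0 => /eqP E.
apply: oppr_inj; rewrite E -sumrN; apply: eq_bigr => l _.
have -> : bracket L (dfwith u' ord_max (g l)) = fun q => -1 * bracket L (dfwith u i (g l)) q.
  by apply/funext => q; rewrite uE mulN1r.
rewrite !bracket_dfwith differentialZ; last exact: smooth_bracket_dfwith.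
by rewrite (altZ _ _ _ _ (alt_at hL p)) mulN1r.
Qed.

Variable p : M.
Hypothesis rp : regular_point L p.
Let c0 := chart_at p.
Let ac0 : atlas c0 := chart_at_atlas p.
Let cp : cdom c0 p := chart_at_dom p.
Let x0 := cmap c0 p.

(** The Nambu identity is available for global functions only, so the coordinates of the chart at
    [p] are extended to [M], with a common neighbourhood of agreement. *)
Lemma global_coordinates : exists (Y : 'I_m -> M -> R) (U : set M),
  [/\ forall l, smooth (Y l), open U, U p, U `<=` cdom c0 &
      forall l q, U q -> Y l q = coord c0 l q].
Proof.
have H l := smooth_extension ac0 cp (@cod_open _ _ _ c0) (@subset_refl _ _) (cmap_cod cp)
  (@smooth_on_coord_cinv R m M c0 l).
have /choice[Y HY] := H.
have /choice[U HU] := fun l => (HY l).2.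
have N l : \forall q \near p, U l q.
  by have [oU Up _ _] := HU l; exact: open_nbhs_nbhs.
have N' : nbhs p [set q | forall l, U l q] by exact: (filter_forall _ N).
exists Y, (interior [set q | forall l, U l q] `&` cdom c0); split.
- by move=> l; case: (HY l).
- by apply: openI; [exact: open_interior|exact: cdom_open].
- by split.
- by move=> q [].
- move=> l q [/interior_subset Uq _].
  by have [_ _ _] := HU l; apply.
Qed.

Lemma nonzero_coordinates : exists I : 'I_k.+1 -> 'I_m,
  L p (fun a => delta_mx (I a) 0 : 'cV[R]_m) <> 0.
Proof.
apply: contrapT => H; apply: rp; apply/funext => w.
have hA := alt_at hL p.
apply: (@slots_ind k.+1 'cV[R]_m (fun v => exists i, v = delta_mx i 0) (fun=> True)
  (fun w => L p w = 0)) => // {w} [w /choice[I HI]|w i v _ _ Hv].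
  apply: contrapT => Lw; apply: H; exists I.
  by rewrite (_ : (fun a => _) = w)//; apply/funext => a; rewrite HI.
have -> : v = \sum_j v j 0 *: delta_mx j 0.
  rewrite {1}(matrix_sum_delta v); apply: eq_bigr => j _.
  by rewrite big_ord1.
rewrite (alt_sum _ _ _ _ _ _ hA) big1// => j _.
by rewrite (Hv (delta_mx j 0)) ?mulr0//; exists j.
Qed.

Section WithCoordinates.
Variables (Y : 'I_m -> M -> R) (U : set M).
Hypothesis sY : forall l, smooth (Y l).
Hypothesis oU : open U.
Hypothesis Up : U p.
Hypothesis Uc : U `<=` cdom c0.
Hypothesis YE : forall l q, U q -> Y l q = coord c0 l q.

(** [h] need only be smooth on an open set [A] of coordinates, which admits rectifying coordinates
    and those of another chart. *)
Lemma bracket_chart (w : 'I_k.+1 -> M -> R) i (A : set 'rV[R]_m) (h : M -> R) q :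
  open A -> A `<=` cod c0 -> smooth_on A (h \o cinv c0) -> U q -> A (cmap c0 q) ->
  bracket L (dfwith w i h) q =
  \sum_l partial l (h \o cinv c0) (cmap c0 q) * bracket L (dfwith w i (Y l)) q.
Proof.
move=> oA Ac sh Uq Aq.
have tr := atlas_compatible (chart_at_atlas q) ac0.
rewrite bracket_dfwith (differentialE tr oA Ac sh (Uc Uq) Aq).
rewrite (alt_sum _ _ _ _ _ _ (alt_at hL q)); apply: eq_bigr => l _.
rewrite bracket_dfwith (eq_differential oU Uq (YE l))//.
Qed.

Lemma bracket_chart_smooth (w : 'I_k.+1 -> M -> R) i (h : M -> R) q :
  smooth h -> U q -> bracket L (dfwith w i h) q =
  \sum_l partial l (h \o cinv c0) (cmap c0 q) * bracket L (dfwith w i (Y l)) q.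
Proof.
move=> sh Uq; apply: (bracket_chart w i (@cod_open _ _ _ c0)) => //.
  exact: sh.
exact/cmap_cod/Uc.
Qed.

Let V := cod c0 `&` cinv c0 @^-1` U.

Let oV : open V. Proof. exact: open_chart_preimage. Qed.
Let Vx0 : V x0. Proof. by split; [exact: cmap_cod|rewrite /= cmapK]. Qed.

(** Near [p], the components in the chart [c0] of the vector field sending [h] to the bracket of [w]
    with [h] in slot [i]. *)
Definition hamiltonian (w : 'I_k.+1 -> M -> R) i (x : 'rV[R]_m) : 'rV[R]_m :=
  \row_l bracket L (dfwith w i (Y l)) (cinv c0 x).

Lemma smooth_hamiltonian (W : set 'rV[R]_m) w i : W `<=` cod c0 -> (forall i, smooth (w i)) ->
  smooth_map W (hamiltonian w i).
Proof.
move=> WV sw l; under eq_fun do rewrite mxE.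
apply: (smooth_on_subset WV).
have := @smooth_bracket_dfwith _ _ _ _ _ hL w i (Y l) sw (sY l).
exact.
Qed.

(* First rectification: a Hamiltonian vector field {., y_2, ..., y_n} is made
   into a coordinate field, which yields y_1 with {y_1, ..., y_n} = 1. *)
Lemma unit_bracket : exists (f : 'I_k.+1 -> M -> R) (U' : set M),
  [/\ forall i, smooth (f i), open U', U' p, U' `<=` U &
      forall q, U' q -> bracket L f q = 1].
Proof.
have [I LI] := nonzero_coordinates.
pose g a := Y (I a).
have sg a : smooth (g a) by exact: sY.
have dY l : differential (Y l) p = delta_mx l 0 :> 'cV[R]_m.
  by rewrite (eq_differential oU Up (YE l)) differential_coord_chart_at.
have bg : bracket L g p <> 0.
  by rewrite bracketE (_ : diffs g p = fun a => delta_mx (I a) 0)//; apply/funext => a; exact: dY.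
pose X (i : 'I_1) := hamiltonian g ord0.
have sX i : smooth_map V (X i) by apply: smooth_hamiltonian => // x [].
have cX : commuting V X by move=> x _ i q l; rewrite (ord1 i) (ord1 q).
have fX : row_free (\matrix_(i, j) X i x0 0 j).
  rewrite /row_free rank_rV eqb1; apply/eqP => /matrixP/(_ 0 (I ord0)).
  rewrite !mxE cmapK//; have -> : dfwith g ord0 (Y (I ord0)) = g by rewrite dfwith_id.
  by move/bg.
have [h1m [V1 [V1' [phi [psi [[oV1 oV1' V1x V1V] [h1 h2 h3 h4] sphi spsi PX]]]]]] :=
  rectification oV Vx0 sX cX fX.
pose i0 := widen_ord h1m ord0.
have D := rectified_coordinates oV1 oV1' h1 h2 h3 h4 sphi spsi PX.
(* The coordinate along the rectified field: the field applied to it gives 1. It is defined near [p]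
   only and extended by [F]. *)
pose f1 q := phi (cmap c0 q) 0 i0.
have V1c : V1 `<=` cod c0 by move=> x /V1V[].
have f1E x : V1 x -> (f1 \o cinv c0) x = phi x 0 i0.
  by move=> Vx; rewrite /f1 /= cinvK//; exact: V1c.
have sf1 : smooth_on V1 (f1 \o cinv c0).
  by apply: (eq_smooth_on oV1 _ (sphi i0)) => x /f1E ->.
have [F [sF [U1 [oU1 U1p U1c FE]]]] := smooth_extension ac0 cp oV1 V1c V1x sf1.
pose f := dfwith g ord0 F.
exists f, (U1 `&` U `&` (cdom c0 `&` cmap c0 @^-1` V1)); split.
- by move=> i; exact: smooth_dfwith.
- apply: openI; first exact: openI.
  exact: open_chart_image.
- by split; split.
- by move=> q [[]].
- move=> q [[U1q Uq] [cq Vq]].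
  have -> : bracket L f q = bracket L (dfwith g ord0 f1) q.
    by rewrite /f !bracket_dfwith (eq_differential oU1 U1q FE).
  rewrite (bracket_chart g ord0 oV1 V1c sf1 Uq Vq).
  have := D _ Vq ord0 i0; rewrite eqxx => E; rewrite -[RHS]E; apply: eq_bigr => l _.
  rewrite mxE cmapK//; congr (_ * _).
  by apply: (eq_partial l oV1) => // x /f1E.
Qed.

(** Applying field [a] to component [l] of field [b] gives a nested bracket with [Y l]. In its
    expansion by the Jacobi identity, every summand but the one containing [Y l] has as inner
    bracket that of [f] with [f r] in slot [i], which is constantly 1 or 0 near the point. The
    remaining summand is the nested bracket with [a] and [b] exchanged. *)
Lemma commuting_hamiltonians (f : 'I_k.+1 -> M -> R) (U' : set M) :
  (forall i, smooth (f i)) -> open U' -> U' `<=` U ->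
  (forall q, U' q -> bracket L f q = 1) ->
  commuting (cod c0 `&` cinv c0 @^-1` U') (hamiltonian f).
Proof.
move=> sf oU' U'U f1 x [cx U'x] i j l.
set q := cinv c0 x in U'x *.
have xE : x = cmap c0 q by rewrite /q cinvK.
have Uq := U'U _ U'x.
have E a b : \sum_r hamiltonian f a x 0 r * partial r (fun x => hamiltonian f b x 0 l) x =
    bracket L (dfwith f a (bracket L (dfwith f b (Y l)))) q.
  rewrite bracket_chart_smooth//; last exact: smooth_bracket_dfwith.
  rewrite -xE; apply: eq_bigr => r _; rewrite mxE mulrC; congr (partial r _ x * _).
  by apply/funext => z; rewrite mxE.
have sg : forall a, smooth (dfwith f j (Y l) a) by exact: smooth_dfwith.
apply: (etrans (E i j)); apply: (etrans _ (esym (E j i))).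
apply: (etrans (jacobi_slot i q sf sg)).
rewrite (bigD1 j)//= dfwithin dfwith_dfwith big1 ?addr0// => r rj.
rewrite (dfwithout _ _ (_ : j != r)); last by rewrite eq_sym.
apply: bracket_diff0 => //.
have [<-|ir] := eqVneq i r.
  rewrite dfwith_id (eq_differential oU' U'x f1).
  exact: differential_cst.
rewrite (@bracket_eq_fun _ _ _ _ _ hL _ i r)//; first exact: differential_cst.
by rewrite dfwithin dfwithout.
Qed.

(** The fields are dual at [p] to the differentials of the [f j]: field [i] applied to [f j] is the
    bracket of [f] with [f j] in slot [i], that is 1 or 0. *)
Lemma free_hamiltonians (f : 'I_k.+1 -> M -> R) :
  (forall i, smooth (f i)) -> bracket L f p = 1 ->
  row_free (\matrix_(i, j) hamiltonian f i x0 0 j).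
Proof.
move=> sf f1; apply: inj_row_free => v v0; apply/rowP => j; rewrite mxE.
have E i : bracket L (dfwith f i (f j)) p = (i == j)%:R.
  have [->|ij] := eqVneq i j; first by rewrite dfwith_id f1.
  by rewrite (@bracket_eq_fun _ _ _ _ _ hL _ i j)// dfwithin dfwithout.
rewrite -(sum_delta (fun i => v 0 i) j).
transitivity (\sum_l partial l (f j \o cinv c0) x0 *
    (v *m (\matrix_(i, j) hamiltonian f i x0 0 j)) 0 l); last first.
  by rewrite v0 big1// => l _; rewrite mxE mulr0.
under eq_bigr => i _ do rewrite -E bracket_chart_smooth// mulr_sumr.
rewrite exchange_big/=; apply: eq_bigr => l _.
rewrite mxE mulr_sumr; apply: eq_bigr => i _.
by rewrite !mxE cmapK// mulrCA.
Qed.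

(** The chart is [c0] followed by the rectifying map [phi]. As the bracket of [f] is 1 on its
    domain, [decomposable_at] at [diffs f q] has the factor 1, and its matrix entries are the
    pairings of the arguments with the rectified fields. *)
Lemma local_form_in : exists (hnm : (k.+1 <= m)%N) (c : chart R m M),
  [/\ local_coordinates c, cdom c p &
      forall q, cdom c q ->
        L q = wedge (fun i : 'I_k.+1 => coord_vector c (widen_ord hnm i) q)].
Proof.
have [f [U' [sf oU' U'p U'U f1]]] := unit_bracket.
pose W := cod c0 `&` cinv c0 @^-1` U'.
have oW : open W by exact: open_chart_preimage.
have Wx0 : W x0 by split; [exact: cmap_cod|rewrite /= cmapK].
have sX i : smooth_map W (hamiltonian f i) by apply: smooth_hamiltonian => // x [].
have cX := commuting_hamiltonians sf oU' U'U f1.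
have fX := free_hamiltonians sf (f1 _ U'p).
have [hnm [V1 [V1' [phi [psi [[oV1 oV1' V1x V1W] [h1 h2 h3 h4] sphi spsi PX]]]]]] :=
  rectification oW Wx0 sX cX fX.
have V1c x : V1 x -> cod c0 x by move=> /V1W[].
pose D := cdom c0 `&` cmap c0 @^-1` V1.
have oD : open D by exact: open_chart_image.
have Dcod q : D q -> V1' ((phi \o cmap c0) q) by move=> [_ /h1].
have Ddom x : V1' x -> D ((cinv c0 \o psi) x).
  move=> /h2 Vx; split=> /=; first exact/cinv_dom/V1c.
  by rewrite cinvK//; exact: V1c.
have DK q : D q -> (cinv c0 \o psi) ((phi \o cmap c0) q) = q.
  by move=> [cq Vq] /=; rewrite h3// cmapK.
have D'K x : V1' x -> (phi \o cmap c0) ((cinv c0 \o psi) x) = x.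
  by move=> Vx /=; rewrite cinvK ?h4//; exact/V1c/h2.
have Dc q : D q -> {for q, continuous (phi \o cmap c0)}.
  move=> [cq Vq]; apply: continuous_comp; first exact: cmap_continuous.
  exact: smooth_map_cont sphi Vq.
have D'c x : V1' x -> {for x, continuous (cinv c0 \o psi)}.
  move=> Vx; apply: continuous_comp; first exact: smooth_map_cont spsi Vx.
  exact/cinv_continuous/V1c/h2.
pose c := Chart oD oV1' Dcod Ddom DK D'K Dc D'c.
exists hnm, c; split; last first.
- move=> q [cq Vq]; set x := cmap c0 q in Vq.
  have [_ /= U'q] := V1W _ Vq; rewrite cmapK// in U'q.
  have Uq := U'U _ U'q.
  have hA := alt_at hL q.
  have Lf : L q (diffs f q) = 1 by exact: f1.
  have l0 : L q (diffs f q) != 0 by rewrite Lf oner_eq0.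
  apply/funext => w; have := decomposable_at hL k1 w (star_everywhere q) l0.
  rewrite Lf expr1n mul1r => ->; rewrite /wedge; congr (\det _).
  apply/matrixP => a b; rewrite !mxE.
  pose vb := coord_vector c (widen_ord hnm b) q.
  (* Vectors and covectors at [q] are represented in [chart_at q], which varies with [q]. The
     components are compared there by the chain rule through [psi], whose partial derivative of
     index [b] is the field. *)
  have key j : L q (dfwith (diffs f q) b (delta_mx j 0 : 'cV[R]_m)) = vb 0 j.
    rewrite -(differential_coord_chart_at q j) -bracket_dfwith.
    pose A := cod c0 `&` cinv c0 @^-1` cdom (chart_at q).
    have oA : open A by exact: open_chart_preimage (@cdom_open _ _ _ _).
    have Ac : A `<=` cod c0 by move=> z [].
    have sA : smooth_on A (coord (chart_at q) j \o cinv c0).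
      exact: (atlas_compatible ac0 (chart_at_atlas q)).
    have Aq : A x by split; [exact: cmap_cod|rewrite /= cmapK//; exact: chart_at_dom].
    rewrite (bracket_chart f b oA Ac sA Uq Aq) mxE /=.
    have V'y := h1 _ Vq.
    have d l : derivable (fun y => psi y 0 l) (phi x) (delta_mx 0 (widen_ord hnm b)).
      exact: (smooth_on_derivable (spsi l) V'y).
    have Apsi : A (psi (phi x)) by rewrite h3.
    have := @partial_comp R m m A (coord (chart_at q) j \o cinv c0) psi (phi x)
      (widen_ord hnm b) oA Apsi (sA 1%N) d.
    rewrite h3// => E.
    transitivity (partial (widen_ord hnm b) ((coord (chart_at q) j \o cinv c0) \o psi) (phi x)); last by [].
    rewrite E; apply: eq_bigr => l _; congr (_ * _).
    by rewrite PX// h3// mxE cmapK.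
  have lin (v : 'cV[R]_m) : L q (dfwith (diffs f q) b v) = \sum_j v j 0 * vb 0 j.
    have -> : v = \sum_j v j 0 *: delta_mx j 0.
      rewrite {1}(matrix_sum_delta v); apply: eq_bigr => j _.
      by rewrite big_ord1.
    rewrite (alt_sum _ _ _ _ _ _ hA); apply: eq_bigr => j _.
    rewrite key; congr (_ * _); rewrite summxE (bigD1 j)//= big1 ?addr0; last first.
      by move=> i ij; rewrite !mxE eq_sym (negPf ij) mulr0.
    by rewrite !mxE !eqxx mulr1.
  by rewrite lin /pairing mxE; apply: eq_bigr => j _; rewrite mulrC.
- by split.
(* The transition maps are those between [c0] and [c'], composed with [psi] or [phi]. *)
move=> c' ac'; split=> j.
- have tr := atlas_compatible ac0 ac'.
  have oT := open_chart_preimage (c := c0) (@cdom_open _ _ _ c').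
  apply: (@smooth_on_comp R m m _ _ (fun z => cmap c' (cinv c0 z) 0 j) psi oT _ _ _ (tr j)).
  + exact: open_chart_preimage (@cdom_open _ _ _ c').
  + by move=> y [/h2/V1c Vy dy]; split.
  + by move=> l; apply: smooth_on_subset (spsi l) => y [].
- have tr := atlas_compatible ac' ac0.
  apply: (@smooth_on_comp R m m V1 _ (fun z => phi z 0 j) (fun z => cmap c0 (cinv c' z)) oV1 _ _ _ (sphi j)).
  + exact: open_chart_preimage.
  + by move=> y [_ [_]].
  + by move=> l; apply: smooth_on_subset (tr l) => y [cy [dy _]].
Qed.

End WithCoordinates.

Theorem local_form : exists (hnm : (k.+1 <= m)%N) (c : chart R m M),
  [/\ local_coordinates c, cdom c p &
      forall q, cdom c q ->
        L q = wedge (fun i : 'I_k.+1 => coord_vector c (widen_ord hnm i) q)].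
Proof.
have [Y [U [sY oU Up Uc YE]]] := global_coordinates.
exact: local_form_in sY oU Up Uc YE.
Qed.

End LocalForm.

Theorem theorem1 (R : realType) (m : nat) (M : manifold R m) (n : nat)
    (hn : (2 < n)%N) (L : forall p : M, multivector n p)
    (hL : multivector_field L) :
  (nambu_poisson L <->
   (forall f : M -> R, smooth f -> nambu_poisson (interior_product L f))) /\
  (nambu_poisson L ->
   forall p : M, regular_point L p ->
   exists (hnm : (n <= m)%N) (c : chart R m M),
     [/\ local_coordinates c,
         cdom c p &
         forall q : M, cdom c q ->
           L q = wedge (fun i : 'I_n => coord_vector c (widen_ord hnm i) q)]).
Proof.
case: n hn L hL => [//|[//|n]] n1 L hL; split; first exact: nambu_poisson_contractions.
move=> /(nambu_poissonE hL)[_ jac0] p rp.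
exact: (local_form hL _ jac0 rp).
Qed.
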